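(* Let $\pi\colon X\to\mathbf{P}^{2}_{\mathbf{C}}$ be the blowup in $10$ general points, with $H$ the pullback of the class of a line and $E_{1},\dots,E_{10}$ the exceptional divisors, and let $F:=-19H+6\sum_{l=1}^{10}E_{l}$. Let $C$ be the unique curve (effective divisor) in $|-3F|$. Then $C$ is reduced and irreducible.
   Context: ''General'' means: for each divisor class $D=dH-\sum m_{l}E_{l}$ ($d,m_{l}\ge 0$) in a suitable finite list (including $-3F=57H-18\sum_l E_l$, all classes $d'H-\sum m_l'E_l$ with $0\le d'\le 57$, $0\le m'_l\le 18$, and $-3F-E_{j}$), $\dim|D|$ is minimal among all choices of $10$ points in $\mathbf{P}^2$; in particular the tuple of points may be taken in a suitable nonempty Zariski open subset of $(\mathbf{P}^{2})^{10}$. For such points $\dim|-3F|=0$, so $C$ is well defined. *)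

(* Defs.v *)
From mathcomp Require Import all_boot all_order all_algebra.
From mathcomp Require Import boolp classical_sets functions cardinality reals.
From mathcomp Require Import complex mpoly.

Set Implicit Arguments.
Unset Strict Implicit.
Unset Printing Implicit Defensive.

Import Order.TTheory GRing.Theory Num.Theory.
Local Open Scope classical_set_scope.
Local Open Scope ring_scope.

(* Points of P^2 and of the dual plane are given by nonzero vectors of
    homogeneous coordinates.  The blowup X of P^2 in distinct points
    p_1, ..., p_r is the subvariety

      { (x, L_1, ..., L_r) | L_l is a line through p_l and x }

    of P^2 x (P^2^* )^r; the blowdown pi is the first projection, and the fibre
    of pi over p_l is the P^1 of lines through p_l.  A point of X is given by an
    (r + 1) x 3 matrix of multihomogeneous coordinates: row 0 is x and
    row l + 1 is L_l.  Subsets of X are handled as sets of such matrices that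
    are stable under rescaling of the individual rows. *)

Definition same_point (K : fieldType) (u v : 'rV[K]_3) : Prop :=
  exists2 c : K, c != 0 & u = c *: v.

Definition distinct_points (K : fieldType) (r : nat) (p : 'I_r -> 'rV[K]_3) :
    Prop :=
  (forall l, p l != 0) /\ (forall l j, same_point (p l) (p j) -> l = j).

Definition incident (K : fieldType) (L x : 'rV[K]_3) : Prop :=
  \sum_(j < 3) L 0 j * x 0 j = 0.

Definition blowup (K : fieldType) (r : nat) (p : 'I_r -> 'rV[K]_3) :
    set 'M[K]_(r.+1, 3) :=
  [set M | (forall i, row i M != 0) /\
           forall l : 'I_r, incident (row (lift ord0 l) M) (p l) /\
                            incident (row (lift ord0 l) M) (row ord0 M)].

Definition exceptional (K : fieldType) (r : nat) (p : 'I_r -> 'rV[K]_3)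
    (l : 'I_r) : set 'M[K]_(r.+1, 3) :=
  [set M | blowup p M /\ same_point (row ord0 M) (p l)].

Definition mxeval (K : fieldType) (r : nat) (A : {mpoly K[r.+1 * 3]})
    (M : 'M[K]_(r.+1, 3)) : K :=
  A.@[fun k => mxvec M 0 k].

Definition rescaling_stable (K : fieldType) (r : nat)
    (Z : set 'M[K]_(r.+1, 3)) : Prop :=
  forall (M : 'M[K]_(r.+1, 3)) (c : 'rV[K]_r.+1),
    (forall i, c 0 i != 0) -> Z M -> Z (diag_mx c *m M).

(* Over an infinite field, the rescaling-stable zero loci are exactly the zero
   loci of multihomogeneous polynomials. *)
Definition zariski_closed (K : fieldType) (r : nat) (p : 'I_r -> 'rV[K]_3)
    (Z : set 'M[K]_(r.+1, 3)) : Prop :=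
  rescaling_stable Z /\
  exists I : set {mpoly K[r.+1 * 3]},
    Z = [set M | blowup p M /\ forall A, I A -> mxeval A M = 0].

Definition irreducible_closed (K : fieldType) (r : nat)
    (p : 'I_r -> 'rV[K]_3) (Z : set 'M[K]_(r.+1, 3)) : Prop :=
  [/\ zariski_closed p Z, Z !=set0 &
      forall Z1 Z2, zariski_closed p Z1 -> zariski_closed p Z2 ->
        Z = Z1 `|` Z2 -> Z = Z1 \/ Z = Z2].

(* Maximality among the proper irreducible closed subsets is codimension one. *)
Definition prime_divisor (K : fieldType) (r : nat)
    (p : 'I_r -> 'rV[K]_3) (G : set 'M[K]_(r.+1, 3)) : Prop :=
  [/\ irreducible_closed p G, G <> blowup p &
      forall Z, irreducible_closed p Z -> G `<=` Z -> Z = G \/ Z = blowup p].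

Definition vanishing_ideal (K : fieldType) (r : nat)
    (Z : set 'M[K]_(r.+1, 3)) : set {mpoly K[r.+1 * 3]} :=
  [set A | forall M, Z M -> mxeval A M = 0].

Definition pullback (K : fieldType) (r : nat) (f : {mpoly K[3]})
    (M : 'M[K]_(r.+1, 3)) : K :=
  f.@[fun j => M ord0 j].

(* [f] lies in the n-th power of the maximal ideal of the local ring of X along
   [G]: in the coordinate ring of X, some multiple S * pi^* f with S not
   vanishing identically on [G] lies in the n-th power of the ideal of [G]. *)
Definition vanishes_to_order (K : fieldType) (r : nat)
    (p : 'I_r -> 'rV[K]_3) (G : set 'M[K]_(r.+1, 3)) (n : nat)
    (f : {mpoly K[3]}) : Prop :=
  exists (S : {mpoly K[r.+1 * 3]}) (N : nat)
         (T : 'I_N -> {mpoly K[r.+1 * 3]})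
         (A : 'I_N -> 'I_n -> {mpoly K[r.+1 * 3]}),
    [/\ ~ vanishing_ideal G S,
        forall k i, vanishing_ideal G (A k i) &
        forall M, blowup p M ->
          mxeval S M * pullback f M =
          \sum_(k < N) mxeval (T k) M * \prod_(i < n) mxeval (A k i) M].

(* For f != 0 and G a prime divisor of X there is exactly one such n. *)
Definition ord_along (K : fieldType) (r : nat) (p : 'I_r -> 'rV[K]_3)
    (G : set 'M[K]_(r.+1, 3)) (f : {mpoly K[3]}) : nat :=
  xget 0%N [set n | vanishes_to_order p G n f /\
                    ~ vanishes_to_order p G n.+1 f].

(* Divisors on X are finitely supported functions on its prime divisors,
   extended by zero to all sets of coordinate matrices. *)
Definition is_divisor (K : fieldType) (r : nat) (p : 'I_r -> 'rV[K]_3)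
    (D : set 'M[K]_(r.+1, 3) -> int) : Prop :=
  finite_set [set G | D G != 0] /\ forall G, D G != 0 -> prime_divisor p G.

Definition effective (K : fieldType) (r : nat) (p : 'I_r -> 'rV[K]_3)
    (D : set 'M[K]_(r.+1, 3) -> int) : Prop :=
  is_divisor p D /\ forall G, 0 <= D G.

(* The divisor pi^*(f = 0), for a nonzero form f on P^2: on the exceptional
   divisor E_l it has the multiplicity of f at p_l. *)
Definition div_pullback (K : fieldType) (r : nat) (p : 'I_r -> 'rV[K]_3)
    (f : {mpoly K[3]}) : set 'M[K]_(r.+1, 3) -> int :=
  fun G => if `[< prime_divisor p G >] then (ord_along p G f)%:Z else 0.

(* The rational functions on X are the pullbacks of the quotients f / g of forms
   of the same degree on P^2, since pi is birational. *)
Definition lin_equiv (K : fieldType) (r : nat) (p : 'I_r -> 'rV[K]_3)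
    (D D' : set 'M[K]_(r.+1, 3) -> int) : Prop :=
  exists (k : nat) (f g : {mpoly K[3]}),
    [/\ f != 0, g != 0, f \is k.-homog, g \is k.-homog &
        D - D' = div_pullback p f - div_pullback p g].

Definition complete_linear_system (K : fieldType) (r : nat)
    (p : 'I_r -> 'rV[K]_3) (D : set 'M[K]_(r.+1, 3) -> int) :
    set (set 'M[K]_(r.+1, 3) -> int) :=
  [set C | effective p C /\ lin_equiv p C D].

(* The space H^0(X, O(D)) of rational functions phi with phi = 0 or
   div(phi) + D >= 0 contains n linearly independent elements f_i / g, written
   with a common denominator. *)
Definition h0_ge (K : fieldType) (r : nat) (p : 'I_r -> 'rV[K]_3)
    (D : set 'M[K]_(r.+1, 3) -> int) (n : nat) : Prop :=
  exists (k : nat) (g : {mpoly K[3]}) (f : 'I_n -> {mpoly K[3]}),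
    [/\ g != 0, g \is k.-homog, forall i, f i \is k.-homog,
        forall c : 'I_n -> K, \sum_(i < n) c i *: f i = 0 -> forall i, c i = 0 &
        forall i G, 0 <= (div_pullback p (f i) - div_pullback p g + D) G].

Definition h0 (K : fieldType) (r : nat) (p : 'I_r -> 'rV[K]_3)
    (D : set 'M[K]_(r.+1, 3) -> int) : nat :=
  xget 0%N [set n | h0_ge p D n /\ ~ h0_ge p D n.+1].

(* dim |D|, equal to -1 when |D| is empty. *)
Definition dim_linear_system (K : fieldType) (r : nat) (p : 'I_r -> 'rV[K]_3)
    (D : set 'M[K]_(r.+1, 3) -> int) : int :=
  (h0 p D)%:Z - 1.

Definition support (K : fieldType) (r : nat)
    (D : set 'M[K]_(r.+1, 3) -> int) : set 'M[K]_(r.+1, 3) :=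
  [set M | exists2 G, D G != 0 & G M].

(* X is a smooth surface: an effective divisor is generically reduced along each
   component, hence reduced, exactly when all its coefficients are at most 1. *)
Definition reduced_divisor (K : fieldType) (r : nat)
    (D : set 'M[K]_(r.+1, 3) -> int) : Prop :=
  forall G, D G <= 1.

Definition irreducible_divisor (K : fieldType) (r : nat)
    (p : 'I_r -> 'rV[K]_3) (D : set 'M[K]_(r.+1, 3) -> int) : Prop :=
  irreducible_closed p (support D).

(* The pullback of the line x_0 = 0, representing the class H. *)
Definition divH (K : fieldType) (r : nat) (p : 'I_r -> 'rV[K]_3) :
    set 'M[K]_(r.+1, 3) -> int :=
  div_pullback p ('X_ord0 : {mpoly K[3]}).

Definition divE (K : fieldType) (r : nat) (p : 'I_r -> 'rV[K]_3) (l : 'I_r) :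
    set 'M[K]_(r.+1, 3) -> int :=
  fun G => (`[< G = exceptional p l >] : nat)%:Z.

Definition div_class (K : fieldType) (r : nat) (p : 'I_r -> 'rV[K]_3)
    (d : nat) (m : 'I_r -> nat) : set 'M[K]_(r.+1, 3) -> int :=
  divH p *+ d - \sum_(l < r) divE p l *+ m l.

Definition divF (K : fieldType) (p : 'I_10 -> 'rV[K]_3) :
    set 'M[K]_(11, 3) -> int :=
  - (divH p *+ 19) + (\sum_(l < 10) divE p l) *+ 6.

(* A pair (d, m) stands for the class d H - sum_l m_l E_l.  The class
   -3F = 57 H - 18 sum_l E_l is the corner case of the first clause; the second
   one gives the classes -3F - E_j. *)
Definition required_class (c : nat * {ffun 'I_10 -> nat}) : Prop :=
  ((c.1 <= 57)%N /\ forall l, (c.2 l <= 18)%N) \/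
  exists j : 'I_10, c = (57%N, [ffun l => (18 + (l == j))%N]).

Definition general_points (K : fieldType)
    (L : seq (nat * {ffun 'I_10 -> nat})) (p : 'I_10 -> 'rV[K]_3) : Prop :=
  distinct_points p /\
  forall c, c \in L -> forall q : 'I_10 -> 'rV[K]_3, distinct_points q ->
    dim_linear_system p (div_class p c.1 c.2) <=
    dim_linear_system q (div_class q c.1 c.2).

(* Main.v *)
Require Import Defs.
From mathcomp Require Import all_boot all_order all_algebra.
From mathcomp Require Import boolp classical_sets functions cardinality reals.
From mathcomp Require Import perm complex mpoly zify ring.

(** The blowup X of the plane in ten points is handled through plane forms.  Its
    prime divisors are the exceptional curves and the strict transforms of the
    curves q = 0, for q a prime form ([prime_divisorP]); the order of a form
    along E_l is its multiplicity at p_l, and its order along the strict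
    transform of q = 0 is the exponent of q ([order_exceptional],
    [order_curve]).  Hence the sections of d H - sum_l m_l E_l are the forms of
    degree d that have multiplicity at least m_l at p_l ([h0_geP], [h0P]).

    Counting conditions, -3F = 57 H - 18 sum_l E_l has a section for every
    choice of the points ([expected_dimension]).  For general points it has only
    one, h, because it has only one for some special points ([special_57_18]);
    for the same reason -F = 19 H - 6 sum_l E_l has none ([special_19_6]).  The
    special points are two orbits of five points under a diagonal matrix of
    order five.  The conditions that they impose split into five blocks, one for
    each weight of the monomials, and they have integer coefficients: it is
    enough to know that each block has full rank modulo 13, and this is decided
    by Gaussian elimination.

    The rest uses the symmetry of general points: a permutation of the points is
    a competitor in the minimality of the dimension, so that the dimension of a
    class is invariant under permutations of its multiplicities
    ([permute_class]).  The form h has multiplicity exactly 18 at each point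
    ([section_exact]): otherwise it has multiplicity 19 at all of them, and the
    products of a partial derivative with the coordinates are three independent
    sections of -3F.  The components of h = 0 are therefore permuted by the
    rotations of the ten points ([permute_factor]).

    Let A be a component of minimal degree d, and let N be the number of
    different classes among its rotations.  The product of the corresponding
    components divides h, and it has a class e H - n sum_l E_l with e = N d.
    Such a class cannot satisfy 6 e < 19 n ([slope_bound]): a power of it would
    have, in -3F, a complement with two independent sections.  Applied to the
    product and to its cofactor in h, this leaves 6 e = 19 n, and so either -F
    or -2F = -3F - (-F), which are impossible because -F has no section, or the
    class of the whole curve ([symmetric_factor]).  Hence N d = 57, and N
    divides 10, so that N = 1 and A is the whole curve ([section_prime]). *)

Set Implicit Arguments.
Unset Strict Implicit.
Unset Printing Implicit Defensive.

Import Order.TTheory GRing.Theory Num.Theory.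
Local Open Scope classical_set_scope.
Local Open Scope ring_scope.

(** * Factorial polynomial rings *)

Definition divides (R : idomainType) (a b : R) : Prop := exists c, b = c * a.

Definition prime_elt (R : idomainType) (p : R) : Prop :=
  [/\ p != 0, p \isn't a GRing.unit &
      forall a b, divides p (a * b) -> divides p a \/ divides p b].

(** Existence is enough: a factorization into prime elements is unique. *)
Definition factorial_domain (R : idomainType) : Prop :=
  forall a : R, a != 0 -> exists (u : R) (s : seq R),
    [/\ u \is a GRing.unit, forall p, p \in s -> prime_elt p &
        a = u * \prod_(p <- s) p].

Section Divides.
Variable R : idomainType.
Implicit Types a b c p q : R.

Lemma divides_refl a : divides a a.
Proof. by exists 1; rewrite mul1r. Qed.

Lemma divides_trans a b c : divides a b -> divides b c -> divides a c.
Proof. by move=> [x ->] [y ->]; exists (y * x); rewrite mulrA. Qed.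

Lemma divides0 a : divides a 0.
Proof. by exists 0; rewrite mul0r. Qed.

Lemma divides_mull a b c : divides a b -> divides a (c * b).
Proof. by move=> [x ->]; exists (c * x); rewrite mulrA. Qed.

Lemma divides_mulr a b c : divides a b -> divides a (b * c).
Proof. by rewrite mulrC; apply: divides_mull. Qed.

Lemma dividesD a b c : divides a b -> divides a c -> divides a (b + c).
Proof. by move=> [x ->] [y ->]; exists (x + y); rewrite mulrDl. Qed.

Lemma dividesB a b c : divides a b -> divides a c -> divides a (b - c).
Proof. by move=> [x ->] [y ->]; exists (x - y); rewrite mulrBl. Qed.

Lemma divides_sum (I : Type) (r : seq I) (P : pred I) (F : I -> R) a :
  (forall i, P i -> divides a (F i)) -> divides a (\sum_(i <- r | P i) F i).
Proof.
by move=> h; elim/big_ind: _ => //; [apply: divides0|apply: dividesD].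
Qed.

Lemma divides_addr a b c : divides a b -> divides a (b + c) -> divides a c.
Proof. by move=> h1 h2; rewrite -[c](addKr b) addrC; apply: dividesB. Qed.

Lemma divides_mul2l a b c : c != 0 -> divides (c * a) (c * b) -> divides a b.
Proof.
by move=> c0 [x h]; exists x; apply: (mulfI c0); rewrite h mulrCA.
Qed.

Lemma dividesM a b c d : divides a b -> divides c d -> divides (a * c) (b * d).
Proof. by move=> [x ->] [y ->]; exists (x * y); rewrite mulrACA. Qed.

Lemma divides_exp a m n : (m <= n)%N -> divides (a ^+ m) (a ^+ n).
Proof. by move=> le; exists (a ^+ (n - m)); rewrite -exprD subnK. Qed.

Lemma divides_unit u a : u \is a GRing.unit -> divides u a.
Proof. by move=> uu; exists (a / u); rewrite divrK. Qed.

Lemma prime_not_unit p u : prime_elt p -> u \is a GRing.unit -> ~ divides p u.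
Proof.
move=> [_ + _] uu [x ux]; apply/negP; rewrite negbK.
by move: uu; rewrite ux unitrM => /andP[].
Qed.

Lemma prime_divides_prod p (s : seq R) :
  prime_elt p -> divides p (\prod_(q <- s) q) -> exists2 q, q \in s & divides p q.
Proof.
move=> pp; elim: s => [|q s IH]; rewrite ?big_nil ?big_cons.
  by move/(prime_not_unit pp (unitr1 _)).
case: (pp) => _ _ h /h[pq|/IH[r rs pr]]; first by exists q; rewrite ?mem_head.
by exists r; rewrite // inE rs orbT.
Qed.

Lemma prime_divides_sym p q : prime_elt p -> prime_elt q -> divides p q -> divides q p.
Proof.
move=> pp [q0 _ qq] [x qx].
have := divides_refl q; rewrite {2}qx => /qq[[y xy]|//].
exfalso; apply: (prime_not_unit pp (unitr1 _)); exists y.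
by apply: (mulfI q0); rewrite mulr1 {1}qx xy mulrAC mulrC.
Qed.

Lemma associate_unit p q : prime_elt p -> prime_elt q -> divides p q ->
  exists2 u, u \is a GRing.unit & q = u * p.
Proof.
move=> pP qP pq; have [y py] := prime_divides_sym pP qP pq.
have [x qx] := pq; have [q0 _ _] := qP; exists x => //; apply/unitrP; exists y.
have xy : x * y = 1 by apply: (mulIf q0); rewrite mul1r -mulrA -py.
by split=> //; rewrite mulrC.
Qed.

Lemma prime_expM p a b n :
  prime_elt p -> ~ divides p a -> divides (p ^+ n) (a * b) -> divides (p ^+ n) b.
Proof.
move=> pp pa; have [p0 _ pP] := pp.
elim: n b => [|n IH] b h; first exact/divides_unit/unitr1.
have : divides p (a * b).
  by apply: divides_trans h; rewrite -{1}[p]expr1; apply: divides_exp.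
case/pP => // -[c bc]; move: h; rewrite bc mulrA exprSr => -[x].
rewrite mulrA => /(mulIf p0) h.
by apply: dividesM (divides_refl p); apply: IH; exists x.
Qed.

(** By induction on the list: after division by its first prime q, the order of
    another prime r of the list drops by one on both sides if r and q are
    associate, and is unchanged otherwise. *)
Lemma divides_prod_primes (s : seq R) a :
  (forall q, q \in s -> prime_elt q) -> a != 0 ->
  (forall q n, q \in s -> divides (q ^+ n) (\prod_(r <- s) r) ->
     divides (q ^+ n) a) ->
  divides (\prod_(r <- s) r) a.
Proof.
elim: s a => [|q s IH] a sP a0 h; first by rewrite big_nil; apply/divides_unit/unitr1.
have qP : prime_elt q by apply: sP; rewrite mem_head.
have [q0 _ _] := qP.
have [b ab] : divides q a.
  rewrite -[q]expr1; apply: h; rewrite ?mem_head // big_cons expr1.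
  exact/divides_mulr/divides_refl.
have b0 : b != 0 by apply: contraNneq a0 => b0; rewrite ab b0 mul0r.
rewrite big_cons ab [q * _]mulrC; apply: dividesM (divides_refl q).
apply: IH => // [r rs|r n rs hr]; first by apply: sP; rewrite inE rs orbT.
have rP : prime_elt r by apply: sP; rewrite inE rs orbT.
have [qr|nqr] := pselect (divides r q); last first.
  apply: (prime_expM rP nqr); rewrite mulrC -ab; apply: h; rewrite ?inE ?rs ?orbT //.
  by rewrite big_cons; apply: divides_mull.
have [x ux qx] := associate_unit rP qP qr.
have : divides (r ^+ n.+1) a.
  apply: h; rewrite ?inE ?rs ?orbT // big_cons exprS qx -mulrA.
  by apply/divides_mull/dividesM => //; apply: divides_refl.
have r0 : r != 0 by case: rP.
have -> : a = r * (x * b) by rewrite ab qx mulrC -mulrA mulrCA.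
rewrite exprS => /(divides_mul2l r0)[y hy]; exists (x^-1 * y).
by rewrite -mulrA -hy mulKr.
Qed.

Lemma factorial_divides a b : factorial_domain R -> a != 0 -> b != 0 ->
  (forall q n, prime_elt q -> divides (q ^+ n) a -> divides (q ^+ n) b) ->
  divides a b.
Proof.
move=> fR a0 b0 h; have [u [s [uu sP aE]]] := fR _ a0.
have [x bx] : divides (\prod_(p <- s) p) b.
  apply: divides_prod_primes => // q n /sP qP hq; apply: h => //.
  by rewrite aE; apply: divides_mull.
by exists (x / u); rewrite aE mulrA divrK.
Qed.

End Divides.

Section FactorialPoly.
Variable R : idomainType.
Implicit Types (a b c p : R) (f g h : {poly R}).

Lemma dividesCP c f : divides c%:P f <-> forall i, divides c f`_i.
Proof.
split=> [[g ->] i|]; first by exists g`_i; rewrite coefMC.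
move=> /choice[g fg]; exists (\poly_(i < size f) g i).
apply/polyP => i; rewrite coefMC coef_poly.
case: ltnP => [_|le]; first exact: fg.
by rewrite mul0r nth_default.
Qed.

(** The product of the first coefficients of two polynomials that are not
    divisible by p is, modulo p, a coefficient of their product. *)
Lemma prime_polyC p : prime_elt p -> prime_elt p%:P.
Proof.
move=> pp; have [p0 pu pP] := pp; split; first by rewrite polyC_eq0.
  by apply: contraNN pu; rewrite poly_unitE coefC eqxx => /andP[].
move=> f g fg.
have [|/dividesCP nf] := pselect (divides p%:P f); first by left.
have [|/dividesCP ng] := pselect (divides p%:P g); first by right.
have ex h : ~ (forall i, divides p h`_i) -> exists i, ~~ `[< divides p h`_i >].
  by move/existsNP => [i hi]; exists i; apply/asboolPn.
have [i /asboolPn fi imin] := ex_minnP (ex _ nf).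
have [j /asboolPn gj jmin] := ex_minnP (ex _ ng).
have /dividesCP/(_ (i + j)%N) := fg; rewrite coefM.
have lt : (i < (i + j).+1)%N by rewrite ltnS leq_addr.
rewrite (bigD1 (Ordinal lt)) //= addKn => h; exfalso.
have /pP[//|//] : divides p (f`_i * g`_j).
move: h; rewrite addrC; apply: divides_addr; apply: divides_sum => k.
rewrite -val_eqE /= => ki.
case: (ltngtP k i) ki => // ki _.
  apply/divides_mulr; apply: contrapT => hk.
  by have /imin := (introN (asboolP _) hk); rewrite leqNgt ki.
apply/divides_mull; apply: contrapT => hk.
have : (j <= i + j - k)%N by apply: jmin; apply/asboolPn.
by rewrite leqNgt ltn_subLR ?ltn_add2r ?ki // -ltnS ltn_ord.
Qed.

(** Gauss's lemma: each prime factor of the denominator c is prime in R[X], and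
    so it divides one of the two factors. *)
Lemma factor_clear_denominator c f g h : factorial_domain R -> c != 0 ->
  c%:P * f = g * h ->
  exists g' h', [/\ f = g' * h', size g' = size g & size h' = size h].
Proof.
move=> fR c0; have [u [s [uu sP ->]]] := fR _ c0.
have {c c0} u0 : u != 0 by apply: contraTneq uu => ->; rewrite unitr0.
elim: s sP f g h => [|p s IH] sP f g h.
  rewrite big_nil mulr1 => e; exists (u^-1 *: g), h.
  rewrite -scalerAl -e mul_polyC scalerA mulVr // scale1r; split=> //.
  by rewrite size_scale // invr_eq0.
rewrite big_cons mulrCA polyCM -mulrA => e.
have pP : prime_elt p by apply: sP; rewrite mem_head.
have p0 : p%:P != 0 by rewrite polyC_eq0; case: pP.
have sP' q : q \in s -> prime_elt q by move=> qs; apply: sP; rewrite inE qs orbT.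
have szC r : size (r * p%:P) = size r.
  by rewrite mulrC mul_polyC size_scale //; rewrite polyC_eq0 in p0.
have : divides p%:P (g * h) by rewrite -e; apply/divides_mulr/divides_refl.
have [_ _ hP] := prime_polyC pP.
move/hP => [[g' ge]|[h' he]].
  have [|g1 [h1 [fE sg sh]]] := IH sP' f g' h.
    by apply: (mulfI p0); rewrite e ge mulrAC mulrC.
  by exists g1, h1; rewrite ge szC.
have [|g1 [h1 [fE sg sh]]] := IH sP' f g h'.
  by apply: (mulfI p0); rewrite e he mulrA mulrC.
by exists g1, h1; rewrite he szC.
Qed.

Let primitive f := forall p, prime_elt p -> ~ divides p%:P f.

(** The prime factors of c are prime in R[X] and none of them divides f. *)
Lemma primitive_cancel f g c : factorial_domain R -> primitive f -> c != 0 ->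
  divides f (c%:P * g) -> divides f g.
Proof.
move=> fR fP c0; have [u [s [uu sP ->]]] := fR _ c0.
elim: s sP g => [|p s IH] sP g.
  rewrite big_nil mulr1 => -[x h]; exists (u^-1%:P * x).
  by rewrite -mulrA -h mulrA -polyCM mulVr // mul1r.
have pP : prime_elt p by apply: sP; rewrite mem_head.
have p0 : p%:P != 0 by rewrite polyC_eq0; case: pP.
rewrite big_cons mulrCA polyCM -mulrA => -[x h]; apply: IH.
  by move=> q qs; apply: sP; rewrite inE qs orbT.
have [_ _ hP] := prime_polyC pP.
have : divides p%:P (x * f) by rewrite -h; apply/divides_mulr/divides_refl.
move/hP => [[y xy]|/(fP _ pP)//]; exists y.
by apply: (mulfI p0); rewrite h xy mulrAC mulrC.
Qed.

(** Up to a constant, f is the product of the gcd d over the fraction field and of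
    a cofactor of smaller degree; being prime, f divides d. *)
Lemma prime_poly_not_coprime f g : prime_elt f -> (1 < size f)%N ->
  ~~ Pdiv.Idomain.coprimep f g -> divides f g.
Proof.
move=> fP sf; have [f0 _ hP] := fP; set d := Pdiv.Idomain.gcdp f g => ncop.
have szc c : c != 0 -> ~ divides f c%:P.
  move=> c0 [x e]; have : size c%:P = 1%N by rewrite size_polyC c0.
  have x0 : x != 0 by apply: contraNneq c0 => x0; rewrite -polyC_eq0 e x0 mul0r.
  rewrite e size_mul // => h; move: x0 sf h; rewrite -size_poly_gt0.
  by move: (size x) (size f) => [//|n] [//|[//|m]]; rewrite addSn /= !addnS.
have [[c w] /= c0 cw] := Pdiv.Idomain.dvdpP _ _ (Pdiv.Idomain.dvdp_gcdl f g).
have [[c' w'] /= c0' cw'] := Pdiv.Idomain.dvdpP _ _ (Pdiv.Idomain.dvdp_gcdr f g).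
rewrite -/d in cw cw'.
have d0 : d != 0 by apply: contraNneq f0 => d0; move/eqP: cw; rewrite d0 mulr0 scale_poly_eq0 (negPf c0).
have sd : (1 < size d)%N.
  rewrite ltn_neqAle size_poly_gt0 d0 andbT eq_sym.
  by rewrite -Pdiv.Idomain.coprimep_def.
have w0 : w != 0 by apply: contraNneq f0 => w0; move/eqP: cw; rewrite w0 mul0r scale_poly_eq0 (negPf c0).
have : divides f (w * d) by rewrite -cw -mul_polyC; apply/divides_mull/divides_refl.
case/hP => [[x wx]|fd].
  have x0 : x != 0 by apply: contraNneq w0 => x0; rewrite wx x0 mul0r.
  have := congr1 (fun p : {poly R} => size p) cw.
  rewrite size_scale // wx !size_mul ?mulf_neq0 //.
  move: sd x0 sf; rewrite -size_poly_gt0.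
  move: (size x) (size f) (size d) => a b e; clear; lia.
have : divides f (c'%:P * g) by rewrite mul_polyC cw'; apply: divides_mull.
by case/hP => // /(szc _ c0').
Qed.

(** Bezout's identity over the fraction field, with the denominators cleared. *)
Lemma coprime_poly_combination f g : Pdiv.Idomain.coprimep f g ->
  exists u v c, c != 0 /\ u * f + v * g = c%:P.
Proof.
case/Pdiv.Idomain.Bezout_coprimepP => -[u v] /= /Pdiv.Idomain.eqpP[[a b] /= /andP[a0 b0] e].
exists (a *: u), (a *: v), b; split=> //.
by rewrite -!scalerAl -scalerDr e -mul_polyC mulr1.
Qed.

(** Over the fraction field, the gcd of f and g is constant or associate to f;
    since f is primitive, the denominators can be cancelled. *)
Lemma primitive_irreducible_prime f : factorial_domain R -> (1 < size f)%N ->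
  primitive f ->
  (forall c g h, c != 0 -> c%:P * f = g * h -> (size g <= 1)%N || (size h <= 1)%N) ->
  prime_elt f.
Proof.
move=> fR sf fP irr; have f0 : f != 0 by rewrite -size_poly_gt0 ltnW.
split=> // [|g h [w e]].
  by rewrite poly_unitE; case: eqP => // s1; rewrite s1 in sf.
have [cop|ncop] := boolP (Pdiv.Idomain.coprimep f g).
  right; have [u [v [c [c0 uv]]]] := coprime_poly_combination cop.
  apply: (primitive_cancel fR fP c0); exists (u * h + v * w).
  by rewrite -uv !mulrDl -!mulrA e [f * h]mulrC.
left; set d := Pdiv.Idomain.gcdp f g in ncop.
have [[c t] /= c0 ct] := Pdiv.Idomain.dvdpP _ _ (Pdiv.Idomain.dvdp_gcdl f g).
have [[c' t'] /= c0' ct'] := Pdiv.Idomain.dvdpP _ _ (Pdiv.Idomain.dvdp_gcdr f g).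
rewrite -/d in ct ct'.
have d0 : d != 0 by apply: contraNneq f0 => d0; move/eqP: ct; rewrite d0 mulr0 scale_poly_eq0 (negPf c0).
have sd : (1 < size d)%N.
  rewrite ltn_neqAle size_poly_gt0 d0 andbT eq_sym.
  by rewrite -Pdiv.Idomain.coprimep_def.
have st : (size t <= 1)%N.
  by have := irr _ _ _ c0 (etrans (mul_polyC _ _) ct); rewrite [in X in _ || X]leqNgt sd orbF.
have t0 : t != 0 by apply: contraNneq f0 => t0; move/eqP: ct; rewrite t0 mul0r scale_poly_eq0 (negPf c0).
have [tc tE] : exists a, t = a%:P by exists t`_0; apply: size1_polyC.
have tc0 : tc != 0 by move: t0; rewrite tE polyC_eq0.
apply: (primitive_cancel fR fP (mulf_neq0 tc0 c0')).
exists (c *: t'); rewrite polyCM -tE -mulrA [c'%:P * g]mul_polyC ct'.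
by rewrite mulrCA -ct -scalerAl -scalerAr.
Qed.

(** A factorization over the fraction field gives one into primitive polynomials
    of smaller degree. *)
Lemma factorial_primitive f : factorial_domain R -> f != 0 -> primitive f ->
  exists (u : {poly R}) (s : seq {poly R}),
    [/\ u \is a GRing.unit, forall q, q \in s -> prime_elt q &
        f = u * \prod_(q <- s) q].
Proof.
move=> fR; elim: {f}(size f) {-2}f (leqnn (size f)) => [|n IHn] f sf f0 fP.
  by move: f0; rewrite -size_poly_eq0 -leqn0 sf.
have [s1|s1] := leqP (size f) 1.
  exists f, [::]; rewrite big_nil mulr1; split=> //.
  have [c fE] : exists c, f = c%:P by exists f`_0; apply: size1_polyC.
  have c0 : c != 0 by move: f0; rewrite fE polyC_eq0.
  rewrite fE poly_unitE size_polyC coefC eqxx c0 /=.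
  have [u [[|p s] [uu sP cE]]] := fR _ c0; first by rewrite cE big_nil mulr1.
  have pP : prime_elt p by apply: sP; rewrite mem_head.
  exfalso; apply: (fP _ pP); exists (u * \prod_(q <- s) q)%:P.
  by rewrite fE cE big_cons -polyCM mulrCA mulrC.
have [irr|] := pselect (forall c g h, c != 0 -> c%:P * f = g * h ->
    (size g <= 1)%N || (size h <= 1)%N).
  exists 1, [:: f]; rewrite big_seq1 mul1r unitr1; split=> // p.
  by rewrite inE => /eqP->; apply: primitive_irreducible_prime.
move/existsNP => [c /existsNP[g /existsNP[h /not_implyP[c0 /not_implyP[e]]]]].
move/negP; rewrite negb_or -!ltnNge => /andP[sg sh].
have [g' [h' [fE sg' sh']]] := factor_clear_denominator fR c0 e.
have g0 : g' != 0 by apply: contraNneq f0 => g0; rewrite fE g0 mul0r.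
have h0 : h' != 0 by apply: contraNneq f0 => h0; rewrite fE h0 mulr0.
have szf : size f = (size g + size h).-1 by rewrite fE size_mul // sg' sh'.
have [|||u1 [s1' [uu1 sP1 gE]]] := IHn g'; rewrite ?sg' //.
- by move: sf szf sg sh; clear; lia.
- by move=> p pP pg; apply: (fP p pP); rewrite fE; apply: divides_mulr.
have [|||u2 [s2' [uu2 sP2 hE]]] := IHn h'; rewrite ?sh' //.
- by move: sf szf sg sh; clear; lia.
- by move=> p pP pg; apply: (fP p pP); rewrite fE; apply: divides_mull.
exists (u1 * u2), (s1' ++ s2'); split.
- by rewrite unitrM uu1.
- by move=> p; rewrite mem_cat => /orP[/sP1|/sP2].
- by rewrite big_cat /= mulrACA -gE -hE.
Qed.

(** Extract the prime constants that divide f; what remains is primitive. *)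
Theorem factorial_poly : factorial_domain R -> factorial_domain {poly R}.
Proof.
move=> fR f f0.
have lf0 : lead_coef f != 0 by rewrite lead_coef_eq0.
have [u [s [uu sP lfE]]] := fR _ lf0.
(* The leading coefficient bounds the number of primes of R that divide f. *)
elim: {s}(size s) {-2}s (erefl (size s)) f f0 lf0 sP u uu lfE
  => [|k IHk] s ss f f0 lf0 sP u uu lfE.
  apply: factorial_primitive => // p pP [g fE].
  apply: (prime_not_unit pP uu); exists (lead_coef g).
  by move/size0nil: ss lfE => ->; rewrite big_nil mulr1 => <-; rewrite fE lead_coefM lead_coefC.
have [|/existsNP[p /not_implyP[pP /contrapT[g fE]]]] := pselect (primitive f).
  exact: factorial_primitive.
have p0 : p != 0 by case: pP.
have g0 : g != 0 by apply: contraNneq f0 => g0; rewrite fE g0 mul0r.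
have lfg : lead_coef f = lead_coef g * p by rewrite fE lead_coefM lead_coefC.
have : divides p (u * \prod_(q <- s) q) by rewrite -lfE lfg; apply/divides_mull/divides_refl.
have [_ _ hP] := pP; case/hP => [/(prime_not_unit pP uu)//|].
case/(prime_divides_prod pP) => r rs pr.
have rP := sP _ rs; have r0 : r != 0 by case: rP.
have [x ux rx] := associate_unit pP rP pr.
have [||||||v [t [vu tP gE]]] := IHk (rem r s) _ g _ _ _ (u * x).
- by rewrite size_rem // ss.
- by [].
- by rewrite lead_coef_eq0.
- by move=> q /mem_rem/sP.
- by rewrite unitrM uu.
- apply: (mulIf p0); rewrite -lfg lfE (perm_big _ (perm_to_rem rs)) big_cons /= rx.
  by rewrite -!mulrA; congr (_ * (_ * _)); rewrite mulrC.
exists v, (p%:P :: t); split=> //.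
  by move=> q; rewrite inE => /orP[/eqP->|/tP//]; apply: prime_polyC.
by rewrite big_cons mulrCA -gE mulrC.
Qed.
End FactorialPoly.

(** * Polynomials in several variables *)

Section RingIsomorphism.
Variables (A B : idomainType) (f : {rmorphism A -> B}) (g : B -> A).
Hypotheses (f_inj : injective f) (gK : cancel g f).

Lemma iso_unit q : (f q \is a GRing.unit) = (q \is a GRing.unit).
Proof.
apply/idP/idP; last exact: rmorph_unit.
case/unitrP => y [y1 y2]; apply/unitrP; exists (g y).
by split; apply: f_inj; rewrite rmorphM gK rmorph1.
Qed.

Lemma iso_divides p q : divides (f p) (f q) <-> divides p q.
Proof.
split=> [[c e]|[c ->]]; last by exists (f c); rewrite rmorphM.
by exists (g c); apply: f_inj; rewrite rmorphM gK.
Qed.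

Lemma iso_prime q : prime_elt (f q) <-> prime_elt q.
Proof.
have f0 : (f q != 0) = (q != 0) by rewrite -(inj_eq f_inj) rmorph0.
split=> -[q0 qu qP]; split; [by rewrite -f0|by rewrite -iso_unit| |
  by rewrite f0|by rewrite iso_unit|] => a b.
  move=> /iso_divides; rewrite rmorphM => /qP[/iso_divides|/iso_divides]; by [left|right].
rewrite -(gK a) -(gK b) -rmorphM => /iso_divides/qP[h|h].
  by left; apply/iso_divides.
by right; apply/iso_divides.
Qed.

(** Applied to [muni], the isomorphism from polynomials in n + 1 variables to
    polynomials in the last variable. *)
Lemma iso_factorial : factorial_domain B -> factorial_domain A.
Proof.
move=> fB a a0; have fa0 : f a != 0 by apply: contraNneq a0 => e; apply/eqP; apply: f_inj; rewrite e rmorph0.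
have [u [s [uu sP aE]]] := fB _ fa0.
exists (g u), [seq g q | q <- s]; split; first by rewrite -iso_unit gK.
  by move=> _ /mapP[q /sP qP ->]; apply/iso_prime; rewrite gK.
apply: f_inj; rewrite aE rmorphM gK big_map rmorph_prod; congr (_ * _).
by apply: eq_bigr => q _; rewrite gK.
Qed.

End RingIsomorphism.

Section LastVariable.
Variables (n : nat) (R : idomainType).
Implicit Types (p q : {mpoly R[n.+1]}).

Local Notation widen := (widen_ord (leqnSn n)).

Lemma muniX (m : 'X_{1..n.+1}) :
  muni ('X_[m] : {mpoly R[n.+1]}) =
  'X_[[multinom m (widen i) | i < n]] *: 'X^(m ord_max).
Proof. by rewrite muniE msuppX big_seq1 mcoeffX eqxx scale1r. Qed.

Lemma muni_mwiden (p : {mpoly R[n]}) : muni (mwiden p) = p%:P.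
Proof.
rewrite [in RHS](mpolyE p) [in LHS](mpolyE p).
rewrite (raddf_sum (@mwiden n R)) (raddf_sum (@muni n R)) (raddf_sum (@polyC _)) /=.
apply: eq_bigr => m _.
rewrite mwidenZ muniZ mwidenX muniX mnmwiden_ordmax expr0.
rewrite scalerA mul_mpolyC alg_polyC; congr (_ *: _)%:P; congr 'X_[_].
by apply/mnmP => i; rewrite mnmE mnmwiden_widen.
Qed.

Lemma coef_muni p k m : (muni p)`_k@_m = p@_[multinom of rcons m k].
Proof.
rewrite muniE coef_sum raddf_sum /= [RHS](_ : _ =
  \sum_(m' <- msupp p) p@_m' * ('X_[m'] : {mpoly R[n.+1]})@_[multinom of rcons m k]); last first.
  rewrite {1}(mpolyE p) raddf_sum /=; apply: eq_bigr => i _; exact: mcoeffZ.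
apply: eq_bigr => m' _; rewrite coefZ coefXn mcoeffX.
have -> : (m' == [multinom of rcons m k]) =
    ([multinom m' (widen i) | i < n] == m) && (k == m' ord_max).
  have wE (i : 'I_n) : [multinom of rcons m k] (widen i) = m i.
    by rewrite (mnm_nth 0%N) /= nth_rcons size_tuple ltn_ord -mnm_nth.
  have mE : [multinom of rcons m k] ord_max = k.
    by rewrite (mnm_nth 0%N) /= nth_rcons size_tuple ltnn eqxx.
  apply/eqP/andP => [->|[/eqP e1 /eqP e2]].
    by rewrite mE eqxx; split=> //; apply/eqP/mnmP => i; rewrite mnmE wE.
  apply/mnmP => i; case: (unliftP ord_max i) => [j ->|->]; last by rewrite mE.
  have -> : lift ord_max j = widen j by apply: val_inj; rewrite /= /bump leqNgt ltn_ord.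
  by rewrite wE -e1 mnmE.
case: (k =P m' ord_max) => _.
  by rewrite mulr1 mcoeffZ mcoeffX andbT.
by rewrite mulr0 mcoeff0 andbF mulr0.
Qed.

Lemma muni_inj : injective (@muni n R).
Proof.
move=> p q e; apply/mpolyP => m.
have -> : m = [multinom of rcons [multinom m (widen i) | i < n] (m ord_max)].
  apply/mnmP => i; rewrite [RHS](mnm_nth 0%N) /= nth_rcons size_tuple card_ord.
  case: (unliftP ord_max i) => [j ->|->]; last by rewrite ltnn eqxx.
  have -> : lift ord_max j = widen j by apply: val_inj; rewrite /= /bump leqNgt ltn_ord.
  by rewrite /= ltn_ord (nth_map j) ?nth_ord_enum ?size_enum_ord ?ltn_ord.
by rewrite -[LHS]coef_muni -[RHS]coef_muni e.
Qed.

Lemma muni_surj (q : {poly {mpoly R[n]}}) : exists p, muni p = q.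
Proof.
exists (\sum_(i < size q) mwiden q`_i * 'X_ord_max ^+ i).
rewrite raddf_sum -[RHS]coefK poly_def /=; apply: eq_bigr => i _.
rewrite muniM rmorphXn /= muni_mwiden muniX mnmE eqxx.
rewrite [X in 'X_[X]](_ : _ = 0%MM) ?mpolyX0 ?scale1r ?mul_polyC //.
by apply/mnmP => j; rewrite mnmE mnm1E mnm0E -val_eqE /= gtn_eqF.
Qed.

Lemma meval_muni p (x : 'I_n.+1 -> R) :
  p.@[x] = (map_poly (meval (x \o widen)) (muni p)).[x ord_max].
Proof.
rewrite muniE raddf_sum /= horner_sum mevalE; apply: eq_bigr => m _.
rewrite -mul_polyC rmorphM /= map_polyC /= map_polyXn.
rewrite hornerM hornerC hornerXn big_ord_recr /= mulrA; congr (_ * _).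
rewrite mevalZ mevalX; congr (_ * _).
by apply: eq_bigr => i _; rewrite mnmE.
Qed.

End LastVariable.

Definition extend_point (n : nat) (R : Type) (x : 'I_n -> R) (z : R) :
    'I_n.+1 -> R :=
  fun i => if unlift ord_max i is Some j then x j else z.

Lemma meval_extend n (R : idomainType) (p : {mpoly R[n.+1]}) x z :
  p.@[extend_point x z] = (map_poly (meval x) (muni p)).[z].
Proof.
rewrite meval_muni /extend_point unlift_none; congr (_.[_]).
apply: eq_map_poly => q; apply: meval_eq => i /=.
have -> : widen_ord (leqnSn n) i = lift ord_max i.
  by apply: val_inj; rewrite /= /bump leqNgt ltn_ord.
by rewrite liftK.
Qed.

Theorem factorial_mpoly n (K : fieldType) : factorial_domain {mpoly K[n]}.
Proof.
elim: n => [|n IH] p p0.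
  exists p, [::]; rewrite big_nil mulr1; split=> //.
  rewrite (nvar0_mpolyC p) in p0 *; rewrite mpolyC_eq0 in p0.
  apply/unitrP; exists (p@_0%MM)^-1%:MP.
  by rewrite -!mpolyCM mulVf // mulfV.
have [g gK] := choice (@muni_surj n K).
have fP : factorial_domain {poly {mpoly K[n]}} by apply: factorial_poly.
exact: (@iso_factorial {mpoly K[n.+1]} {poly {mpoly K[n]}} (@muni n K) g (@muni_inj n K) gK fP).
Qed.

Lemma poly_nonroot (K : numDomainType) (p : {poly K}) :
  p != 0 -> exists x, p.[x] != 0.
Proof.
move=> p0; apply: contrapT => /forallNP h.
have := max_poly_roots p0 (rs := [seq i%:R | i <- iota 0 (size p)]).
rewrite size_map size_iota ltnn => /(_ _ _)/notF; apply.
  by apply/allP => x _; apply/rootP/eqP; apply: contra_notT (h x).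
by rewrite map_inj_uniq ?iota_uniq //; apply: mulrIn; apply: oner_neq0.
Qed.

(** Specialize the first n variables so that the leading coefficient in the last
    one survives. *)
Lemma mpoly_nonzero_point n (K : numFieldType) (p : {mpoly K[n]}) :
  p != 0 -> exists x, p.@[x] != 0.
Proof.
elim: n p => [|n IH] p p0.
  by exists (fun=> 0); move: p0; rewrite (nvar0_mpolyC p) mpolyC_eq0 mevalC.
have mp0 : muni p != 0 by rewrite -(muni0 _ _) (inj_eq (@muni_inj _ _)).
have [x hx] : exists x, (lead_coef (muni p)).@[x] != 0 by apply: IH; rewrite lead_coef_eq0.
have [z hz] : exists z, (map_poly (meval x) (muni p)).[z] != 0.
  apply: poly_nonroot; apply: contraNneq hx => e.
  by rewrite lead_coefE -coef_map e coef0.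
by exists (extend_point x z); rewrite meval_extend.
Qed.

Lemma mpoly_eq_meval n (K : numFieldType) (p q : {mpoly K[n]}) :
  (forall x, p.@[x] = q.@[x]) -> p = q.
Proof.
move=> h; apply/eqP; rewrite -subr_eq0; apply: contraT => /mpoly_nonzero_point[x].
by rewrite mevalB h subrr eqxx.
Qed.

(** Were [f] coprime to [g] over the fraction field, a combination of the two
    would be a nonzero constant [c]; specialize so that neither [c] nor the
    leading coefficient of [f] vanishes, and take a zero of [f]. *)
Lemma prime_poly_zeros (R : idomainType) (K : closedFieldType) (f g : {poly R}) :
  prime_elt f -> (1 < size f)%N ->
  (forall c : R, c != 0 -> exists e : {rmorphism R -> K}, e c != 0 /\
     forall z, (map_poly e f).[z] = 0 -> (map_poly e g).[z] = 0) ->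
  divides f g.
Proof.
move=> fP sf h.
have [cop|] := boolP (Pdiv.Idomain.coprimep f g); last exact: prime_poly_not_coprime.
exfalso; have [u [v [c [c0 uv]]]] := coprime_poly_combination cop.
have [f0 _ _] := fP.
have [|e [+ hz]] := h (c * lead_coef f); first by rewrite mulf_neq0 // lead_coef_eq0.
rewrite rmorphM mulf_eq0 negb_or => /andP[ec el].
have /closed_rootP[z /rootP fz] : size (map_poly e f) != 1%N.
  by rewrite size_map_poly_id0 // gtn_eqF.
have := congr1 (fun p => (map_poly e p).[z]) uv.
rewrite rmorphD !rmorphM hornerD !hornerM fz (hz _ fz) !mulr0 addr0.
by rewrite map_polyC hornerC => /esym/eqP; apply/negP.
Qed.

(** By induction on the number of variables. If the last one occurs in [q], its
    zeros over a general point of the space of the others show that [q] and [A]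
    are not coprime; if not, the coefficients of [A] vanish on the zeros of [q]. *)
Theorem hypersurface_nullstellensatz n (K : numClosedFieldType)
    (q A : {mpoly K[n]}) : prime_elt q ->
  (forall x, q.@[x] = 0 -> A.@[x] = 0) -> divides q A.
Proof.
elim: n q A => [|n IH] q A qP h.
  have [q0 qu _] := qP; case/negP: qu.
  rewrite (nvar0_mpolyC q) in q0 *; rewrite mpolyC_eq0 in q0.
  apply/unitrP; exists (q@_0%MM)^-1%:MP.
  by rewrite -!mpolyCM mulVf // mulfV.
have [g gK] := choice (@muni_surj n K).
have mqP : prime_elt (muni q) by apply/(@iso_prime {mpoly K[n.+1]} {poly {mpoly K[n]}} (@muni n K) g (@muni_inj n K) gK).
suff [c e] : divides (muni q) (muni A).
  by exists (g c); apply: muni_inj; rewrite muniM gK.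
have h' x z : (map_poly (meval x) (muni q)).[z] = 0 ->
    (map_poly (meval x) (muni A)).[z] = 0.
  by move=> qz; have := h (extend_point x z); rewrite (meval_extend q) (meval_extend A) => /(_ qz).
have [s1|s1] := leqP (size (muni q)) 1.
  have [c qE] : exists c, muni q = c%:P by exists (muni q)`_0; apply: size1_polyC.
  rewrite qE; apply/dividesCP => i; apply: IH.
    have [c0 cu cP] := mqP; rewrite qE in c0 cu cP; rewrite polyC_eq0 in c0.
    split=> //.
      by apply: contraNN cu => cu; rewrite poly_unitE size_polyC coefC eqxx c0 cu.
    move=> a b ab; have [] := cP a%:P b%:P.
    - by rewrite -polyCM; apply/dividesCP => j; rewrite coefC; case: eqP => // _; apply: divides0.
    - by move/dividesCP/(_ 0%N); rewrite coefC eqxx; left.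
    - by move/dividesCP/(_ 0%N); rewrite coefC eqxx; right.
  move=> x cx; have : map_poly (meval x) (muni A) = 0.
    apply/eqP; apply: contraT => /poly_nonroot[z]; rewrite h' ?eqxx //.
    by rewrite qE map_polyC hornerC.
  by move/polyP/(_ i); rewrite coef_map coef0.
apply: (@prime_poly_zeros {mpoly K[n]} K (muni q) (muni A) mqP s1) => c c0.
have [x cx] := mpoly_nonzero_point c0.
exists (meval x : {rmorphism {mpoly K[n]} -> K}); split; first exact: cx.
move=> z; exact: (h' x z).
Qed.

(** * Homogeneous factors *)

Lemma factor_of_polyXn (R : idomainType) (a b : {poly R}) c d : c != 0 ->
  a * b = c%:P * 'X^d -> exists a0 k, a = a0%:P * 'X^k.
Proof.
move=> c0; elim: d a b => [|d IH] a b e.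
  have : size (a * b) = 1%N by rewrite e expr0 mulr1 size_polyC c0.
  have ab0 : a * b != 0 by rewrite e expr0 mulr1 polyC_eq0.
  have [a0 b0] : a != 0 /\ b != 0 by apply/andP; rewrite -negb_or -mulf_eq0.
  rewrite size_mul // => s; exists a`_0, 0%N; rewrite expr0 mulr1.
  by apply: size1_polyC; move: s a0 b0; rewrite -!size_poly_gt0; lia.
have X0 : 'X != 0 :> {poly R} by rewrite polyX_eq0.
have : (a * b).[0] = 0 by rewrite e exprSr mulrA hornerM hornerX mulr0.
move/eqP; rewrite hornerM mulf_eq0 => /orP[]/factor_theorem[q]; rewrite subr0 => qE.
  have [a0 [k qk]] : exists a0 k, q = a0%:P * 'X^k.
    by apply: (IH q b); apply: (mulIf X0); rewrite mulrAC -qE e exprSr mulrA.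
  by exists a0, k.+1; rewrite qE qk exprSr mulrA.
by apply: (IH a q); apply: (mulIf X0); rewrite -mulrA -qE e exprSr mulrA.
Qed.

(** Over a domain, a divisor of a monomial in t is a monomial in t, and its value
    at t = 1 is its coefficient. *)
Lemma graded_factor (A : idomainType) (dil : {rmorphism A -> {poly A}}) d (r s : A) :
  (forall a, (dil a).[1] = a) -> r * s != 0 -> dil (r * s) = (r * s)%:P * 'X^d ->
  exists k, dil r = r%:P * 'X^k.
Proof.
move=> dil1 rs0; rewrite rmorphM => /(factor_of_polyXn rs0)[r0 [k rE]].
by exists k; have := dil1 r; rewrite rE hornerM hornerC hornerXn expr1n mulr1 => ->.
Qed.

Section HomogeneousFactors.
Variables (n : nat) (K : fieldType).
Implicit Types (p q : {mpoly K[n]}).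

Let dil : {rmorphism {mpoly K[n]} -> {poly {mpoly K[n]}}} :=
  mmap (polyC \o @mpolyC n K) (fun i => ('X_i)%:P * 'X).

Let dilE p : dil p = \sum_(m <- msupp p) (p@_m *: 'X_[m])%:P * 'X^(mdeg m).
Proof.
apply: eq_bigr => m _ /=; rewrite /mmap1 -mul_mpolyC polyCM -mulrA; congr (_ * _).
rewrite mpolyXE_id (eq_bigr _ (fun i _ => exprMn _ _ _)) big_split /=.
rewrite rmorph_prod /=; congr (_ * _).
  by apply: eq_bigr => i _; rewrite rmorphXn.
by rewrite mdegE -expr_sum.
Qed.

Let dil1 p : (dil p).[1] = p.
Proof.
rewrite dilE horner_sum [RHS]mpolyE; apply: eq_bigr => m _.
by rewrite hornerM hornerC hornerXn expr1n mulr1.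
Qed.

Let dil_homog d p : (p \is d.-homog) <-> dil p = p%:P * 'X^d.
Proof.
split=> [/dhomogP h|e].
  rewrite dilE [in RHS](mpolyE p) rmorph_sum /= mulr_suml big_seq [RHS]big_seq.
  by apply: eq_bigr => m /h ->.
apply/dhomogP => m mp; apply/eqP; apply: contraTT mp => md.
have := congr1 (fun r : {poly {mpoly K[n]}} => r`_(mdeg m)@_m) e.
rewrite coefCM coefXn (negPf md) mulr0 mcoeff0 dilE coef_sum raddf_sum /=.
rewrite mcoeff_msupp negbK => <-; rewrite {1}(mpolyE p) raddf_sum /=; apply/eqP.
apply: eq_bigr => m' _; rewrite coefCM coefXn mulr_natr mcoeffMn !mcoeffZ !mcoeffX.
by case: (m' =P m) => [->|_]; rewrite ?eqxx ?mulr0 ?mul0rn.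
Qed.

(** A polynomial [p] is homogeneous exactly when [p (t x)] is a monomial in [t],
    and a divisor of a monomial in [t] is one. *)
Lemma homog_factor d p q : p * q != 0 -> p * q \is d.-homog ->
  exists2 k, (k <= d)%N & p \is k.-homog /\ q \is (d - k).-homog.
Proof.
move=> pq0 pqh.
have fac (r s : {mpoly K[n]}) : r * s != 0 -> r * s \is d.-homog -> exists k, r \is k.-homog.
  move=> rs0 /(proj1 (dil_homog _ _)) e.
  have [k rE] := @graded_factor {mpoly K[n]} dil d r s dil1 rs0 e.
  by exists k; apply/(proj2 (dil_homog _ _)).
have [k pk] := fac _ _ pq0 pqh.
have [l ql] : exists l, q \is l.-homog by apply: (fac q p); rewrite mulrC.
have kl := dhomog_uniq pq0 pqh (dhomogM pk ql).
by exists k; rewrite kl ?leq_addr // addKn.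
Qed.

End HomogeneousFactors.

Lemma homog_scale n (K : comRingType) d (p : {mpoly K[n]}) c x :
  p \is d.-homog -> p.@[fun i => c * x i] = c ^+ d * p.@[x].
Proof.
move/dhomogP => h; rewrite !mevalE mulr_sumr big_seq [RHS]big_seq.
apply: eq_bigr => m /h /= <-; rewrite mulrCA; congr (_ * _).
rewrite mdegE expr_sum -big_split /=.
by apply: eq_bigr => i _; rewrite exprMn.
Qed.

Section PrimeOrder.
Variables (n : nat) (K : fieldType).
Implicit Types (p q f g : {mpoly K[n]}).

Lemma mpoly_unitP f : (f \is a GRing.unit) = (f != 0) && (f \is 0.-homog).
Proof.
apply/unitrP/andP => [[g [gf fg]]|[f0 fh]].
  have fg0 : f * g != 0 by rewrite fg oner_neq0.
  split; first by apply: contraNneq fg0 => ->; rewrite mul0r.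
  have [|k + [fk _]] := homog_factor fg0 (d := 0); first by rewrite fg; apply: dhomog1.
  by rewrite leqn0 => /eqP k0; rewrite k0 in fk.
have fE : f = (f@_0%MM)%:MP.
  apply/mpolyP => m; rewrite mcoeffC; case: eqP => [->|m0]; first by rewrite mulr1.
  by rewrite mulr0; apply: (dhomog_nemf_coeff fh); rewrite mdeg_eq0; apply/eqP.
rewrite fE mpolyC_eq0 in f0; rewrite fE; exists (f@_0%MM)^-1%:MP.
by rewrite -!mpolyCM mulVf // mulfV.
Qed.

Lemma prime_homog_gt0 q d : prime_elt q -> q \is d.-homog -> (0 < d)%N.
Proof.
move=> [q0 qu _] qh; rewrite lt0n; apply: contraNneq qu => d0.
by rewrite mpoly_unitP q0; move: qh; rewrite d0.
Qed.

Lemma msize_expn f k : f != 0 -> (msize (f ^+ k)).-1 = (k * (msize f).-1)%N.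
Proof.
move=> f0; elim: k => [|k IH]; first by rewrite expr0 msizeC oner_neq0.
have fk0 : f ^+ k != 0 by rewrite expf_neq0.
rewrite exprS msizeM // mulSn -IH.
rewrite (mpolySpred mdeg f0) (mpolySpred mdeg fk0).
by rewrite /= addnS.
Qed.

Lemma prime_msize q : prime_elt q -> (1 < msize q)%N.
Proof.
move=> [q0 qu _]; rewrite ltnNge; apply: contra qu => s1.
rewrite mpoly_unitP q0 /=; apply/dhomogP => m /msize_mdeg_lt.
by move/leq_trans/(_ s1); rewrite ltnS leqn0 => /eqP.
Qed.

(** The exponent is bounded by the degree. *)
Lemma prime_exact_order q f : prime_elt q -> f != 0 ->
  exists k, divides (q ^+ k) f /\ ~ divides (q ^+ k.+1) f.
Proof.
move=> qP f0; have [q0 _ _] := qP.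
have bound k : divides (q ^+ k) f -> (k < (msize f).+1)%N.
  move=> [g fE]; have g0 : g != 0 by apply: contraNneq f0 => g0; rewrite fE g0 mul0r.
  have qk0 : q ^+ k != 0 by rewrite expf_neq0.
  have := msize_expn k q0; have := prime_msize qP; rewrite fE msizeM //.
  rewrite (mpolySpred mdeg g0) (mpolySpred mdeg qk0).
  move: (msize g).-1 (msize (q ^+ k)).-1 (msize q) => a b c; nia.
pose P k := `[< divides (q ^+ k) f >].
have exP : exists k, P k by exists 0%N; apply/asboolP; rewrite expr0; apply/divides_unit/unitr1.
have [k /asboolP hk kmax] := ex_maxnP exP (fun k hk => ltnW (bound k (asboolW hk))).
exists k; split=> // hk'; have : (k.+1 <= k)%N by apply: kmax; apply/asboolP.
by rewrite ltnn.
Qed.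

End PrimeOrder.

(** * Vectors of the plane and matrices of the blowup *)

Definition o0 : 'I_3 := @Ordinal 3 0 isT.
Definition o1 : 'I_3 := @Ordinal 3 1 isT.
Definition o2 : 'I_3 := @Ordinal 3 2 isT.

Lemma ord3P (P : 'I_3 -> Prop) : P o0 -> P o1 -> P o2 -> forall i, P i.
Proof.
move=> p0 p1 p2 [[|[|[|i]]] lt] //; [move: p0|move: p1|move: p2];
  congr (P _); exact: val_inj.
Qed.

Lemma big_ord3 (T : Type) (idx : T) (op : Monoid.law idx) (F : 'I_3 -> T) :
  \big[op/idx]_j F j = op (op (F o0) (F o1)) (F o2).
Proof.
rewrite !big_ord_recl big_ord0 Monoid.mulm1 Monoid.mulmA.
by congr (op (op _ _) _); congr (F _); apply: val_inj.
Qed.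

Definition cross (B : pzRingType) (u v : 'rV[B]_3) : 'rV[B]_3 :=
  \row_i nth 0 [:: u 0 o1 * v 0 o2 - u 0 o2 * v 0 o1;
                   u 0 o2 * v 0 o0 - u 0 o0 * v 0 o2;
                   u 0 o0 * v 0 o1 - u 0 o1 * v 0 o0] i.

Lemma crossE (B : pzRingType) (u v : 'rV[B]_3) :
  (cross u v 0 o0 = u 0 o1 * v 0 o2 - u 0 o2 * v 0 o1) *
  (cross u v 0 o1 = u 0 o2 * v 0 o0 - u 0 o0 * v 0 o2) *
  (cross u v 0 o2 = u 0 o0 * v 0 o1 - u 0 o1 * v 0 o0).
Proof. by rewrite !mxE. Qed.

Lemma row3P (B : Type) (u v : 'rV[B]_3) :
  u 0 o0 = v 0 o0 -> u 0 o1 = v 0 o1 -> u 0 o2 = v 0 o2 -> u = v.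
Proof. by move=> h0 h1 h2; apply/rowP; apply: ord3P. Qed.

Lemma map_cross (B C : pzRingType) (e : {rmorphism B -> C}) (u v : 'rV[B]_3) :
  map_mx e (cross u v) = cross (map_mx e u) (map_mx e v).
Proof. by apply: row3P; rewrite !mxE /= ?mxE rmorphB !rmorphM. Qed.

Section CrossField.
Variable K : fieldType.
Implicit Types (u v w L x : 'rV[K]_3) (c : K).

Lemma incident3 L x :
  incident L x <-> L 0 o0 * x 0 o0 + L 0 o1 * x 0 o1 + L 0 o2 * x 0 o2 = 0.
Proof. by rewrite /incident big_ord3. Qed.

Lemma cross_incidentl u v : incident (cross u v) u.
Proof. by apply/incident3; rewrite !crossE; ring. Qed.

Lemma cross_incidentr u v : incident (cross u v) v.
Proof. by apply/incident3; rewrite !crossE; ring. Qed.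

Lemma cross_self u : cross u u = 0.
Proof. by apply: row3P; rewrite !crossE !mxE; ring. Qed.

Lemma crossZr c u v : cross u (c *: v) = c *: cross u v.
Proof. by apply: row3P; rewrite !mxE /= ?mxE; ring. Qed.

Lemma crossDr u v w : cross u (v + w) = cross u v + cross u w.
Proof. by apply: row3P; rewrite !mxE /= ?mxE; ring. Qed.

Lemma row_neq0 u : u != 0 -> exists i, u 0 i != 0.
Proof.
move=> u0; apply: contrapT => /forallNP h; case/eqP: u0; apply/rowP => i.
by rewrite mxE; apply/eqP; apply: contra_notT (h i).
Qed.

Lemma cross_eq0 u v : u != 0 -> cross u v = 0 -> exists c, v = c *: u.
Proof.
move=> /row_neq0[i ui] e.
have := congr1 (fun w : 'rV[K]_3 => w 0 o0) e; rewrite crossE mxE => /eqP.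
have := congr1 (fun w : 'rV[K]_3 => w 0 o1) e; rewrite crossE mxE => /eqP.
have := congr1 (fun w : 'rV[K]_3 => w 0 o2) e; rewrite crossE mxE => /eqP.
rewrite !subr_eq0 => /eqP e2 /eqP e1 /eqP e0; exists (v 0 i / u 0 i).
apply/rowP => j; rewrite mxE; apply: (mulIf ui); rewrite mulrAC divfK //.
by move: i j {ui}; apply: ord3P; apply: ord3P; first
  [done|rewrite mulrC e0 mulrC|rewrite mulrC e1 mulrC|rewrite mulrC e2 mulrC
  |rewrite mulrC -e0 mulrC|rewrite mulrC -e1 mulrC|rewrite mulrC -e2 mulrC].
Qed.

Lemma incident_cross1 u L : u != 0 -> incident L u -> exists v, L = cross u v.
Proof.
move=> /row_neq0[i ui] /incident3 h.
have [h0|h1|h2] : [\/ u 0 o0 != 0, u 0 o1 != 0 | u 0 o2 != 0].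
- by move: i ui; apply: ord3P; [constructor 1|constructor 2|constructor 3].
- exists (\row_j nth 0 [:: 0; L 0 o2 / u 0 o0; - L 0 o1 / u 0 o0] j).
  have L0 : L 0 o0 = - (L 0 o1 * u 0 o1 + L 0 o2 * u 0 o2) / u 0 o0.
    by apply: (mulIf h0); rewrite divfK //; apply/eqP; rewrite -subr_eq0 opprK addrA h.
  by apply: row3P; rewrite !mxE /= ?mxE /= ?L0; field.
- exists (\row_j nth 0 [:: - L 0 o2 / u 0 o1; 0; L 0 o0 / u 0 o1] j).
  have L1 : L 0 o1 = - (L 0 o0 * u 0 o0 + L 0 o2 * u 0 o2) / u 0 o1.
    by apply: (mulIf h1); rewrite divfK //; apply/eqP; rewrite -subr_eq0 opprK addrA -h; apply/eqP; ring.
  by apply: row3P; rewrite !mxE /= ?mxE /= ?L1; field.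
- exists (\row_j nth 0 [:: L 0 o1 / u 0 o2; - L 0 o0 / u 0 o2; 0] j).
  have L2 : L 0 o2 = - (L 0 o0 * u 0 o0 + L 0 o1 * u 0 o1) / u 0 o2.
    by apply: (mulIf h2); rewrite divfK //; apply/eqP; rewrite -subr_eq0 opprK -h; apply/eqP; ring.
  by apply: row3P; rewrite !mxE /= ?mxE /= ?L2; field.
Qed.

(** By the identity (u * x) * L = (L u) x - (L x) u for the cross product *, the
    vector L is proportional to u * x. *)
Lemma incident_cross2 u x L : cross u x != 0 -> incident L u -> incident L x ->
  exists c, L = c *: cross u x.
Proof.
move=> n0 /incident3 hu /incident3 hx; apply: cross_eq0 n0 _.
suff -> : cross (cross u x) L =
    (L 0 o0 * u 0 o0 + L 0 o1 * u 0 o1 + L 0 o2 * u 0 o2) *: x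
    - (L 0 o0 * x 0 o0 + L 0 o1 * x 0 o1 + L 0 o2 * x 0 o2) *: u.
  by rewrite hu hx !scale0r subr0.
by apply: row3P; rewrite !mxE /= ?mxE /= ?mxE; ring.
Qed.

End CrossField.

Section Blowup.
Variables (K : numClosedFieldType) (r : nat) (p : 'I_r -> 'rV[K]_3).
Hypothesis hp : distinct_points p.

Local Notation P := {mpoly K[3]}.
Local Notation Q := {mpoly K[r.+1 * 3]}.
Local Notation Mx := 'M[K]_(r.+1, 3).
Local Notation X := (blowup p).
Implicit Types (A S T : Q) (M : Mx) (c : 'rV[K]_r.+1) (x v : 'rV[K]_3).

Definition family (B : Type) (x : 'rV[B]_3) (L : 'I_r -> 'rV[B]_3) : 'M[B]_(r.+1, 3) :=
  \matrix_(i, j) (if unlift ord0 i is Some l then L l 0 j else x 0 j).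

Lemma family0 B (x : 'rV[B]_3) L : row ord0 (family x L) = x.
Proof. by apply/rowP => j; rewrite !mxE unlift_none. Qed.

Lemma familyS B (x : 'rV[B]_3) L l : row (lift ord0 l) (family x L) = L l.
Proof. by apply/rowP => j; rewrite !mxE liftK. Qed.

Lemma family_rowP B (M N : 'M[B]_(r.+1, 3)) : row ord0 M = row ord0 N ->
  (forall l, row (lift ord0 l) M = row (lift ord0 l) N) -> M = N.
Proof.
by move=> h0 hS; apply/row_matrixP => i; case: (unliftP ord0 i) => [l ->|->].
Qed.

Lemma map_family (B C : Type) (e : B -> C) (x : 'rV[B]_3) (L : 'I_r -> 'rV[B]_3) :
  map_mx e (family x L) = family (map_mx e x) (fun l => map_mx e (L l)).
Proof. by apply/matrixP => i j; rewrite !mxE; case: unlift => [l|]; rewrite ?mxE. Qed.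

Lemma row_rescale c M i : row i (diag_mx c *m M) = c 0 i *: row i M.
Proof. by apply/rowP => j; rewrite mul_diag_mx !mxE. Qed.

Definition rescaling c := forall i, c 0 i != 0.

Lemma rescale_inv c M : rescaling c ->
  M = diag_mx (\row_i (c 0 i)^-1) *m (diag_mx c *m M).
Proof.
by move=> hc; apply/row_matrixP => i; rewrite !row_rescale scalerA mxE mulVf ?scale1r.
Qed.

Lemma rescaling_inv c : rescaling c -> rescaling (\row_i (c 0 i)^-1).
Proof. by move=> hc i; rewrite mxE invr_eq0. Qed.

Lemma rescaleM c d M :
  diag_mx c *m (diag_mx d *m M) = diag_mx (\row_i (c 0 i * d 0 i)) *m M.
Proof. by apply/row_matrixP => i; rewrite !row_rescale scalerA mxE. Qed.

Lemma rescalingM c d : rescaling c -> rescaling d ->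
  rescaling (\row_i (c 0 i * d 0 i)).
Proof. by move=> hc hd i; rewrite mxE mulf_neq0. Qed.

Lemma incidentZ (a b : K) (L x : 'rV[K]_3) : incident L x -> incident (a *: L) (b *: x).
Proof.
move=> /incident3 h; apply/incident3; rewrite !mxE.
have -> : a * L 0 o0 * (b * x 0 o0) + a * L 0 o1 * (b * x 0 o1) + a * L 0 o2 * (b * x 0 o2)
  = a * b * (L 0 o0 * x 0 o0 + L 0 o1 * x 0 o1 + L 0 o2 * x 0 o2) by ring.
by rewrite h mulr0.
Qed.

Lemma blowup_rescale c M : rescaling c -> X M -> X (diag_mx c *m M).
Proof.
move=> hc [M0 Mi]; split=> [i|l]; first by rewrite row_rescale scaler_eq0 negb_or hc M0.
rewrite !row_rescale; have [h1 h2] := Mi l.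
by split; [rewrite -[p l]scale1r|]; apply: incidentZ.
Qed.

Lemma blowup_family (x : 'rV[K]_3) L : x != 0 ->
  (forall l, [/\ L l != 0, incident (L l) (p l) & incident (L l) x]) ->
  X (family x L).
Proof.
move=> x0 h; split=> [i|l]; last by rewrite familyS family0; case: (h l).
by case: (unliftP ord0 i) => [l ->|->]; rewrite ?familyS ?family0 //; case: (h l).
Qed.

Definition rescale_poly c A : Q :=
  A \mPo [tuple (mxvec (\matrix_(i < r.+1, j < 3) c 0 i) 0 k) *: 'X_k | k < r.+1 * 3].

Lemma mxeval_rescale c A M :
  mxeval (rescale_poly c A) M = mxeval A (diag_mx c *m M).
Proof.
rewrite /mxeval comp_mpoly_meval; apply: meval_eq => k.
rewrite tnth_mktuple mevalZ mevalXU; case/mxvec_indexP: k => i j.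
by rewrite !mxvecE mul_diag_mx !mxE.
Qed.

Definition pull (F : 'M[P]_(r.+1, 3)) A : P := A \mPo [tuple mxvec F 0 k | k < r.+1 * 3].

Lemma pullE F A x :
  (pull F A).@[fun j => x 0 j] = mxeval A (map_mx (meval (fun j => x 0 j)) F).
Proof.
rewrite /mxeval comp_mpoly_meval; apply: meval_eq => k.
by rewrite tnth_mktuple; case/mxvec_indexP: k => i j; rewrite !mxvecE mxE.
Qed.

Lemma mxevalM A S M : mxeval (A * S) M = mxeval A M * mxeval S M.
Proof. exact: mevalM. Qed.

Lemma mxeval_prod (I : Type) (s : seq I) (F : I -> Q) M :
  mxeval (\prod_(i <- s) F i) M = \prod_(i <- s) mxeval (F i) M.
Proof. by rewrite /mxeval rmorph_prod. Qed.

(** * Closed subsets of the blowup *)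

Lemma closed_sub Z : zariski_closed p Z -> Z `<=` X.
Proof. by move=> [_ [I ->]] M []. Qed.

Lemma closed_separate Z M : zariski_closed p Z -> X M -> ~ Z M ->
  exists A, vanishing_ideal Z A /\ mxeval A M != 0.
Proof.
move=> [_ [I ZE]] XM ZM; apply: contrapT => /forallNP h; apply: ZM.
rewrite ZE; split=> // A IA; apply/eqP; apply: contra_notT (h A) => AM; split=> //.
by move=> N; rewrite ZE => -[_]; apply.
Qed.

Lemma closed_vanishing Z : rescaling_stable Z -> Z `<=` X ->
  (forall M, X M -> (forall A, vanishing_ideal Z A -> mxeval A M = 0) -> Z M) ->
  zariski_closed p Z.
Proof.
move=> st ZX h; split=> //; exists (vanishing_ideal Z); apply/seteqP; split=> M.
  by move=> ZM; split=> [|A]; [apply: ZX|apply].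
by move=> [XM hM]; apply: h.
Qed.

Lemma rescaling_stableI Z1 Z2 : rescaling_stable Z1 -> rescaling_stable Z2 ->
  rescaling_stable (Z1 `&` Z2 : set Mx).
Proof. by move=> h1 h2 M c hc [z1 z2]; split; [apply: h1|apply: h2]. Qed.

Lemma closedI Z1 Z2 : zariski_closed p Z1 -> zariski_closed p Z2 ->
  zariski_closed p (Z1 `&` Z2).
Proof.
move=> c1 c2; apply: closed_vanishing.
- by apply: rescaling_stableI; [case: c1|case: c2].
- by move=> M [/(closed_sub c1)].
move=> M XM h; split; apply: contrapT => nZ.
  have [A [hA /eqP]] := closed_separate c1 XM nZ; apply; apply: h.
  by move=> N [/hA].
have [A [hA /eqP]] := closed_separate c2 XM nZ; apply; apply: h.
by move=> N [_ /hA].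
Qed.

Lemma closedU Z1 Z2 : zariski_closed p Z1 -> zariski_closed p Z2 ->
  zariski_closed p (Z1 `|` Z2).
Proof.
move=> c1 c2; apply: closed_vanishing.
- by move=> M c hc [z|z]; [left; case: c1 => + _|right; case: c2 => + _]; apply.
- by move=> M [/(closed_sub c1)|/(closed_sub c2)].
move=> M XM h; apply: contrapT => /not_orP[n1 n2].
have [A [hA /negP A0]] := closed_separate c1 XM n1.
have [B [hB /negP B0]] := closed_separate c2 XM n2.
have /eqP : mxeval (A * B) M = 0.
  by apply: h => N [/hA|/hB] e; rewrite mxevalM e ?mul0r ?mulr0.
by rewrite mxevalM mulf_eq0 => /orP[].
Qed.

Lemma closed0 : zariski_closed p set0.
Proof.
split; first by move=> M c _ [].
exists [set 1]; apply/seteqP; split=> M // -[_ /(_ _ erefl)/eqP].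
by rewrite /mxeval meval1 oner_eq0.
Qed.

(** By induction on the list: Z is the union of its intersections with the first
    set and with the union of the others. *)
Lemma irreducible_cover Z (s : seq (set Mx)) : irreducible_closed p Z ->
  (forall F, F \in s -> zariski_closed p F) ->
  (forall M, Z M -> exists2 F, F \in s & F M) -> exists2 F, F \in s & Z `<=` F.
Proof.
move=> [cZ [M0 ZM0] irr]; elim: s => [|F s IH] cs cov.
  by have [] := cov _ ZM0.
have cF : zariski_closed p F by apply: cs; rewrite mem_head.
have cs' G : G \in s -> zariski_closed p G by move=> Gs; apply: cs; rewrite inE Gs orbT.
pose U := foldr setU set0 s : set Mx.
have UP M : U M <-> exists2 G, G \in s & G M.
  rewrite /U; elim: (s) => [|G t IHt] /=; first by split=> // -[].
  split=> [[GM|/IHt[H Ht HM]]|[H]]; first by exists G; rewrite ?mem_head.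
    by exists H; rewrite // inE Ht orbT.
  by rewrite inE => /orP[/eqP->|Ht HM]; [left|right; apply/IHt; exists H].
have cU : zariski_closed p U.
  rewrite /U; elim: (s) cs' => [|G t IHt] ct /=; first exact: closed0.
  apply: closedU; first by apply: ct; rewrite mem_head.
  by apply: IHt => H Ht; apply: ct; rewrite inE Ht orbT.
have ZE : Z = (Z `&` F) `|` (Z `&` U).
  apply/seteqP; split=> M; last by move=> [[]|[]].
  move=> ZM; have [G] := cov _ ZM.
  rewrite inE => /orP[/eqP->|Gs GM]; [left|right]; split=> //.
  by apply/UP; exists G.
have [e|e] := irr _ _ (closedI cZ cF) (closedI cZ cU) ZE.
  by exists F; rewrite ?mem_head // e => M [].
have [|G Gs ZG] := IH cs'.
  by move=> M ZM; apply/UP; move: ZM; rewrite e => -[].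
by exists G; rewrite // inE Gs orbT.
Qed.

(** The pullbacks of two polynomials that vanish on closed subsets of [Z], but not
    on [Z], lie outside the prime ideal [J], hence so does their product. For a
    strict transform, [J] is generated by the equation of the plane curve; for an
    exceptional curve, it is zero. *)
Lemma irreducible_family (F : 'M[P]_(r.+1, 3)) (W : 'rV[K]_3 -> Prop)
    (J : P -> Prop) Z :
  (forall a b, J (a * b) -> J a \/ J b) ->
  (forall a, J a <-> forall x, W x -> a.@[fun j => x 0 j] = 0) ->
  (exists x, W x) ->
  zariski_closed p Z ->
  (forall x, W x -> Z (map_mx (meval (fun j => x 0 j)) F)) ->
  (forall A M, (forall x c, rescaling c -> W x ->
       mxeval A (diag_mx c *m map_mx (meval (fun j => x 0 j)) F) = 0) ->
     Z M -> mxeval A M = 0) ->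
  irreducible_closed p Z.
Proof.
move=> Jprime JE [x0 Wx0] cZ FZ dense; split=> //.
  by exists (map_mx (meval (fun j => x0 0 j)) F); apply: FZ.
have main Z' : zariski_closed p Z' -> Z' `<=` Z -> Z <> Z' ->
    exists2 A, vanishing_ideal Z' A & ~ J (pull F A).
  move=> c' sub ne.
  have /existsNP[M /not_implyP[ZM nZ]] : ~ (Z `<=` Z').
    by move=> sub'; apply: ne; apply/seteqP.
  have [A [hA AM]] := closed_separate c' (closed_sub cZ ZM) nZ.
  have /existsNP[x /existsNP[c /not_implyP[hc /not_implyP[Wx e]]]] : ~ (forall x c, rescaling c -> W x ->
       mxeval A (diag_mx c *m map_mx (meval (fun j => x 0 j)) F) = 0).
    by move=> h; move/eqP: AM; apply; apply: dense ZM.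
  exists (rescale_poly c A).
    by move=> N ZN; rewrite mxeval_rescale; apply: hA; case: c' => + _; apply.
  by move/JE/(_ x Wx); rewrite pullE mxeval_rescale.
move=> Z1 Z2 c1 c2 ZE; apply: contrapT => /not_orP[n1 n2].
have [A hA JA] := main _ c1 (fun M h => eq_ind_r (fun Y : set Mx => Y M) (or_introl h) ZE) n1.
have [B hB JB] := main _ c2 (fun M h => eq_ind_r (fun Y : set Mx => Y M) (or_intror h) ZE) n2.
have : J (pull F A * pull F B).
  apply/JE => x Wx; rewrite mevalM !pullE; have := FZ _ Wx; rewrite ZE.
  by move=> [/hA|/hB] ->; rewrite ?mul0r ?mulr0.
by case/Jprime.
Qed.

End Blowup.

(** * Parametrizations of the blowup *)

Local Notation ev x := (meval (fun j => x 0 j)).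

Section Forms.
Variable K : numClosedFieldType.
Local Notation P := {mpoly K[3]}.
Implicit Types (u v x : 'rV[K]_3) (a f q : P).

Definition var_row : 'rV[P]_3 := \row_j 'X_j.
Definition const_row u : 'rV[P]_3 := map_mx (@mpolyC 3 K) u.

Lemma ev_var_row x : map_mx (ev x) var_row = x.
Proof. by apply/rowP => j; rewrite !mxE mevalXU. Qed.

Lemma ev_const_row u x : map_mx (ev x) (const_row u) = u.
Proof. by apply/rowP => j; rewrite !mxE mevalC. Qed.

Lemma ev_fun a (y : 'I_3 -> K) : a.@[y] = ev (\row_j y j) a.
Proof. by apply: meval_eq => j; rewrite mxE. Qed.

(** The linear forms that cut out the point [u]. *)
Definition minor u i : P := cross (const_row u) var_row 0 i.

Lemma ev_minor u x i : ev x (minor u i) = cross u x 0 i.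
Proof.
have := congr1 (fun m : 'rV[K]_3 => m 0 i) (map_cross (ev x) (const_row u) var_row).
by rewrite ev_const_row ev_var_row mxE.
Qed.

Lemma minor_homog u i : minor u i \is 1.-homog.
Proof.
have h (c : K) j : c%:MP * 'X_j \is [in K[3], 1.-homog].
  by rewrite mul_mpolyC; apply: dhomogZ; rewrite dhomogX /= mdeg1.
by move: i; apply: ord3P; rewrite /minor crossE !mxE; apply: rpredB; apply: h.
Qed.

(** Two of the linear forms that cut out [u] are independent. *)
Lemma minor_pair u : u != 0 -> exists i1 i2,
  (exists x, cross u x 0 i1 != 0) /\ (exists x, cross u x 0 i1 = 0 /\ cross u x 0 i2 != 0).
Proof.
move/row_neq0 => [k]; move: k; apply: ord3P => ui.
- exists o2, o1; split; [exists (\row_j nth 0 [:: 0; 1; 0] j)|exists (\row_j nth 0 [:: 0; 0; 1] j); split];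
    by rewrite !crossE !mxE /= !mulr0 ?mulr1 ?subr0 ?sub0r ?oppr_eq0.
- exists o0, o2; split; [exists (\row_j nth 0 [:: 0; 0; 1] j)|exists (\row_j nth 0 [:: 1; 0; 0] j); split];
    by rewrite !crossE !mxE /= !mulr0 ?mulr1 ?subr0 ?sub0r ?oppr_eq0.
- exists o1, o0; split; [exists (\row_j nth 0 [:: 1; 0; 0] j)|exists (\row_j nth 0 [:: 0; 1; 0] j); split];
    by rewrite !crossE !mxE /= !mulr0 ?mulr1 ?subr0 ?sub0r ?oppr_eq0.
Qed.

Lemma minor_neq0 u : u != 0 -> exists i, minor u i != 0.
Proof.
move=> /minor_pair[i [_ [[x hx] _]]]; exists i; apply: contraNneq hx => e.
by rewrite -ev_minor e meval0.
Qed.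

(** A prime that divides a linear form is proportional to it, and two of the
    linear forms are independent. *)
Lemma prime_minor u q : u != 0 -> prime_elt q -> exists i, ~ divides q (minor u i).
Proof.
move=> u0 qP; have [i1 [i2 [[x1 h1] [x2 [h2 h2']]]]] := minor_pair u0.
have [[c1 e1]|] := pselect (divides q (minor u i1)); last by exists i1.
exists i2 => -[c2 e2].
have l0 : minor u i1 != 0 by apply: contraNneq h1 => e; rewrite -ev_minor e meval0.
have l1 := minor_homog u i1; rewrite e1 in l0 l1.
have [k k1 [ck qk]] := homog_factor l0 l1.
have := prime_homog_gt0 qP qk; rewrite subn_gt0 ltnS leqn0 => /eqP k0.
move: ck; rewrite k0 => ck.
have c0 : c1 != 0 by apply: contraNneq l0 => ->; rewrite mul0r.
have cu : c1 \is a GRing.unit by rewrite mpoly_unitP c0.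
have : ev x2 q = 0.
  have [d [dc _]] := unitrP cu.
  have -> : q = d * minor u i1 by rewrite e1 mulrA dc mul1r.
  by rewrite mevalM ev_minor h2 mulr0.
by move=> qx; move: h2'; rewrite -ev_minor e2 mevalM qx mulr0 eqxx.
Qed.

Lemma ev_eq0 a : (forall x, ev x a = 0) -> a = 0.
Proof. by move=> h; apply: mpoly_eq_meval => y; rewrite ev_fun h meval0. Qed.

Lemma nullstellensatz q a : prime_elt q -> (forall x, ev x q = 0 -> ev x a = 0) ->
  divides q a.
Proof.
move=> qP h; apply: hypersurface_nullstellensatz qP _ => y.
by rewrite (ev_fun q) (ev_fun a); apply: h.
Qed.

End Forms.

Section PrimeDivisors.
Variables (K : numClosedFieldType) (r : nat) (p : 'I_r -> 'rV[K]_3).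
Hypotheses (hp : distinct_points p) (r0 : (0 < r)%N).

Local Notation P := {mpoly K[3]}.
Local Notation Q := {mpoly K[r.+1 * 3]}.
Local Notation Mx := 'M[K]_(r.+1, 3).
Local Notation X := (blowup p).
Implicit Types (A S T : Q) (M : Mx) (c : 'rV[K]_r.+1) (x v : 'rV[K]_3) (a f q : P).

Lemma p_neq0 l : p l != 0.
Proof. by case: hp. Qed.

Lemma cross_pp j l : j != l -> cross (p j) (p l) != 0.
Proof.
move=> jl; apply: contraNneq jl => /(cross_eq0 (p_neq0 j))[c e].
apply/eqP/esym; case: hp => _; apply; exists c => //.
by apply: contraNneq (p_neq0 l) => c0; rewrite e c0 scale0r.
Qed.

(** The points of the plane over which the blowup is an isomorphism. *)
Definition off x := forall l, cross (p l) x != 0.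

Lemma off_neq0 x : off x -> x != 0.
Proof.
move=> /(_ (Ordinal r0)); apply: contraNneq => ->.
by have := crossZr 0 (p (Ordinal r0)) 0; rewrite !scale0r => ->.
Qed.

(** The inverse of the blowdown over [off]: the line through p_l and x is given by
    their cross product. *)
Definition point_over x : Mx := family x (fun l => cross (p l) x).

Definition generic_family : 'M[P]_(r.+1, 3) :=
  family (var_row K) (fun l => cross (const_row (p l)) (var_row K)).

Lemma ev_generic x : map_mx (ev x) generic_family = point_over x.
Proof.
rewrite map_family ev_var_row; congr family; apply: funext => l.
by rewrite map_cross ev_const_row ev_var_row.
Qed.

Lemma point_over_blowup x : off x -> X (point_over x).
Proof.
move=> ox; apply: blowup_family; first exact: off_neq0.
by move=> l; split; [apply: ox|apply: cross_incidentl|apply: cross_incidentr].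
Qed.

Lemma blowup_off M : X M -> off (row ord0 M) ->
  exists2 c, rescaling c & M = diag_mx c *m point_over (row ord0 M).
Proof.
move=> [M0 Mi] ox.
have /choice[d dE] : forall l, exists d, row (lift ord0 l) M = d *: cross (p l) (row ord0 M).
  by move=> l; have [h1 h2] := Mi l; apply: incident_cross2.
exists (\row_i if unlift ord0 i is Some l then d l else 1).
  move=> i; rewrite mxE; case: (unliftP ord0 i) => [l _|_]; last exact: oner_neq0.
  by apply: contraNneq (M0 (lift ord0 l)) => d0; rewrite dE d0 scale0r.
apply: family_rowP => [|l]; rewrite row_rescale mxE ?unlift_none ?liftK.
  by rewrite family0 scale1r.
by rewrite familyS -dE.
Qed.

Lemma blowup_not_off M : X M -> ~ off (row ord0 M) ->
  exists l, same_point (row ord0 M) (p l).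
Proof.
move=> [M0 _] /existsNP[l /negP]; rewrite negbK => /eqP/(cross_eq0 (p_neq0 l))[c e].
exists l; exists c => //; apply: contraNneq (M0 ord0) => c0.
by rewrite e c0 scale0r.
Qed.

(** The point of the l-th exceptional curve given by the line through p_l and v. *)
Definition exc_point l v : Mx :=
  family (p l) (fun j => if j == l then cross (p l) v else cross (p j) (p l)).

Definition exc_family l : 'M[P]_(r.+1, 3) :=
  family (const_row (p l)) (fun j => if j == l then cross (const_row (p l)) (var_row K)
                              else cross (const_row (p j)) (const_row (p l))).

Lemma ev_exc l v : map_mx (ev v) (exc_family l) = exc_point l v.
Proof.
rewrite map_family ev_const_row; congr family; apply: funext => j.
by case: ifP => _; rewrite map_cross !ev_const_row ?ev_var_row.
Qed.

Lemma exc_point_exceptional l v c : rescaling c -> cross (p l) v != 0 ->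
  exceptional p l (diag_mx c *m exc_point l v).
Proof.
move=> hc v0; split.
  apply: blowup_rescale => //; apply: blowup_family; first exact: p_neq0.
  move=> j; case: (j =P l) => [->|/eqP jl].
    by split=> //; apply: cross_incidentl.
  by split; [apply: cross_pp|apply: cross_incidentl|apply: cross_incidentr].
by exists (c 0 ord0); rewrite ?hc // row_rescale family0.
Qed.

Lemma exceptional_point l M : exceptional p l M ->
  exists v c, [/\ cross (p l) v != 0, rescaling c & M = diag_mx c *m exc_point l v].
Proof.
move=> [[M0 Mi] [c0 c00 e0]].
have [v vE] : exists v, row (lift ord0 l) M = cross (p l) v.
  by have [h1 _] := Mi l; apply: incident_cross1 => //; apply: p_neq0.
have v0 : cross (p l) v != 0 by rewrite -vE.
have /choice[d dE] : forall j, exists d, j != l -> row (lift ord0 j) M = d *: cross (p j) (p l).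
  move=> j; have [->|jl] := eqVneq j l; first by exists 0.
  have [h1 h2] := Mi j; rewrite e0 in h2.
  have h3 : incident (row (lift ord0 j) M) (p l).
    by have := incidentZ 1 c0^-1 h2; rewrite scale1r scalerA mulVf // scale1r.
  by have [d dE] := incident_cross2 (cross_pp jl) h1 h3; exists d.
pose e j := if j == l then 1 else d j.
have eE j : row (lift ord0 j) M = e j *: (if j == l then cross (p l) v else cross (p j) (p l)).
  by rewrite /e; case: eqP => [->|/eqP/dE//]; rewrite scale1r.
exists v, (\row_i if unlift ord0 i is Some j then e j else c0); split=> //.
  move=> i; rewrite mxE; case: (unliftP ord0 i) => [j _|_] //.
  by apply: contraNneq (M0 (lift ord0 j)) => d0; rewrite eE d0 scale0r.
apply: family_rowP => [|j]; rewrite row_rescale mxE ?unlift_none ?liftK.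
  by rewrite family0.
by rewrite familyS -eE.
Qed.

(** * Lifts of the lines through a centre *)

Definition line_row (u v : 'rV[K]_3) : 'rV[{poly K}]_3 := \row_j ((u 0 j)%:P + (v 0 j)%:P * 'X).

Lemma line_row_at (u v : 'rV[K]_3) t : map_mx (horner_eval t) (line_row u v) = u + t *: v.
Proof. by apply/rowP => j; rewrite !mxE /horner_eval !hornerE mulrC. Qed.

Lemma horner_mmap n (h : 'I_n -> {poly K}) (A : {mpoly K[n]}) t :
  (mmap (@polyC K) h A).[t] = A.@[fun k => (h k).[t]].
Proof.
rewrite mevalE horner_sum; apply: eq_bigr => m _.
rewrite hornerM hornerC; congr (_ * _); rewrite horner_prod.
by apply: eq_bigr => i _; rewrite horner_exp.
Qed.

Definition line_family l v : 'M[{poly K}]_(r.+1, 3) :=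
  family (line_row (p l) v)
    (fun j => if j == l then map_mx (@polyC K) (cross (p l) v)
              else cross (map_mx (@polyC K) (p j)) (line_row (p l) v)).

(** The lift to the blowup of the line through p_l and v: the l-th line is that
    line for all t, and the point at t = 0 lies on the exceptional curve. *)
Definition line_point l v t : Mx :=
  family (p l + t *: v)
    (fun j => if j == l then cross (p l) v else cross (p j) (p l + t *: v)).

Lemma map_polyC_at (u : 'rV[K]_3) t : map_mx (horner_eval t) (map_mx (@polyC K) u) = u.
Proof. by apply/rowP => j; rewrite !mxE /horner_eval hornerC. Qed.

Lemma line_family_at l v t : map_mx (horner_eval t) (line_family l v) = line_point l v t.
Proof.
rewrite map_family line_row_at; congr family; apply: funext => j.
by case: ifP => _; rewrite ?map_cross ?map_polyC_at ?line_row_at.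
Qed.

Lemma line_point0 l v : line_point l v 0 = exc_point l v.
Proof. by rewrite /line_point /exc_point scale0r addr0. Qed.

Lemma line_point_over l v t : t != 0 ->
  exists2 c, rescaling c & line_point l v t = diag_mx c *m point_over (p l + t *: v).
Proof.
move=> t0; exists (\row_i if unlift ord0 i == Some l then t^-1 else 1).
  by move=> i; rewrite mxE; case: (_ =P Some l) => _; rewrite ?invr_eq0 ?oner_neq0.
apply: family_rowP => [|j]; rewrite row_rescale mxE ?unlift_none ?liftK ?family0 ?familyS.
  by rewrite scale1r.
rewrite (inj_eq (@Some_inj _)); case: (j =P l) => [->|_]; last by rewrite scale1r.
by rewrite crossDr cross_self add0r crossZr scalerA mulVf // scale1r.
Qed.

Definition line_pull l v A : {poly K} :=
  mmap (@polyC K) (fun k => mxvec (line_family l v) 0 k) A.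

Lemma line_pull_at l v A t : (line_pull l v A).[t] = mxeval A (line_point l v t).
Proof.
rewrite horner_mmap -line_family_at; apply: meval_eq => k.
by case/mxvec_indexP: k => i j; rewrite !mxvecE [RHS]mxE.
Qed.

(** The condition for the centre j is a nonzero polynomial in t: it holds at t = 1
    if j = l, and at t = 0 otherwise. *)
Lemma line_off l v : cross (p l) v != 0 -> exists2 w : {poly K}, w != 0 &
  forall t, w.[t] != 0 -> t != 0 /\ off (p l + t *: v).
Proof.
move=> v0.
have hw j : exists wj : {poly K}, wj != 0 /\
    forall t, wj.[t] != 0 -> cross (p j) (p l + t *: v) != 0.
  pose comp := cross (map_mx (@polyC K) (p j)) (line_row (p l) v).
  have compE t i : (comp 0 i).[t] = cross (p j) (p l + t *: v) 0 i.
    have := congr1 (fun m : 'rV[K]_3 => m 0 i)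
      (map_cross (horner_eval t) (map_mx (@polyC K) (p j)) (line_row (p l) v)).
    by rewrite map_polyC_at line_row_at mxE.
  have [t0 /row_neq0[i hi]] : exists t, cross (p j) (p l + t *: v) != 0.
    have [->|jl] := eqVneq j l; last by exists 0; rewrite scale0r addr0 cross_pp.
    by exists 1; rewrite scale1r crossDr cross_self add0r.
  exists (comp 0 i); split.
    by apply: contraNneq hi => e; rewrite -compE e horner0.
  by move=> t; rewrite compE; apply: contraNneq => ->; rewrite mxE.
have [w hw'] := choice hw.
exists ('X * \prod_j w j).
  by rewrite mulf_neq0 ?polyX_eq0 //; apply/prodf_neq0 => j _; case: (hw' j).
move=> t; rewrite hornerM hornerX mulf_eq0 negb_or => /andP[t0].
rewrite horner_prod => /prodf_neq0 h; split=> // j.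
by have [_] := hw' j; apply; apply: h.
Qed.

Lemma line_poly_eq l v (B : {poly K}) : cross (p l) v != 0 ->
  (forall t, t != 0 -> off (p l + t *: v) -> B.[t] = 0) -> B = 0.
Proof.
move=> /line_off[w w0 hw] h; apply/eqP; apply: contraT => B0.
have /poly_nonroot[t] : B * w != 0 by rewrite mulf_neq0.
rewrite hornerM mulf_eq0 negb_or => /andP[+ /hw[t0 ot]].
by rewrite h ?eqxx.
Qed.

Definition over_plane M := exists x c, [/\ off x, rescaling c & M = diag_mx c *m point_over x].

(** A point of an exceptional curve is the point at t = 0 of a lifted line whose
    general points lie over [off]. *)
Lemma blowup_dense A : (forall M, over_plane M -> mxeval A M = 0) ->
  forall M, X M -> mxeval A M = 0.
Proof.
move=> h M XM; have [o|/(blowup_not_off XM)[l pl]] := pselect (off (row ord0 M)).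
  by have [c hc e] := blowup_off XM o; apply: h; exists (row ord0 M), c.
have [v [c [v0 hc ->]]] := exceptional_point (conj XM pl).
rewrite -mxeval_rescale -line_point0 -line_pull_at (_ : line_pull _ _ _ = 0) ?horner0 //.
apply: (line_poly_eq v0) => t t0 ot; rewrite line_pull_at mxeval_rescale.
have [d hd ->] := line_point_over l v t0; rewrite rescaleM.
by apply: h; exists (p l + t *: v); eexists; split; [exact: ot| |reflexivity]; apply: rescalingM.
Qed.

(** Take the product of linear forms through the centres, none of them divisible
    by [q]. *)
Lemma off_form q : prime_elt q -> exists w,
  ~ divides q w /\ forall x, ev x w != 0 -> off x.
Proof.
move=> qP; have /choice[i hi] l := prime_minor (p_neq0 l) qP.
exists (\prod_(f <- [seq minor (p l) (i l) | l : 'I_r]) f); split.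
  by move=> /(prime_divides_prod qP)[f /mapP[l _ ->] /hi].
move=> x; rewrite big_image rmorph_prod => /prodf_neq0 h l.
by have := h l isT; rewrite /= ev_minor; apply: contraNneq => ->; rewrite mxE.
Qed.

End PrimeDivisors.

(** * Strict transforms and exceptional curves *)

Lemma homog_factorization n (K : fieldType) d (h : {mpoly K[n]}) :
  h != 0 -> h \is d.-homog -> exists (u : {mpoly K[n]}) (s : seq {mpoly K[n]}),
    [/\ u \is a GRing.unit, forall q, q \in s -> prime_elt q /\ exists k, q \is k.-homog &
        h = u * \prod_(q <- s) q].
Proof.
move=> h0 hh; have [u [s [uu sP hE]]] := factorial_mpoly h0.
exists u, s; split=> // q qs; split; first exact: sP.
have e : h = q * (u * \prod_(f <- rem q s) f) by rewrite mulrCA hE (perm_big _ (perm_to_rem qs)) big_cons.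
rewrite e in h0 hh; have [k _ [qk _]] := homog_factor h0 hh.
by exists k.
Qed.

Section PrimeDivisors.
Variables (K : numClosedFieldType) (r : nat) (p : 'I_r -> 'rV[K]_3).
Hypotheses (hp : distinct_points p) (r0 : (0 < r)%N).

Local Notation P := {mpoly K[3]}.
Local Notation Q := {mpoly K[r.+1 * 3]}.
Local Notation Mx := 'M[K]_(r.+1, 3).
Local Notation X := (blowup p).
Local Notation off := (off p).
Local Notation point_over := (point_over p).
Implicit Types (A S T : Q) (M : Mx) (c : 'rV[K]_r.+1) (x v : 'rV[K]_3) (a f q : P).

Lemma ev_homog d f (k : K) x : f \is d.-homog -> ev (k *: x) f = k ^+ d * ev x f.
Proof. by move=> fh; rewrite -homog_scale //; apply: meval_eq => j; rewrite mxE. Qed.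

Definition lift_form f : Q := f \mPo [tuple 'X_(mxvec_index (ord0 : 'I_r.+1) j) | j < 3].

Lemma lift_formE f M : mxeval (lift_form f) M = pullback f M.
Proof.
rewrite /mxeval comp_mpoly_meval; apply: meval_eq => j.
by rewrite tnth_mktuple mevalXU mxvecE.
Qed.

Lemma pullback_row f M : pullback f M = ev (row ord0 M) f.
Proof. by apply: meval_eq => j; rewrite mxE. Qed.

Lemma row0_over x : row ord0 (point_over x) = x.
Proof. exact: family0. Qed.

(** The strict transform of the plane curve q = 0: the closure of its part off the
    centres. *)
Definition curve q : set Mx :=
  [set M | X M /\ forall A, (forall x c, rescaling c -> off x -> ev x q = 0 ->
      mxeval A (diag_mx c *m point_over x) = 0) -> mxeval A M = 0].

Lemma curve_point q x c : rescaling c -> off x -> ev x q = 0 ->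
  curve q (diag_mx c *m point_over x).
Proof.
move=> hc ox qx; split; last by move=> A; apply.
by apply: blowup_rescale => //; apply: point_over_blowup.
Qed.

Lemma curve_closed q : zariski_closed p (curve q).
Proof.
apply: closed_vanishing.
- move=> M c hc [XM h]; split; first exact: blowup_rescale.
  move=> A hA; rewrite -mxeval_rescale; apply: h => x d hd ox qx.
  by rewrite mxeval_rescale rescaleM; apply: hA => //; apply: rescalingM.
- by move=> M [].
- move=> M XM h; split=> // A hA; apply: h => N [_]; exact.
Qed.

(** Multiply [a] by a form that vanishes at the centres and is not divisible by
    [q], and apply the Nullstellensatz. *)
Lemma prime_curve q a : prime_elt q ->
  (divides q a <-> forall x, off x /\ ev x q = 0 -> ev x a = 0).
Proof.
move=> qP; split=> [[b ->] x [_ qx]|h]; first by rewrite mevalM qx mulr0.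
have [w [qw hw]] := off_form hp qP; have [_ _ qq] := qP.
suff : divides q (w * a) by case/qq.
apply: nullstellensatz => // x qx; rewrite mevalM.
have [->|/hw ox] := eqVneq (ev x w) 0; first by rewrite mul0r.
by rewrite h ?mulr0.
Qed.

Lemma prime_curve_point q : prime_elt q -> exists x, off x /\ ev x q = 0.
Proof.
move=> qP; apply: contrapT => /forallNP h.
apply: (prime_not_unit qP (unitr1 _)); apply/(prime_curve _ qP) => x hx.
by have := h x.
Qed.

Lemma curve_irreducible q : prime_elt q -> irreducible_closed p (curve q).
Proof.
move=> qP; apply: (@irreducible_family _ _ _ (generic_family p)
  (fun x => off x /\ ev x q = 0) (divides q)).
- by case: qP.
- by move=> a; apply: prime_curve.
- exact: prime_curve_point.
- exact: curve_closed.
- move=> x [ox qx]; rewrite ev_generic; split; first exact: point_over_blowup.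
  move=> A /(_ x (const_mx 1)); rewrite diag_const_mx mul1mx; apply=> //.
  by move=> i; rewrite mxE oner_neq0.
- move=> A M hA [_]; apply=> x c hc ox qx.
  by have := hA x c hc (conj ox qx); rewrite ev_generic.
Qed.

Lemma curve_row0 q d M : q \is d.-homog -> curve q M -> ev (row ord0 M) q = 0.
Proof.
move=> qh [_ h]; rewrite -pullback_row -lift_formE; apply: h => x c hc ox qx.
by rewrite lift_formE pullback_row row_rescale row0_over (ev_homog _ _ qh) qx mulr0.
Qed.

Lemma curve_sub q q' d : prime_elt q -> q' \is d.-homog ->
  curve q `<=` curve q' -> divides q q'.
Proof.
move=> qP q'h sub; apply/(prime_curve _ qP) => x [ox qx].
have : curve q (diag_mx (const_mx 1) *m point_over x).
  by apply: curve_point => // i; rewrite mxE oner_neq0.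
move/sub/(curve_row0 q'h).
by rewrite diag_const_mx mul1mx row0_over.
Qed.

Lemma curve_assoc q q' : prime_elt q -> prime_elt q' -> divides q q' -> curve q = curve q'.
Proof.
move=> qP q'P [a qa]; have [b qb] := prime_divides_sym qP q'P (ex_intro _ a qa).
have e x : ev x q = 0 <-> ev x q' = 0.
  by split=> h; [rewrite qa|rewrite qb]; rewrite mevalM h mulr0.
apply/seteqP; split=> M [XM h]; split=> // A hA; apply: h => x c hc ox.
  by move=> /e; apply: hA.
by move=> /e; apply: hA.
Qed.

Lemma curve_neq_blowup q d : prime_elt q -> q \is d.-homog -> curve q <> X.
Proof.
move=> qP qh e; have [w [qw hw]] := off_form hp qP.
have [q0 _ _] := qP.
have w0 : w != 0 by apply: contra_notN qw => /eqP->; apply: divides0.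
have /mpoly_nonzero_point[y] : q * w != 0 by rewrite mulf_neq0.
rewrite ev_fun; set x := \row_j y j; rewrite mevalM mulf_eq0 negb_or => /andP[qx /hw ox].
have : curve q (point_over x) by rewrite e; apply: point_over_blowup.
by move/(curve_row0 qh); rewrite row0_over => /eqP; apply/negP.
Qed.

Lemma exceptional_closed l : zariski_closed p (exceptional p l).
Proof.
apply: closed_vanishing.
- move=> M c hc [XM [k k0 e]]; split; first exact: blowup_rescale.
  by exists (c 0 ord0 * k); rewrite ?mulf_neq0 // row_rescale e scalerA.
- by move=> M [].
- move=> M XM h; split=> //.
  have /(cross_eq0 (p_neq0 hp l))[k e] : cross (p l) (row ord0 M) = 0.
    apply/rowP => i; rewrite -ev_minor -pullback_row -lift_formE mxE.
    apply: h => N [_ [k _ e]].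
    by rewrite lift_formE pullback_row ev_minor e crossZr cross_self !mxE mulr0.
  exists k => //; case: XM => /(_ ord0) + _; apply: contraNneq => k0.
  by rewrite e k0 scale0r.
Qed.

(** The parameters v are dense in the space. *)
Lemma exceptional_family l a : (a = 0) <->
  forall v, cross (p l) v != 0 -> ev v a = 0.
Proof.
split=> [-> v _|h]; first by rewrite meval0.
have [i m0] := minor_neq0 (p_neq0 hp l).
apply/eqP; apply: contraT => a0.
have /mpoly_nonzero_point[y] : a * minor (p l) i != 0 by rewrite mulf_neq0.
rewrite ev_fun mevalM mulf_eq0 negb_or ev_minor => /andP[+ hi].
by rewrite h ?eqxx //; apply: contraNneq hi => ->; rewrite mxE.
Qed.

Lemma exceptional_irreducible l : irreducible_closed p (exceptional p l).
Proof.
apply: (@irreducible_family _ _ _ (exc_family p l)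
  (fun v => cross (p l) v != 0) (fun a => a = 0)).
- by move=> a b /eqP; rewrite mulf_eq0 => /orP[]/eqP; [left|right].
- by move=> a; apply: exceptional_family.
- have [i1 [_ [[x hx] _]]] := minor_pair (p_neq0 hp l); exists x.
  by apply: contraNneq hx => ->; rewrite mxE.
- exact: exceptional_closed.
- move=> v v0; rewrite ev_exc.
  have := @exc_point_exceptional _ _ _ hp l v (const_mx 1) _ v0.
  by rewrite diag_const_mx mul1mx; apply=> i; rewrite mxE oner_neq0.
- move=> A M hA /(exceptional_point hp)[v [c [v0 hc ->]]].
  by have := hA v c hc v0; rewrite ev_exc.
Qed.

Lemma exceptional_nonempty l : exists M, exceptional p l M.
Proof. by have [_ [M EM] _] := exceptional_irreducible l; exists M. Qed.

Lemma exceptional_neq_blowup l : exceptional p l <> X.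
Proof.
move=> e.
have [x ox] : exists x, off x.
  have /choice[i hi] l' := minor_neq0 (p_neq0 hp l').
  have /mpoly_nonzero_point[y] : \prod_l' minor (p l') (i l') != 0.
    by apply/prodf_neq0 => l' _.
  rewrite ev_fun rmorph_prod => /prodf_neq0 h; exists (\row_j y j) => l'.
  by have := h l' isT; rewrite /= ev_minor; apply: contraNneq => ->; rewrite mxE.
have [_ [k _]] : exceptional p l (point_over x) by rewrite e; apply: point_over_blowup.
rewrite row0_over => xE; have := ox l.
by rewrite xE crossZr cross_self scaler0 eqxx.
Qed.

Lemma exceptional_sub l j : exceptional p l `<=` exceptional p j -> l = j.
Proof.
move=> sub; have [M EM] := exceptional_nonempty l.
have [_ [b b0 eb]] := sub _ EM; case: EM => _ [a a0 ea].
case: hp => _; apply; exists (a^-1 * b); first by rewrite mulf_neq0 ?invr_eq0.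
by rewrite -scalerA -eb ea scalerA mulVf // scale1r.
Qed.

Lemma curve_not_exceptional q l : prime_elt q -> ~ (curve q `<=` exceptional p l).
Proof.
move=> qP sub; have [x [ox qx]] := prime_curve_point qP.
have : curve q (diag_mx (const_mx 1) *m point_over x).
  by apply: curve_point => // i; rewrite mxE oner_neq0.
move/sub => [_ [k _]]; rewrite diag_const_mx mul1mx row0_over => xE.
by have := ox l; rewrite xE crossZr cross_self scaler0 eqxx.
Qed.

(** A proper closed subset projects, off the centres, into a plane curve: the
    pullback of a polynomial that vanishes on it vanishes on a cone, and so do
    its homogeneous components. *)
Lemma closed_proper_form Z : zariski_closed p Z -> Z <> X ->
  exists (h : P) d, [/\ h != 0, h \is d.-homog &
    forall M, Z M -> off (row ord0 M) -> ev (row ord0 M) h = 0].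
Proof.
move=> cZ ZX.
have /existsNP[M /not_implyP[XM nZ]] : ~ (X `<=` Z).
  by move=> sub; apply: ZX; apply/seteqP; split=> //; apply: closed_sub.
have [A [hA A0]] := closed_separate cZ XM nZ.
have [x0 [c0 [ox0 hc0 Ax0]]] : exists x c, [/\ off x, rescaling c &
    mxeval A (diag_mx c *m point_over x) != 0].
  apply: contrapT => hN; move/eqP: A0; apply.
  apply: (blowup_dense hp _ XM) => N.
  move=> [x [c [ox hc ->]]]; apply/eqP; apply: contra_notT hN => ne.
  by exists x, c.
pose a := pull (generic_family p) (rescale_poly c0 A).
have aE x : ev x a = mxeval A (diag_mx c0 *m point_over x).
  by rewrite pullE ev_generic mxeval_rescale.
have a0 : a != 0 by apply: contraNneq Ax0 => e; rewrite -aE e meval0.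
have az N (k : K) : k != 0 -> Z N -> off (row ord0 N) -> ev (k *: row ord0 N) a = 0.
  move=> k0 ZN oN; rewrite aE; apply: hA.
  have [c hc NE] := blowup_off (closed_sub cZ ZN) oN.
  have cZr : rescaling_stable Z by case: cZ.
  apply: (cZr) => //.
  have -> : point_over (k *: row ord0 N) = diag_mx (const_mx k) *m
      (diag_mx (\row_i (c 0 i)^-1) *m N).
    rewrite {2}NE -rescale_inv //; apply: family_rowP => [|l]; rewrite row_rescale !mxE.
      by rewrite !row0_over.
    by rewrite !familyS crossZr.
  apply: (cZr); first by move=> i; rewrite mxE.
  by apply: (cZr) => //; apply: rescaling_inv.
have [d hd] : exists d, pihomog mdeg d a != 0.
  apply: contrapT => /forallNP hN; move/eqP: a0; apply.
  rewrite (@pihomog_partitionE _ _ mdeg (msize a) a (leqnn _)) big1 // => i _.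
  by apply/eqP; apply: contra_notT (hN i).
exists (pihomog mdeg d a), d; split=> //; first exact: pihomogP.
move=> N ZN oN; set x := row ord0 N in oN *.
pose B : {poly K} := \poly_(i < msize a) ev x (pihomog mdeg i a).
have BE k : ev (k *: x) a = B.[k].
  rewrite {1}(@pihomog_partitionE _ _ mdeg (msize a) a (leqnn _)) raddf_sum /=.
  rewrite horner_poly; apply: eq_bigr => i _.
  by rewrite (ev_homog k x (pihomogP mdeg i a)) mulrC.
have B0 : B = 0.
  apply/eqP; apply: contraT => B0.
  have /poly_nonroot[k] : B * 'X != 0 by rewrite mulf_neq0 ?polyX_eq0.
  rewrite hornerM hornerX mulf_eq0 negb_or -BE => /andP[+ k0].
  by rewrite az ?eqxx.
have [lt|le] := ltnP d (msize a).
  by have := congr1 (fun b : {poly K} => b`_d) B0; rewrite coef_poly lt coef0.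
suff -> : pihomog mdeg d a = 0 by rewrite meval0.
rewrite pihomogE big_seq_cond big_pred0 // => m.
apply/negP => /andP[/msize_mdeg_lt lt /eqP /= e].
by move: le; rewrite -e leqNgt lt.
Qed.

(** The image of [Z] off the centres lies in a plane curve; the strict transforms
    of its components and the exceptional curves cover [Z]. *)
Theorem irreducible_proper Z : irreducible_closed p Z -> Z <> X ->
  (exists q d, [/\ prime_elt q, q \is d.-homog & Z `<=` curve q]) \/
  exists l, Z `<=` exceptional p l.
Proof.
move=> iZ ZX; have [cZ _ _] := iZ.
have [h [d [h0 hh hz]]] := closed_proper_form cZ ZX.
have [u [s [uu sP hE]]] := homog_factorization h0 hh.
have [F|M ZM|F] := @irreducible_cover _ _ _ Z
  ([seq curve q | q <- s] ++ [seq exceptional p l | l : 'I_r]) iZ.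
- rewrite mem_cat => /orP[/mapP[q _ ->]|/mapP[l _ ->]].
    exact: curve_closed.
  exact: exceptional_closed.
- have XM := closed_sub cZ ZM.
  have [o|no] := pselect (off (row ord0 M)).
    have := hz M ZM o; rewrite hE mevalM => /eqP; rewrite mulf_eq0 => /orP[/eqP u0|].
      have [v [vu _]] := unitrP uu; have := congr1 (ev (row ord0 M)) vu.
      by rewrite mevalM u0 mulr0 meval1 => /esym/eqP; rewrite oner_eq0.
    rewrite rmorph_prod prodf_seq_eq0 => /hasP[q qs /= /eqP qM].
    exists (curve q); first by rewrite mem_cat map_f.
    have [c hc ->] := blowup_off XM o; exact: curve_point.
  have [l pl] := blowup_not_off hp XM no.
  by exists (exceptional p l) => //; rewrite mem_cat; apply/orP; right; apply/mapP; exists l; rewrite ?mem_enum.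
- rewrite mem_cat => /orP[/mapP[q /sP[qP [k qk]] ->]|/mapP[l _ ->]] sub; [left|right].
    by exists q, k.
  by exists l.
Qed.

Lemma curve_prime_divisor q d : prime_elt q -> q \is d.-homog -> prime_divisor p (curve q).
Proof.
move=> qP qh; split; [exact: curve_irreducible|exact: curve_neq_blowup qh|].
move=> Z iZ sub; have [->|ZX] := pselect (Z = X); [by right|left].
have [[q' [d' [q'P q'h sub']]]|[l sub']] := irreducible_proper iZ ZX.
  have e : curve q = curve q'.
    by apply: curve_assoc => //; apply: (curve_sub qP q'h); apply: subset_trans sub'.
  by apply/seteqP; split=> //; rewrite e.
by have := @curve_not_exceptional q l qP (subset_trans sub sub').
Qed.

End PrimeDivisors.

(** * Multiplicity of a form at a point *)

Lemma low_coef_Xn (B : idomainType) (F : {poly B}) n :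
  (forall k, (k < n)%N -> F`_k = 0) <-> exists G, F = G * 'X^n.
Proof.
split=> [h|[G ->] k lt]; last by rewrite coefMXn lt.
exists (drop_poly n F); rewrite -[LHS](poly_take_drop n) [take_poly _ _](_ : _ = 0) ?add0r //.
by apply/polyP => k; rewrite coef_take_poly coef0; case: ltnP => // /h.
Qed.

Lemma size_prod_leq (K : idomainType) (I : Type) (s : seq I) (F : I -> {poly K})
    (e : I -> nat) :
  (forall i, (size (F i) <= (e i).+1)%N) ->
  (size (\prod_(i <- s) F i)%R <= (\sum_(i <- s) e i).+1)%N.
Proof.
move=> h; elim: s => [|i s IH]; first by rewrite !big_nil size_poly1.
rewrite !big_cons; apply: leq_trans (size_polyMleq _ _) _.
have := leq_add (h i) IH; rewrite addSn addnS.
by case: (_ + _)%N => [|a] //=; rewrite ltnS.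
Qed.

Section Multiplicity.
Variable K : numClosedFieldType.
Local Notation P := {mpoly K[3]}.
Implicit Types (u v x : 'rV[K]_3) (f g q : P).

(** The restriction t |-> f (u + t v) of a form to a line. *)
Definition line f u v : {poly K} := mmap (@polyC K) (fun j => line_row u v 0 j) f.

Lemma line_at f u v t : (line f u v).[t] = ev (u + t *: v) f.
Proof.
rewrite horner_mmap; apply: meval_eq => j.
by rewrite !mxE !hornerE mulrC.
Qed.

Lemma lineM f g u v : line (f * g) u v = line f u v * line g u v.
Proof. exact: rmorphM. Qed.

Lemma lineD f g u v : line (f + g) u v = line f u v + line g u v.
Proof. exact: raddfD. Qed.

Lemma lineZ c f u v : line (c *: f) u v = c *: line f u v.
Proof. by rewrite /line mmapZ mul_polyC. Qed.

(** The multiplicity of [f] at [u] is the least order at t = 0 of the polynomials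
    f (u + t v). *)
Definition mult_ge f u n := forall v k, (k < n)%N -> (line f u v)`_k = 0.

(** The restriction of [f] to the general line through [u]: the coefficients of
    f (u + t v) as polynomials in v. *)
Definition generic_line f u : {poly P} :=
  mmap (@polyC P \o @mpolyC 3 K) (fun j => (u 0 j)%:MP%:P + ('X_j)%:P * 'X) f.

Lemma map_generic_line f u v : map_poly (ev v) (generic_line f u) = line f u v.
Proof.
rewrite /generic_line /line /mmap raddf_sum /=; apply: eq_bigr => m _.
rewrite rmorphM /= map_polyC /= mevalC; congr (_ * _).
rewrite rmorph_prod /=; apply: eq_bigr => j _; rewrite rmorphXn /=; congr (_ ^+ _).
by rewrite rmorphD rmorphM /= !map_polyC map_polyX /= mevalC mevalXU mxE.
Qed.

Lemma coef_line f u v k : (line f u v)`_k = ev v (generic_line f u)`_k.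
Proof. by rewrite -map_generic_line coef_map. Qed.

Lemma mult_geP f u n :
  mult_ge f u n <-> forall k, (k < n)%N -> (generic_line f u)`_k = 0.
Proof.
split=> [h k lt|h v k lt]; last by rewrite coef_line h // meval0.
by apply: ev_eq0 => v; rewrite -coef_line h.
Qed.

Lemma mult_geW f u m n : (m <= n)%N -> mult_ge f u n -> mult_ge f u m.
Proof. by move=> le h v k lt; apply: h; apply: leq_trans le. Qed.

Lemma mult_geD f g u n : mult_ge f u n -> mult_ge g u n -> mult_ge (f + g) u n.
Proof. by move=> hf hg v k lt; rewrite lineD coefD hf ?hg ?addr0. Qed.

Lemma mult_geZ c f u n : mult_ge f u n -> mult_ge (c *: f) u n.
Proof. by move=> hf v k lt; rewrite lineZ coefZ hf ?mulr0. Qed.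

Lemma mult_geM f g u m n : mult_ge f u m -> mult_ge g u n -> mult_ge (f * g) u (m + n).
Proof.
move=> hf hg v; apply/low_coef_Xn; rewrite lineM.
have [F ->] := (proj1 (low_coef_Xn _ _)) (hf v).
have [G ->] := (proj1 (low_coef_Xn _ _)) (hg v).
by exists (F * G); rewrite exprD mulrACA.
Qed.

Definition mult_exact f u n := mult_ge f u n /\ ~ mult_ge f u n.+1.

Lemma mult_exact_coef f u n : mult_exact f u n -> (generic_line f u)`_n != 0.
Proof.
move=> [h1 h2]; apply: contra_notN h2 => /eqP e; apply/mult_geP => k.
by rewrite ltnS leq_eqVlt => /orP[/eqP->//|]; apply: (proj1 (mult_geP f u n) h1).
Qed.

(** The lowest coefficients of f (u + t v) and g (u + t v) are nonzero polynomials
    in v, hence so is their product. *)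
Lemma mult_exactM f g u m n : mult_exact f u m -> mult_exact g u n ->
  mult_exact (f * g) u (m + n).
Proof.
move=> hf hg; split; first by apply: mult_geM; [case: hf|case: hg].
have := mulf_neq0 (mult_exact_coef hf) (mult_exact_coef hg).
move/mpoly_nonzero_point => [y]; rewrite ev_fun mevalM -!coef_line; set v := \row_j y j.
have [F fE] := (proj1 (low_coef_Xn _ _)) (proj1 hf v).
have [G gE] := (proj1 (low_coef_Xn _ _)) (proj1 hg v).
rewrite fE gE !coefMXn !ltnn !subnn => FG0 /(_ v (m + n)%N (leqnn _)).
rewrite lineM fE gE mulrACA -exprD coefMXn ltnn subnn coef0M.
by move/eqP; rewrite (negPf FG0).
Qed.

Lemma mult_exact_uniq f u m n : mult_exact f u m -> mult_exact f u n -> m = n.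
Proof.
move=> [h1 h2] [h3 h4]; case: (ltngtP m n) => // lt.
  by case: h2; apply: mult_geW h3.
by case: h4; apply: mult_geW h1.
Qed.

Lemma mult_exact_leq f u m n : mult_exact f u m -> mult_ge f u n -> (n <= m)%N.
Proof.
move=> [_ h] hn; rewrite leqNgt; apply/negP => lt; apply: h.
exact: mult_geW hn.
Qed.

(** The order at t = 0 on a line on which [f] is not zero is a bound. *)
Lemma mult_exact_ex f u : f != 0 -> exists n, mult_exact f u n.
Proof.
move=> /mpoly_nonzero_point[y]; rewrite ev_fun => fy.
pose v : 'rV[K]_3 := \row_j y j - u.
have l0 : line f u v != 0.
  apply: contraNneq fy => e; have := line_at f u v 1.
  by rewrite e horner0 scale1r addrC subrK => <-.
have bound n : mult_ge f u n -> (n <= size (line f u v))%N.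
  move=> h; rewrite leqNgt; apply/negP => lt.
  have := h v (size (line f u v)).-1; rewrite prednK ?size_poly_gt0 // => /(_ (ltnW lt)).
  by move/eqP; rewrite -lead_coefE lead_coef_eq0 (negPf l0).
have exP : exists n, `[< mult_ge f u n >] by exists 0%N; apply/asboolP.
have [n /asboolP hn nmax] := ex_maxnP exP (fun n hn => bound n (asboolW hn)).
exists n; split=> // hn'; have : (n.+1 <= n)%N by apply: nmax; apply/asboolP.
by rewrite ltnn.
Qed.

(** Each factor t comes with a coordinate of v. *)
Lemma generic_line_homog f u k : (generic_line f u)`_k \is k.-homog.
Proof.
pose G (F : {poly P}) := forall k, F`_k \is k.-homog.
have GD F F' : G F -> G F' -> G (F + F') by move=> h h' i; rewrite coefD; apply: rpredD.
have GM F F' : G F -> G F' -> G (F * F').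
  move=> h h' i; rewrite coefM; apply: rpred_sum => j _.
  have ji : (j <= i)%N by rewrite -ltnS.
  by have := dhomogM (h j) (h' (i - j)%N); rewrite subnKC.
have GC (c : K) : G (c%:MP%:P).
  move=> i; rewrite coefC; case: eqP => [->|_]; last exact: dhomog0.
  by apply/dhomogP => m; rewrite msuppC; case: ifP => // _; rewrite inE => /eqP->; rewrite /= mdeg0.
suff : G (generic_line f u) by apply.
rewrite /generic_line /mmap; apply: (big_ind G) => [i|F F'|m _].
- by rewrite coef0; apply: dhomog0.
- exact: GD.
apply: (GM _ _); first exact: (GC _).
rewrite /mmap1; apply: (big_ind G) => [|F F'|j _]; [exact: (GC 1)|exact: (GM _ _)|].
elim: (m j) => [|i IH]; first exact: (GC 1).
rewrite exprS; apply: (GM _ _) => //; apply: (GD _ _); first exact: (GC _).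
move=> i'; rewrite coefCM coefX; case: eqP => [->|_]; last by rewrite mulr0 dhomog0.
by rewrite mulr1 dhomogX /= mdeg1.
Qed.

(** The n-th power of the homogeneous ideal of the point [u]. *)
Definition point_ideal u n f := exists s : seq (P * seq 'I_3),
  (forall t, t \in s -> size t.2 = n) /\
  f = \sum_(t <- s) t.1 * \prod_(i <- t.2) minor u i.

Lemma point_idealD u n f g : point_ideal u n f -> point_ideal u n g -> point_ideal u n (f + g).
Proof.
move=> [s [hs ->]] [t [ht ->]]; exists (s ++ t); rewrite big_cat; split=> // w.
by rewrite mem_cat => /orP[/hs|/ht].
Qed.

Lemma point_ideal0 u n : point_ideal u n 0.
Proof. by exists [::]; rewrite big_nil. Qed.

Lemma point_idealM u n f g : point_ideal u n f -> point_ideal u n (g * f).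
Proof.
move=> [s [hs ->]]; exists [seq (g * t.1, t.2) | t <- s]; split.
  by move=> _ /mapP[t /hs h ->].
by rewrite big_map mulr_sumr; apply: eq_bigr => t _; rewrite mulrA.
Qed.

Lemma point_idealS u n f i : point_ideal u n f -> point_ideal u n.+1 (f * minor u i).
Proof.
move=> [s [hs ->]]; exists [seq (t.1, i :: t.2) | t <- s]; split.
  by move=> _ /mapP[t /hs h ->]; rewrite /= h.
rewrite big_map mulr_suml; apply: eq_bigr => t _.
by rewrite /= big_cons -mulrA [_ * minor _ _]mulrC.
Qed.

Lemma point_idealW u n f : point_ideal u n.+1 f -> point_ideal u n f.
Proof.
move=> [s [hs ->]].
exists [seq (t.1 * minor u (head o0 t.2), behead t.2) | t <- s]; split.
  by move=> _ /mapP[t /hs h ->]; rewrite /= size_behead h.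
rewrite big_map big_seq [RHS]big_seq; apply: eq_bigr => -[a [|i t]] /hs //= _.
by rewrite big_cons mulrA.
Qed.

Lemma minor_det u j k : exists (c : K) i,
  u 0 j *: 'X_k - u 0 k *: 'X_j = c *: minor u i.
Proof.
move: j k; apply: ord3P; apply: ord3P; rewrite ?subrr;
  try by exists 0, o0; rewrite scale0r.
- by exists 1, o2; rewrite scale1r /minor crossE !mxE !mul_mpolyC.
- by exists (-1), o1; rewrite scaleN1r /minor crossE !mxE !mul_mpolyC opprB.
- by exists (-1), o2; rewrite scaleN1r /minor crossE !mxE !mul_mpolyC opprB.
- by exists 1, o0; rewrite scale1r /minor crossE !mxE !mul_mpolyC.
- by exists 1, o1; rewrite scale1r /minor crossE !mxE !mul_mpolyC.
- by exists (-1), o0; rewrite scaleN1r /minor crossE !mxE !mul_mpolyC opprB.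
Qed.

Lemma line_size d f u v : f \is d.-homog -> (size (line f u v) <= d.+1)%N.
Proof.
move=> fh; apply/leq_sizeP => k lt; rewrite /line coef_sum big_seq big1 // => m /(dhomogP _ _ _ fh) /= md.
rewrite coefCM (nth_default _ _) ?mulr0 //.
apply: leq_trans lt; rewrite -md mdegE.
apply: size_prod_leq => i; apply: leq_trans (size_poly_exp_leq _ _) _.
rewrite ltnS -[X in (_ <= X)%N]mul1n leq_mul2r; apply/orP; right.
rewrite mxE -subn1 leq_subLR; apply: leq_trans (size_polyD _ _) _.
rewrite geq_max (leq_trans (size_polyC_leq1 _)) //=.
by apply: leq_trans (size_polyMleq _ _) _; rewrite size_polyX addn2 /= ltnS size_polyC_leq1.
Qed.

(** With y a linear form such that y (u) = 1 and z = x - y u, the form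
    f (x) = f (y u + z) is the sum of the y^(d-k) c_k (z), where c_k (v) is the
    coefficient of t^k in f (u + t v), and the coordinates of z are linear forms
    that vanish at u. *)
Lemma mult_ge_ideal d f u n : u != 0 -> f \is d.-homog -> mult_ge f u n ->
  point_ideal u n f.
Proof.
move=> /row_neq0[j uj] fh /mult_geP hf.
pose y : P := (u 0 j)^-1 *: 'X_j.
pose z : 3.-tuple P := [tuple 'X_k - u 0 k *: y | k < 3].
have zI k : exists (c : K) i, tnth z k = c *: minor u i.
  have [c [i e]] := minor_det u j k; exists ((u 0 j)^-1 * c), i.
  rewrite -scalerA -e scalerBr scalerA mulVf // scale1r tnth_mktuple.
  by rewrite !scalerA mulrC.
pose c k : P := (generic_line f u)`_k.
(* At a point x where y has the value a, x = a (u + a^-1 z (x)). *)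
have -> : f = \sum_(k < d.+1) y ^+ (d - k) * (c k \mPo z).
  have yu : ev u y = 1 by rewrite mevalZ mevalXU mulVf.
  have y0 : y != 0 by apply: contraNneq (oner_neq0 K) => e; rewrite -yu e meval0.
  apply/eqP; rewrite -subr_eq0; apply: contraT => D0.
  have /mpoly_nonzero_point[w] := mulf_neq0 D0 y0.
  rewrite ev_fun; set x := \row_k w k; rewrite mevalM mulf_eq0 negb_or => /andP[+ yx].
  rewrite mevalB subr_eq0 => /negP[]; apply/eqP.
  pose a := ev x y; pose v : 'rV[K]_3 := \row_k ev x (tnth z k).
  have xE : x = a *: (u + a^-1 *: v).
    apply/rowP => k; rewrite !mxE mulrDr mulrA mulfV // mul1r tnth_mktuple.
    by rewrite mevalB mevalZ mevalXU mxE -/a; ring.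
  have sz : (size (line f u v) <= d.+1)%N by apply: line_size.
  rewrite {1}xE (ev_homog _ _ fh) -line_at (horner_coef_wide _ sz) mulr_sumr.
  rewrite raddf_sum; apply: eq_bigr => -[k /= lt] _.
  rewrite mevalM rmorphXn /= -/a comp_mpoly_meval coef_line -/(c k).
  have -> : (c k).@[fun i => (tnth z i).@[fun j0 => x 0 j0]] = ev v (c k).
    by apply: meval_eq => i; rewrite mxE.
  have -> : a ^+ d = a ^+ (d - k) * a ^+ k by rewrite -exprD subnK.
  rewrite exprVn; field; exact: expf_neq0.
apply: (big_ind (point_ideal u n)); [exact: point_ideal0|by move=> ? ?; apply: point_idealD|].
move=> [k /= lt] _; apply: point_idealM.
have [kn|nk] := ltnP k n; first by rewrite /c hf // raddf0; apply: point_ideal0.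
have ck : c k \is k.-homog by apply: generic_line_homog.
rewrite comp_mpolyE big_seq; apply: (big_ind (point_ideal u n)); [exact: point_ideal0|by move=> ? ?; apply: point_idealD|].
move=> m /(dhomogP _ _ _ ck) /= mk; rewrite -mul_mpolyC; apply: point_idealM.
have prodI (s : seq 'I_3) : point_ideal u (\sum_(i <- s) m i) (\prod_(i <- s) tnth z i ^+ m i).
  elim: s => [|i s IH]; first by rewrite !big_nil; exists [:: (1, [::])]; split=> [t|]; rewrite ?inE ?big_seq1 ?big_nil ?mulr1 // => /eqP->.
  rewrite !big_cons; elim: (m i) => [|e IHe]; first by rewrite expr0 mul1r.
  have [b [i' zE]] := zI i; rewrite addSn; set R := \prod_(_ <- s) _ in IHe *.
  have -> : tnth z i ^+ e.+1 * R = b%:MP * (tnth z i ^+ e * R * minor u i').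
    by rewrite exprS {1}zE -mul_mpolyC -!mulrA; congr (_ * _); rewrite mulrC -mulrA.
  by apply/point_idealM/point_idealS.
have := prodI (index_enum 'I_3); rewrite -mdegE mk.
rewrite -{1}(subnK nk); elim: (k - n)%N => [//|e IHe] /point_idealW; exact: IHe.
Qed.

End Multiplicity.

(** * Orders along the prime divisors *)

Section Orders.
Variables (K : numClosedFieldType) (r : nat) (p : 'I_r -> 'rV[K]_3).
Hypotheses (hp : distinct_points p) (r0 : (0 < r)%N).

Local Notation P := {mpoly K[3]}.
Local Notation Q := {mpoly K[r.+1 * 3]}.
Local Notation Mx := 'M[K]_(r.+1, 3).
Local Notation X := (blowup p).
Local Notation off := (off p).
Local Notation point_over := (point_over p).
Local Notation curve := (curve p).
Implicit Types (A S T : Q) (M : Mx) (c : 'rV[K]_r.+1) (x v : 'rV[K]_3) (a f q : P).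

Lemma pullback_rescale d f c M : f \is d.-homog ->
  pullback f (diag_mx c *m M) = c 0 ord0 ^+ d * ev (row ord0 M) f.
Proof. by move=> fh; rewrite pullback_row row_rescale (ev_homog _ _ fh). Qed.

(** Over the plane minus the centres, the identity that defines the order is an
    identity of polynomials, in which [S] is not divisible by [q] while all the
    [A k i] are. *)
Lemma order_curve q d f e n : prime_elt q -> q \is d.-homog -> f \is e.-homog ->
  vanishes_to_order p (curve q) n f <-> divides (q ^+ n) f.
Proof.
move=> qP qh fh; split=> [[S [N [T [A [hS hA hid]]]]]|[g fE]]; last first.
  exists 1, 1%N, (fun=> lift_form r g), (fun _ _ => lift_form r q); split.
  - have [M [cM0 hM]] : exists M, curve q M.
      by have [_ [M cM] _] := curve_irreducible hp r0 qP; exists M.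
    by move/(_ M (conj cM0 hM)); rewrite /mxeval meval1 => /eqP; rewrite oner_eq0.
  - by move=> _ _ M /(curve_row0 qh); rewrite lift_formE pullback_row.
  - move=> M _; rewrite big_ord1 /mxeval meval1 mul1r -!/(mxeval _ _).
    under eq_bigr do rewrite lift_formE.
    by rewrite prodr_const card_ord lift_formE fE /pullback mevalM rmorphXn.
have [x0 [c [hc [ox0 [qx0 Sx0]]]]] : exists x c, rescaling c /\ off x /\ ev x q = 0 /\
    mxeval S (diag_mx c *m point_over x) != 0.
  apply: contrapT => hN; apply: hS => M [XM]; apply=> x c hc ox qx.
  by apply/eqP; apply: contra_notT hN => ne; exists x, c.
pose R B : P := pull (generic_family p) (rescale_poly c B).
have RE B x : ev x (R B) = mxeval B (diag_mx c *m point_over x).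
  by rewrite pullE ev_generic mxeval_rescale.
have qS : ~ divides q (R S).
  by move=> [b bE]; move: Sx0; rewrite -RE bE mevalM qx0 mulr0 eqxx.
have qA k i : divides q (R (A k i)).
  apply/(prime_curve hp _ qP) => x [ox qx]; rewrite RE; apply: hA.
  exact: curve_point.
have id : R S * (c 0 ord0 ^+ e *: f) = \sum_(k < N) R (T k) * \prod_(i < n) R (A k i).
  have [w [qw hw]] := off_form hp qP.
  have w0 : w != 0 by apply: contra_notN qw => /eqP->; apply: divides0.
  apply/eqP; rewrite -subr_eq0; apply: contraT => D0.
  have /mpoly_nonzero_point[y] := mulf_neq0 D0 w0.
  rewrite ev_fun mevalM mulf_eq0 negb_or => /andP[+ /hw ox].
  rewrite mevalB subr_eq0 mevalM mevalZ RE => /negP[]; apply/eqP.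
  set x := (\row_j y j) in ox *.
  have := hid (diag_mx c *m point_over x).
  rewrite (pullback_rescale _ _ fh) row0_over => -> //; last first.
    by apply: blowup_rescale => //; apply: point_over_blowup.
  rewrite raddf_sum /=; apply: eq_bigr => k _; rewrite mevalM RE rmorph_prod /=.
  by congr (_ * _); apply: eq_bigr => i _; rewrite RE.
have : divides (q ^+ n) (R S * (c 0 ord0 ^+ e *: f)).
  rewrite id; apply: divides_sum => k _; apply: divides_mull.
  have -> : q ^+ n = \prod_(i < n) q by rewrite prodr_const card_ord.
  elim/big_rec2: _ => [|i a b _ ab]; first exact: divides_refl.
  exact: dividesM.
move/(prime_expM qP qS) => [g gE]; exists ((c 0 ord0 ^+ e)^-1 *: g).
by rewrite -scalerAl -gE scalerA mulVf ?scale1r // expf_neq0.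
Qed.

(** On the lift of a general line through the centre, the identity that defines
    the order becomes one of polynomials in t, in which [S] is nonzero at t = 0
    while all the [A k i] vanish there. Conversely, the linear forms through the
    centre vanish on the exceptional curve. *)
Lemma order_exceptional l f e n : f \is e.-homog ->
  vanishes_to_order p (exceptional p l) n f <-> mult_ge f (p l) n.
Proof.
move=> fh; split=> [[S [N [T [A [hS hA hid]]]]]|fm]; last first.
  have [s [hs fE]] := mult_ge_ideal (p_neq0 hp l) fh fm.
  pose nt k := nth (0, [::]) s k.
  exists 1, (size s), (fun k => lift_form r (nt k).1),
    (fun k i => lift_form r (minor (p l) (nth o0 (nt k).2 i))); split.
  - have [M EM] := exceptional_nonempty hp l.
    by move/(_ M EM); rewrite /mxeval meval1 => /eqP; rewrite oner_eq0.
  - move=> j i M [_ [k _ eM]].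
    by rewrite lift_formE pullback_row ev_minor eM crossZr cross_self !mxE mulr0.
  - move=> M _; have -> : mxeval 1 M = 1 by rewrite /mxeval meval1.
    rewrite mul1r pullback_row fE raddf_sum /= (big_nth (0, [::])) big_mkord; apply: eq_bigr => k _.
    rewrite mevalM rmorph_prod /= lift_formE pullback_row; congr (_ * _).
    have sk : size (nt k).2 = n by apply: hs; apply: mem_nth.
    rewrite (big_nth o0) sk big_mkord; apply: eq_bigr => i _.
    by rewrite lift_formE pullback_row.
have [v0 [c [cv0 [hc Sv0]]]] : exists v c, cross (p l) v != 0 /\ rescaling c /\
    mxeval S (diag_mx c *m exc_point p l v) != 0.
  apply: contrapT => hN; apply: hS => M /(exceptional_point hp)[v [c [v0 hc ->]]].
  by apply/eqP; apply: contra_notT hN => ne; exists v, c.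
pose s : P := pull (exc_family p l) (rescale_poly c S).
have sE v : ev v s = mxeval S (diag_mx c *m exc_point p l v).
  by rewrite pullE ev_exc mxeval_rescale.
have s0 : s != 0 by apply: contraNneq Sv0 => s0; rewrite -sE s0 meval0.
have [i m0] := minor_neq0 (p_neq0 hp l).
apply/mult_geP => k kn; apply/eqP; apply: contraT => f0.
have /mpoly_nonzero_point[y] := mulf_neq0 (mulf_neq0 f0 s0) m0.
rewrite ev_fun; set v := \row_j y j; rewrite !mevalM ev_minor !mulf_eq0 !negb_or.
move=> /andP[/andP[fv sv] cv].
have {cv} cv : cross (p l) v != 0 by apply: contraNneq cv => ->; rewrite mxE.
pose R B : {poly K} := line_pull p l v (rescale_poly c B).
have RE B t : (R B).[t] = mxeval B (diag_mx c *m line_point p l v t).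
  by rewrite line_pull_at mxeval_rescale.
have id : R S * (c 0 ord0 ^+ e *: line f (p l) v) =
    \sum_(k < N) R (T k) * \prod_(i < n) R (A k i).
  apply/eqP; rewrite -subr_eq0; apply/eqP; apply: (line_poly_eq hp cv) => t t0 ot.
  apply/eqP; rewrite hornerD hornerN subr_eq0 hornerM RE hornerZ line_at horner_sum; apply/eqP.
  have [d hd lE] := line_point_over p l v t0.
  have := hid (diag_mx c *m line_point p l v t).
  rewrite (pullback_rescale _ _ fh) family0 => -> //; last first.
    apply: blowup_rescale => //; rewrite lE; apply: blowup_rescale => //.
    exact: point_over_blowup.
  apply: eq_bigr => j _; rewrite hornerM horner_prod RE; congr (_ * _).
  by apply: eq_bigr => m _; rewrite RE.
have RA j m : exists B, R (A j m) = B * 'X.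
  have /factor_theorem[B] : root (R (A j m)) 0.
    apply/rootP; rewrite RE line_point0; apply: hA.
    exact: exc_point_exceptional.
  by rewrite subr0 => ->; exists B.
have [B BE] : exists B, R S * (c 0 ord0 ^+ e *: line f (p l) v) = B * 'X^n.
  rewrite id; elim/big_rec: _ => [|j C _ [B ->]]; first by exists 0; rewrite mul0r.
  have [D ->] : exists D, \prod_(m < n) R (A j m) = D * 'X^n.
    have /choice[D hD] := RA j; exists (\prod_(m < n) D m).
    rewrite (eq_bigr _ (fun m _ => hD m)) big_split /=.
    by rewrite prodr_const card_ord.
  by exists (R (T j) * D + B); rewrite mulrDl mulrA.
have RS0 : ~~ root (R S) 0 by rewrite /root RE line_point0 -sE.
have : 'X^n %| line f (p l) v.
  have cop : coprimep 'X^n (R S).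
    have copX := coprimep_XsubC (R S) 0; rewrite polyC0 subr0 RS0 in copX.
    by apply: coprimep_expl; rewrite coprimep_sym copX.
  have c0 : c 0 ord0 ^+ e != 0 by rewrite expf_neq0.
  rewrite -(dvdpZr _ _ c0) -(Gauss_dvdpr _ cop) BE dvdp_mulIr //.
move=> /dvdpP[G lE]; move: fv; rewrite -coef_line lE coefMXn kn eqxx.
by [].
Qed.

(** The tangent cone: were the exceptional curve contained in the strict
    transform of q = 0, every polynomial that vanishes on the latter would
    vanish on it; but q is a sum of products T l_1 ... l_n, n its multiplicity,
    and replacing the linear forms l_i by coordinates of L_l gives such a
    polynomial, whose restriction to the exceptional curve is the tangent cone. *)
Lemma exceptional_not_curve l q d : prime_elt q -> q \is d.-homog ->
  ~ (exceptional p l `<=` curve q).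
Proof.
move=> qP qh sub; have [q0 _ _] := qP.
have [n qn] := mult_exact_ex (p l) q0.
have [s [hs qE]] := mult_ge_ideal (p_neq0 hp l) qh (proj1 qn).
pose rowv i : Q := 'X_(mxvec_index (lift ord0 l) i).
have rowvE i M : mxeval (rowv i) M = row (lift ord0 l) M 0 i.
  by rewrite /mxeval mevalXU mxvecE mxE.
pose A : Q := \sum_(t <- s) lift_form r t.1 * \prod_(i <- t.2) rowv i.
have AE M : mxeval A M = \sum_(t <- s) ev (row ord0 M) t.1 *
    \prod_(i <- t.2) row (lift ord0 l) M 0 i.
  rewrite /mxeval raddf_sum /=; apply: eq_bigr => t _.
  rewrite mevalM -!/(mxeval _ _) lift_formE pullback_row mxeval_prod; congr (_ * _).
  by apply: eq_bigr => i _; rewrite rowvE.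
have Acurve M : curve q M -> mxeval A M = 0.
  move=> [_]; apply=> x c hc ox qx; rewrite AE !row_rescale row0_over familyS.
  have c0 := hc ord0; set k := c 0 ord0 in c0 *; set m := c 0 _.
  have : (m / k) ^+ n * ev (k *: x) q = 0 by rewrite (ev_homog _ _ qh) qx !mulr0.
  move=> zero; rewrite -[RHS]zero qE raddf_sum /= mulr_sumr big_seq [RHS]big_seq.
  apply: eq_bigr => t /hs tn; rewrite mevalM rmorph_prod /= mulrCA; congr (_ * _).
  rewrite -tn; elim: (t.2) => [|i u IH]; first by rewrite !big_nil expr0 mulr1.
  rewrite !big_cons IH ev_minor crossZr !mxE exprS [RHS]mulrACA; congr (_ * _).
  by rewrite mulrA divfK.
have [i m0] := minor_neq0 (p_neq0 hp l).
have /mpoly_nonzero_point[y] := mulf_neq0 (mult_exact_coef qn) m0.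
rewrite ev_fun; set v := \row_j y j; rewrite mevalM ev_minor mulf_eq0 negb_or.
rewrite -coef_line => /andP[qv cv].
have {cv} cv : cross (p l) v != 0 by apply: contraNneq cv => ->; rewrite mxE.
have h1 : rescaling (const_mx 1 : 'rV[K]_r.+1) by move=> j; rewrite mxE oner_neq0.
have /sub/Acurve := exc_point_exceptional hp h1 cv.
rewrite diag_const_mx mul1mx AE family0 familyS eqxx => e.
move/eqP: qv; apply; rewrite -[RHS]e.
have lmin j : line (minor (p l) j) (p l) v = (cross (p l) v 0 j)%:P * 'X.
  apply/eqP; rewrite -subr_eq0; apply: contraT => /poly_nonroot[t].
  rewrite hornerD hornerN hornerM hornerC hornerX line_at ev_minor.
  by rewrite crossDr cross_self add0r crossZr mxE mulrC subrr eqxx.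
rewrite {1}qE /line raddf_sum /= coef_sum big_seq [RHS]big_seq; apply: eq_bigr => t /hs tn.
rewrite rmorphM rmorph_prod /= -/(line _ _ _).
under eq_bigr do rewrite -/(line _ (p l) v) lmin.
rewrite big_split /= big_const_seq count_predT tn.
rewrite (_ : iter n _ 1 = 'X^n); last by elim: (n) => //= m ->; rewrite exprS.
rewrite mulrA coefMXn ltnn subnn coef0M -!horner_coef0 -/(line _ _ _) line_at scale0r addr0.
by rewrite horner_prod; congr (_ * _); apply: eq_bigr => j _; rewrite hornerC.
Qed.

Lemma exceptional_prime_divisor l : prime_divisor p (exceptional p l).
Proof.
split; [exact: exceptional_irreducible|exact: exceptional_neq_blowup|].
move=> Z iZ sub; have [->|ZX] := pselect (Z = X); [by right|left].
have [[q [d [qP qh sub']]]|[j sub']] := irreducible_proper hp r0 iZ ZX.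
  by case: (@exceptional_not_curve l q d qP qh (subset_trans sub sub')).
have e := exceptional_sub hp (subset_trans sub sub').
by apply/seteqP; split=> //; rewrite e.
Qed.

(** Every proper irreducible closed subset lies in one of these curves, and there
    are no inclusions between them. *)
Theorem prime_divisorP G : prime_divisor p G <->
  (exists q d, [/\ prime_elt q, q \is d.-homog & G = curve q]) \/
  exists l, G = exceptional p l.
Proof.
split=> [[iG GX Gmax]|[[q [d [qP qh ->]]]|[l ->]]]; last 2 first.
- exact: curve_prime_divisor qh.
- exact: exceptional_prime_divisor.
have [[q [d [qP qh sub]]]|[l sub]] := irreducible_proper hp r0 iG GX; [left|right].
  exists q, d; split=> //.
  have [//|e] := Gmax _ (curve_irreducible hp r0 qP) sub.
  by case: (curve_neq_blowup hp r0 qP qh e).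
exists l; have [//|e] := Gmax _ (exceptional_irreducible hp l) sub.
by case: (exceptional_neq_blowup hp r0 e).
Qed.

End Orders.

(** * Divisors of forms and sections of line bundles *)

Lemma exact_order_unique (V : nat -> Prop) k :
  (forall m n, (m <= n)%N -> V n -> V m) -> V k -> ~ V k.+1 ->
  xget 0%N [set n | V n /\ ~ V n.+1] = k.
Proof.
move=> Vle Vk nVk; apply: xget_unique => // n [Vn nVn].
case: (ltngtP n k) => // lt; first by case: nVn; apply: Vle Vk.
by case: nVk; apply: Vle Vn.
Qed.

Section Divisors.
Variables (K : numClosedFieldType) (r : nat) (p : 'I_r -> 'rV[K]_3).
Hypotheses (hp : distinct_points p) (r0 : (0 < r)%N).

Local Notation P := {mpoly K[3]}.
Local Notation Mx := 'M[K]_(r.+1, 3).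
Local Notation curve := (curve p).
Local Notation exc := (exceptional p).
Local Notation div := (div_pullback p).
Implicit Types (f g q : P) (G : set Mx).

Lemma div_curve q d f e k : prime_elt q -> q \is d.-homog -> f \is e.-homog ->
  divides (q ^+ k) f -> ~ divides (q ^+ k.+1) f -> div f (curve q) = k%:Z.
Proof.
move=> qP qh fh h1 h2; rewrite /div_pullback asboolT; last exact: curve_prime_divisor qh.
congr Posz; apply: (@exact_order_unique (fun n => vanishes_to_order p (curve q) n f)).
- move=> m n le /(order_curve hp r0 _ qP qh fh) h; apply/(order_curve hp r0 _ qP qh fh).
  by apply: divides_trans h; apply: divides_exp.
- exact/(order_curve hp r0 _ qP qh fh).
- by move/(order_curve hp r0 _ qP qh fh).
Qed.

Lemma div_exceptional l f e k : f \is e.-homog -> mult_exact f (p l) k ->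
  div f (exc l) = k%:Z.
Proof.
move=> fh [h1 h2]; rewrite /div_pullback asboolT; last exact: exceptional_prime_divisor.
congr Posz; apply: (@exact_order_unique (fun n => vanishes_to_order p (exc l) n f)).
- move=> m n le /(order_exceptional hp r0 l _ fh) h; apply/(order_exceptional hp r0 l _ fh).
  exact: mult_geW h.
- exact/(order_exceptional hp r0 l _ fh).
- by move/(order_exceptional hp r0 l _ fh).
Qed.

Lemma div_not_prime G f : ~ prime_divisor p G -> div f G = 0.
Proof. by move=> nG; rewrite /div_pullback asboolF. Qed.

Lemma div_ge0 f G : 0 <= div f G.
Proof. by rewrite /div_pullback; case: ifP. Qed.

Lemma prime_divisor_ind (Pr : set Mx -> Prop) :
  (forall q d, prime_elt q -> q \is d.-homog -> Pr (curve q)) ->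
  (forall l, Pr (exc l)) -> (forall G, ~ prime_divisor p G -> Pr G) ->
  forall G, Pr G.
Proof.
move=> hq hl hn G; have [|nG] := pselect (prime_divisor p G); last exact: hn.
by case/(prime_divisorP hp r0) => [[q [d [qP qh ->]]]|[l ->]]; [apply: hq qh|apply: hl].
Qed.

Lemma exact_order_mul q f g m n : prime_elt q ->
  divides (q ^+ m) f /\ ~ divides (q ^+ m.+1) f ->
  divides (q ^+ n) g /\ ~ divides (q ^+ n.+1) g ->
  divides (q ^+ (m + n)) (f * g) /\ ~ divides (q ^+ (m + n).+1) (f * g).
Proof.
move=> qP [[a fE] hf] [[b gE] hg]; have [q0 _ qq] := qP.
split; first by rewrite exprD; apply: dividesM; [exists a|exists b].
rewrite fE gE mulrACA -exprD exprS => -[c].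
rewrite mulrA => /(mulIf (expf_neq0 _ q0)) ab.
have : divides q (a * b) by exists c.
case/qq => -[x h]; [apply: hf|apply: hg].
  by exists x; rewrite fE h exprS mulrA.
by exists x; rewrite gE h exprS mulrA.
Qed.

Lemma div_mul f g d e : f != 0 -> g != 0 -> f \is d.-homog -> g \is e.-homog ->
  div (f * g) = div f + div g.
Proof.
move=> f0 g0 fh gh; apply: funext => G; rewrite addrfctE.
have fgh := dhomogM fh gh.
elim/prime_divisor_ind: G => [q k qP qh|l|G nG]; last by rewrite !div_not_prime.
- have [m hm] := prime_exact_order qP f0; have [n hn] := prime_exact_order qP g0.
  have [h1 h2] := exact_order_mul qP hm hn; case: hm hn => [m1 m2] [n1 n2].
  rewrite (div_curve qP qh fh m1 m2) (div_curve qP qh gh n1 n2).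
  by rewrite (div_curve qP qh fgh h1 h2) PoszD.
- have [m hm] := mult_exact_ex (p l) f0; have [n hn] := mult_exact_ex (p l) g0.
  rewrite (div_exceptional fh hm) (div_exceptional gh hn).
  by rewrite (div_exceptional fgh (mult_exactM hm hn)) PoszD.
Qed.

Lemma mult_exact1 (u : 'rV[K]_3) : mult_exact (1 : P) u 0.
Proof.
split=> // /(_ 0 0%N isT); rewrite -horner_coef0 line_at meval1.
by apply/eqP; rewrite oner_neq0.
Qed.

Lemma div_unit f : f != 0 -> f \is 0.-homog -> div f = 0.
Proof.
move=> f0 fh; apply: funext => G.
have fu : f \is a GRing.unit by rewrite mpoly_unitP f0.
elim/prime_divisor_ind: G => [q k qP qh|l|G nG]; last by rewrite div_not_prime.
  apply: (div_curve qP qh fh); first exact/divides_unit/unitr1.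
  by rewrite expr1; apply: prime_not_unit.
have [m hm] := mult_exact_ex (p l) f0.
have [g [gf _]] := unitrP fu.
have g0 : g != 0 by apply: contraTneq (oner_neq0 P) => g0; rewrite -gf g0 mul0r eqxx.
have [n hn] := mult_exact_ex (p l) g0.
have := mult_exact_uniq (mult_exactM hn hm); rewrite gf => /(_ _ (mult_exact1 _)) e.
rewrite (div_exceptional fh hm); congr Posz; lia.
Qed.

Lemma div_exp f d n : f != 0 -> f \is d.-homog -> div (f ^+ n) = div f *+ n.
Proof.
move=> f0 fh; elim: n => [|n IH]; first by rewrite expr0 mulr0n div_unit ?oner_neq0 // dhomog1.
by rewrite exprS (@div_mul _ _ d (d * n)) ?expf_neq0 ?dhomogMn // IH mulrS.
Qed.

(** Polynomial rings are factorial, and the prime factors of a form are forms. *)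
Lemma divides_of_div f g d e : f != 0 -> g != 0 -> f \is d.-homog -> g \is e.-homog ->
  (forall q k, prime_elt q -> q \is k.-homog -> div g (curve q) <= div f (curve q)) ->
  divides g f.
Proof.
move=> f0 g0 fh gh h; apply: (factorial_divides (@factorial_mpoly 3 K)) => // q [|n] qP hn.
  exact/divides_unit/unitr1.
have [k qh] : exists k, q \is k.-homog.
  have [a gE] : divides q g by apply: divides_trans hn; rewrite -{1}[q]expr1; apply: divides_exp.
  move: gh g0; rewrite gE mulrC => gh g0; have [k _ [qh _]] := homog_factor g0 gh.
  by exists k.
have [a [a1 a2]] := prime_exact_order qP f0; have [b [b1 b2]] := prime_exact_order qP g0.
have := h q k qP qh; rewrite (div_curve qP qh fh a1 a2) (div_curve qP qh gh b1 b2) lez_nat => ba.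
apply: divides_trans a1; apply: divides_exp; apply: leq_trans ba.
rewrite leqNgt; apply/negP => lt; apply: b2.
by apply: divides_trans hn; apply: divides_exp.
Qed.

Local Notation X0 := ('X_ord0 : P).

Lemma X0_neq0 : X0 != 0.
Proof. by rewrite -msupp_eq0 msuppX. Qed.

Lemma X0_homog : X0 \is 1.-homog.
Proof. by rewrite dhomogX /= mdeg1. Qed.

Lemma X0n_homog d : X0 ^+ d \is d.-homog.
Proof. by rewrite -[X in X.-homog]mul1n; apply: dhomogMn; exact: X0_homog. Qed.

Lemma X0n_neq0 d : X0 ^+ d != 0.
Proof. by rewrite expf_neq0 // X0_neq0. Qed.

Lemma curve_neq_exc q l : prime_elt q -> curve q <> exc l.
Proof. by move=> qP e; apply: (@curve_not_exceptional _ _ _ hp r0 q l qP); rewrite e. Qed.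

Lemma div_classE d m G : div_class p d m G =
  div (X0 ^+ d) G - \sum_(l < r) divE p l G *+ m l.
Proof.
rewrite /div_class /divH (div_exp d X0_neq0 X0_homog).
rewrite addrfctE opprfctE; congr (_ - _).
by rewrite fct_sumE; apply: eq_bigr => l _; rewrite natmulfctE.
Qed.

Lemma divE_exc l j : divE p l (exc j) = (l == j)%:Z.
Proof.
rewrite /divE; congr (Posz (nat_of_bool _)); apply/asboolP/eqP => [e|-> //].
by apply/esym; apply: (exceptional_sub hp); rewrite e.
Qed.

Lemma class_exc d m l : div_class p d m (exc l) = div (X0 ^+ d) (exc l) - (m l)%:Z.
Proof.
rewrite div_classE (bigD1 l) //= big1 => [|j jl]; rewrite divE_exc ?eqxx ?(negPf jl) ?mul0rn //.
by rewrite addr0 /= -[(m l)%:Z]natz.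
Qed.

Lemma class_curve d m q : prime_elt q -> div_class p d m (curve q) = div (X0 ^+ d) (curve q).
Proof.
move=> qP; rewrite div_classE big1 ?subr0 // => l _.
by rewrite /divE asboolF ?mul0rn //; apply: curve_neq_exc.
Qed.

Lemma class_not_prime d m G : ~ prime_divisor p G -> div_class p d m G = 0.
Proof.
move=> nG; rewrite div_classE div_not_prime // big1 ?subr0 // => l _.
rewrite /divE asboolF ?mul0rn // => e; apply: nG; rewrite e.
exact: exceptional_prime_divisor.
Qed.

(** The forms whose divisor minus sum_l m_l E_l is effective and linearly
    equivalent to d H - sum_l m_l E_l. *)
Definition in_class d (m : 'I_r -> nat) f := f \is d.-homog /\ forall l, mult_ge f (p l) (m l).

(** Along the strict transforms of plane curves f X0^d / g has no poles, so it is
    a form; along the exceptional curves its multiplicities are bounded below. *)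
Lemma section_form d m k f g : f != 0 -> g != 0 -> f \is k.-homog -> g \is k.-homog ->
  (forall G, 0 <= (div f - div g + div_class p d m) G) ->
  exists2 h, in_class d m h & f * X0 ^+ d = h * g.
Proof.
move=> f0 g0 fh gh pos.
have F0 : f * X0 ^+ d != 0 by rewrite mulf_neq0 // X0n_neq0.
have Fh : f * X0 ^+ d \is (k + d).-homog by apply: dhomogM => //; apply: X0n_homog.
have FE : div (f * X0 ^+ d) = div f + div (X0 ^+ d).
  by apply: (div_mul (d := k) (e := d)); rewrite ?X0n_neq0 ?X0n_homog.
have [h hE] : divides g (f * X0 ^+ d).
  apply: (divides_of_div F0 g0 Fh gh) => q j qP qh.
  have := pos (curve q); rewrite FE !addrfctE opprfctE class_curve //.
  by rewrite addrAC subr_ge0.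
exists h => //; have h0 : h != 0 by apply: contraNneq F0 => h0; rewrite hE h0 mul0r.
rewrite hE in F0 Fh; have [i ik [hh gh']] := homog_factor F0 Fh.
have e : (k + d - i)%N = k by apply: dhomog_uniq g0 gh' gh.
have {e ik gh'} id : i = d by move: e ik; clear; lia.
rewrite {i}id in hh; split=> // l.
have [a ha] := mult_exact_ex (p l) h0; have [b hb] := mult_exact_ex (p l) g0.
have e1 := congr1 (fun D => D (exc l)) FE.
rewrite /= addrfctE hE (div_exceptional Fh (mult_exactM ha hb)) in e1.
have := pos (exc l); rewrite !addrfctE opprfctE class_exc (div_exceptional gh hb).
move=> e2; apply: mult_geW (proj1 ha); move: e1 e2.
set x := div f _; set y := div _ _; move: x y; clear => x y; lia.
Qed.

Lemma form_section d m h G : h != 0 -> in_class d m h ->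
  0 <= (div h - div (X0 ^+ d) + div_class p d m) G.
Proof.
move=> h0 [hh hm]; rewrite !addrfctE opprfctE.
elim/prime_divisor_ind: G => [q k qP qh|l|G nG].
- by rewrite class_curve // subrK div_ge0.
- rewrite class_exc addrA subrK.
  have [a ha] := mult_exact_ex (p l) h0; rewrite (div_exceptional hh ha).
  by rewrite subr_ge0 lez_nat; apply: mult_exact_leq ha (hm l).
- by rewrite class_not_prime // !div_not_prime.
Qed.

Definition independent n (f : 'I_n -> P) :=
  forall c : 'I_n -> K, \sum_(i < n) c i *: f i = 0 -> forall i, c i = 0.

Lemma independent_neq0 n (f : 'I_n -> P) i : independent f -> f i != 0.
Proof.
move=> fi; apply: contraT; rewrite negbK => /eqP fi0.
have s0 : \sum_(j < n) (j == i)%:R *: f j = 0.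
  rewrite (bigD1 i) //= fi0 scaler0 add0r big1 // => j ji.
  by rewrite (negPf ji) scale0r.
by have := fi _ s0 i; rewrite eqxx => /eqP; rewrite oner_eq0.
Qed.

Definition class_dim_ge d m n := exists f : 'I_n -> P,
  independent f /\ forall i, in_class d m (f i).

(** Multiplication by X0^d / g turns sections into forms. *)
Theorem h0_geP d m n : h0_ge p (div_class p d m) n <-> class_dim_ge d m n.
Proof.
split=> [[k [g [f [g0 gh fh fi pos]]]]|[h [hi hc]]]; last first.
  exists d, (X0 ^+ d), h; split=> //; [exact: X0n_neq0|exact: X0n_homog|by move=> i; case: (hc i)|].
  by move=> i G; apply: form_section => //; apply: independent_neq0.
have /choice[h hE] : forall i, exists h, in_class d m h /\ f i * X0 ^+ d = h * g.
  move=> i; have [h h1 h2] := section_form (independent_neq0 i fi) g0 (fh i) gh (pos i).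
  by exists h.
exists h; split=> [c cE|i]; last by case: (hE i).
apply: fi; apply: (mulIf (X0n_neq0 d)); rewrite mul0r mulr_suml.
rewrite (eq_bigr (fun i => c i *: h i * g)) => [|i _]; last by rewrite -!scalerAl; case: (hE i) => _ ->.
by rewrite -mulr_suml cE mul0r.
Qed.

End Divisors.

(** * The expected dimension *)

Definition mon3 (e : seq nat) : 'X_{1..3} := [multinom nth 0%N e i | i < 3].

Lemma mon3E (m : 'X_{1..3}) : m = mon3 [:: m o0; m o1; m o2].
Proof. by apply/mnmP; apply: ord3P; rewrite mnmE. Qed.

Lemma mdeg3 (m : 'X_{1..3}) : mdeg m = (m o0 + m o1 + m o2)%N.
Proof. by rewrite mdegE big_ord3. Qed.

Lemma triangular_sum n : (\sum_(k < n) k.+1)%N = 'C(n.+1, 2).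
Proof.
elim: n => [|n IH]; first by rewrite big_ord0.
by rewrite big_ord_recr /= IH [in RHS]binS bin1 addnC.
Qed.

Section Dimension.
Variable K : numClosedFieldType.
Local Notation P := {mpoly K[3]}.
Implicit Types (u v w : 'rV[K]_3) (f g q : P).

(** Write v = w + s u with w in the plane x_j = 0; then f (u + t v) is the product
    of (1 + s t)^d and f (u + t' w), where t' = t / (1 + s t). *)
Lemma mult_ge_transversal d f u j n : u 0 j != 0 -> f \is d.-homog ->
  (forall w k, w 0 j = 0 -> (k < n)%N -> (line f u w)`_k = 0) -> mult_ge f u n.
Proof.
move=> uj fh h v k kn; pose s := v 0 j / u 0 j; pose w := v - s *: u.
have wj : w 0 j = 0 by rewrite !mxE /s divfK // subrr.
have vE : v = w + s *: u by rewrite subrK.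
pose D : {poly K} := 1 + s *: 'X.
have D0 : D != 0.
  apply: contraNneq (oner_neq0 K) => /(congr1 (horner_eval 0)).
  by rewrite /horner_eval !hornerE ?mulr0 ?addr0 => /eqP.
have lE : line f u v = \sum_(i < d.+1) (line f u w)`_i *: ('X^i * D ^+ (d - i)).
  apply/eqP; rewrite -subr_eq0; apply: contraT => F0.
  have /poly_nonroot[t] := mulf_neq0 F0 D0.
  rewrite hornerM mulf_eq0 negb_or => /andP[+ Dt].
  rewrite hornerD hornerN subr_eq0 => /negP[]; apply/eqP.
  set a := D.[t] in Dt; have aE : a = 1 + t * s.
    by rewrite /a /D hornerD hornerZ hornerX -[1 in LHS]/(1%:P) hornerC [s * t]mulrC.
  rewrite line_at vE.
  have key (b : K) (w' : 'rV[K]_3) : a = 1 + t * b ->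
      u + t *: (w' + b *: u) = a *: (u + (t / a) *: w').
    move=> ab; rewrite [RHS]scalerDr scalerA [a * (t / a)]mulrC divfK // ab.
    by rewrite scalerDl scale1r scalerDr scalerA addrA addrAC.
  rewrite (key _ _ aE) {key}.
  rewrite (ev_homog _ _ fh) -line_at (horner_coef_wide _ (line_size u w fh)) mulr_sumr.
  rewrite horner_sum; apply: eq_bigr => -[i /= lt] _.
  rewrite hornerZ hornerM hornerXn horner_exp -/a.
  have -> : a ^+ d = a ^+ (d - i) * a ^+ i by rewrite -exprD subnK.
  rewrite expr_div_n; field; exact: expf_neq0.
rewrite lE coef_sum big1 // => -[i /= lt] _.
rewrite coefZ coefXnM; case: ltnP => [_|ik]; first by rewrite mulr0.
by rewrite h ?mul0r // (leq_ltn_trans ik).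
Qed.

(** The exponents of the monomials of degree a + b without the variable j. *)
Definition mon_off (j : 'I_3) a b : 'X_{1..3} :=
  mon3 (nth [::] [:: [:: 0; a; b]; [:: a; 0; b]; [:: a; b; 0]] j).

Lemma mon_off_ex j (m : 'X_{1..3}) : m j = 0%N -> exists2 a, (a <= mdeg m)%N &
  m = mon_off j a (mdeg m - a)%N.
Proof.
rewrite mdeg3 [m]mon3E; move: (m o0) (m o1) (m o2) => a b c; move: j.
apply: ord3P; rewrite mnmE /= => ->; rewrite ?mnmE /=.
- by exists b; rewrite ?add0n ?leq_addr // addKn.
- by exists a; rewrite ?addn0 ?leq_addr // addKn.
- by exists a; rewrite ?addn0 ?leq_addr // addKn.
Qed.

(** In each order k this leaves the k + 1 coefficients of a binary form. *)
Lemma mult_ge_coefs d f u j n : u 0 j != 0 -> f \is d.-homog ->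
  (forall k a, (k < n)%N -> (a <= k)%N ->
     (generic_line f u)`_k@_(mon_off j a (k - a)%N) = 0) -> mult_ge f u n.
Proof.
move=> uj fh h; apply: (mult_ge_transversal uj fh) => w k wj kn.
have ch := generic_line_homog f u k.
rewrite coef_line mevalE big_seq big1 // => m mc.
have mk : mdeg m = k by have /dhomogP := ch; apply.
have [mj|mj] := posnP (m j).
  have [a ak mE] := mon_off_ex mj; rewrite mk in ak mE.
  by rewrite mE h ?mul0r.
by rewrite (bigD1 j) //= wj expr0n -[_ == _]negbK -lt0n mj mul0r mulr0.
Qed.

Section Forms.
Variables (r : nat) (p : 'I_r -> 'rV[K]_3).
Hypothesis p0 : forall l, p l != 0.

Lemma in_class_lin d m n (f : 'I_n -> P) (c : 'I_n -> K) :
  (forall i, in_class p d m (f i)) -> in_class p d m (\sum_(i < n) c i *: f i).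
Proof.
move=> h; split.
  by apply: rpred_sum => i _; apply: rpredZ; case: (h i).
move=> l; apply: (big_ind (fun g => mult_ge g (p l) (m l))) => [v k _|? ?|i _].
- by rewrite /line raddf0 coef0.
- exact: mult_geD.
- by apply: mult_geZ; case: (h i).
Qed.

Lemma class_dim_geW d (m : 'I_r -> nat) n n' : (n <= n')%N ->
  class_dim_ge p d m n' -> class_dim_ge p d m n.
Proof.
move=> le [f [fi fc]]; exists (fun i => f (widen_ord le i)); split=> // c cf i.
pose c' (i' : 'I_n') := if insub (val i') is Some k then c k else 0.
have cE k : c' (widen_ord le k) = c k by rewrite /c' /= valK.
rewrite -cE; apply: fi; rewrite (bigID (fun i' : 'I_n' => (i' < n)%N)) /=.
rewrite (big_ord_narrow le) (eq_bigr _ (fun k _ => congr1 (fun b => b *: _) (cE k))) cf add0r.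
by apply: big1 => i' ni; rewrite /c' insubN // scale0r.
Qed.

(** A point of multiplicity m imposes m (m + 1) / 2 linear conditions. *)
Theorem expected_dimension d (m : 'I_r -> nat) n :
  (n + \sum_(l < r) 'C((m l).+1, 2) <= 'C(d.+2, 2))%N -> class_dim_ge p d m n.
Proof.
move=> hn; have /choice[j hj] : forall l, exists j, p l 0 j != 0 by move=> l; apply: row_neq0.
pose T : finType := {a : 'I_d.+1 & 'I_a.+1}.
pose C : finType := {l : 'I_r & {k : 'I_(m l) & 'I_k.+1}}.
have cT : #|T| = 'C(d.+2, 2).
  rewrite card_tagged sumnE big_map big_enum /= -triangular_sum.
  by apply: eq_bigr => a _; rewrite card_ord.
have cC : #|C| = (\sum_(l < r) 'C((m l).+1, 2))%N.
  rewrite card_tagged sumnE big_map big_enum /=; apply: eq_bigr => l _.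
  rewrite card_tagged sumnE big_map big_enum /= -triangular_sum.
  by apply: eq_bigr => a _; rewrite card_ord.
pose mon (t : T) : 'X_{1..3} := mon3 [:: (d - tag t)%N; (tag t - tagged t)%N; nat_of_ord (tagged t)].
have mon_deg t : mdeg (mon t) = d.
  rewrite mdeg3 !mnmE /= -addnA subnK ?subnK //; first by rewrite -ltnS; case: (tag t).
  by rewrite -ltnS; case: (tagged t).
have mon_inj : injective mon.
  move=> [a b] [a' b'] /mnmP e.
  have := e o1; have := e o2; rewrite !mnmE /= => eb ea.
  have aa : a = a'.
    apply: val_inj => /=; move: (ltn_ord b) (ltn_ord b'); rewrite !ltnS => ba ba'.
    by rewrite -(subnK ba) -(subnK ba') ea eb.
  by subst a'; congr existT; apply: val_inj.
pose cond (t : C) f : K :=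
  (generic_line f (p (tag t)))`_(tag (tagged t))@_(mon_off (j (tag t)) (tagged (tagged t))
    (tag (tagged t) - tagged (tagged t))%N).
pose A : 'M[K]_(#|T|, #|C|) := \matrix_(s, t) cond (enum_val t) 'X_[mon (enum_val s)].
have rk : (n <= \rank (kermx A))%N.
  have hTC : (n + #|C| <= #|T|)%N by rewrite cT cC.
  rewrite mxrank_ker; apply: leq_trans (leq_sub2l _ (rank_leq_col A)).
  by rewrite leq_subRL 1?addnC //; apply: leq_trans hTC; rewrite leq_addl.
apply: class_dim_geW rk _.
pose B := row_base (kermx A); have Bfree : row_free B := row_base_free _.
have BA : B *m A = 0 by apply/sub_kermxP; rewrite eq_row_base.
pose f i : P := \sum_(s < #|T|) B i s *: 'X_[mon (enum_val s)].
exists f; split=> [c cf i|i].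
  have : (\row_i c i) *m B = 0.
    apply/rowP => s; rewrite mxE [RHS]mxE.
    have := congr1 (fun g => g@_(mon (enum_val s))) cf; rewrite mcoeff0 raddf_sum /= => e; rewrite -[RHS]e.
    apply: eq_bigr => i' _; rewrite mcoeffZ mxE; congr (_ * _).
    rewrite raddf_sum /= (bigD1 s) //= big1 => [|s' ss'].
      by rewrite mcoeffZ mcoeffX eqxx mulr1 addr0.
    by rewrite mcoeffZ mcoeffX (inj_eq mon_inj) (inj_eq enum_val_inj) (negPf ss') mulr0.
  rewrite -(mul0mx _ B) => /(row_free_inj Bfree)/rowP/(_ i).
  by rewrite !mxE.
have fh : f i \is d.-homog.
  by apply: rpred_sum => s _; apply: rpredZ; rewrite dhomogX /= mon_deg.
split=> // l; apply: (mult_ge_coefs (hj l) fh) => k a kn ak.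
pose t : C := @Tagged _ l (fun l => {k : 'I_(m l) & 'I_k.+1})
   (@Tagged _ (Ordinal kn) (fun k : 'I_(m l) => 'I_k.+1) (Ordinal (ak : (a < k.+1)%N))).
have : (B *m A) i (enum_rank t) = 0 by rewrite BA mxE.
rewrite mxE; under eq_bigr do rewrite [A _ _]mxE enum_rankK; move=> zero; rewrite -[RHS]zero.
rewrite /generic_line raddf_sum coef_sum raddf_sum /=; apply: eq_bigr => s _.
by rewrite mmapZ /= coefCM mcoeffCM.
Qed.

End Forms.
End Dimension.

(** * Dimensions, products, permutations and derivatives *)

Section ClassDimension.
Variables (K : numClosedFieldType) (r : nat).
Local Notation P := {mpoly K[3]}.
Implicit Types (p : 'I_r -> 'rV[K]_3) (f g h : P) (d n : nat) (m : 'I_r -> nat).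

Lemma independent_bound d n (f : 'I_n -> P) : independent f ->
  (forall i, f i \is d.-homog) -> (n <= #|{: 'X_{1..3 < d.+1}}|)%N.
Proof.
move=> fi fh; pose A : 'M[K]_(n, #|{: 'X_{1..3 < d.+1}}|) :=
  \matrix_(i, j) (f i)@_(val (enum_val j : 'X_{1..3 < d.+1})).
suff /eqP <- : row_free A by apply: rank_leq_col.
apply: inj_row_free => v vA; apply/rowP => i; rewrite [RHS]mxE.
apply: (fi (fun i => v 0 i)); apply/mpolyP => m; rewrite mcoeff0.
have [md|md] := eqVneq (mdeg m) d; last first.
  apply: (dhomog_nemf_coeff _ md); apply: rpred_sum => k _; exact: rpredZ.
have lt : (mdeg m < d.+1)%N by rewrite md.
have := congr1 (fun w : 'rV[K]_ _ => w 0 (enum_rank (BMultinom lt))) vA.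
rewrite mxE [RHS]mxE => zero; rewrite -[RHS]zero raddf_sum /=.
by apply: eq_bigr => k _; rewrite mcoeffZ [A _ _]mxE enum_rankK.
Qed.

Lemma class_dim_ge0 p d m : class_dim_ge p d m 0.
Proof. by exists (fun=> 0); split=> [c _ []|[]]. Qed.

(** The number of monomials bounds the dimensions, so that [h0] is the largest. *)
Theorem h0P p d m n : distinct_points p -> (0 < r)%N ->
  (n <= h0 p (div_class p d m))%N <-> class_dim_ge p d m n.
Proof.
move=> hp r0; pose V k := `[< class_dim_ge p d m k >].
have bound k : V k -> (k <= #|{: 'X_{1..3 < d.+1}}|)%N.
  move/asboolP => [f [fi fc]]; apply: (independent_bound fi) => i.
  by case: (fc i).
have exV : exists k, V k by exists 0%N; apply/asboolP/class_dim_ge0.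
have [k /asboolP hk kmax] := ex_maxnP exV bound.
have -> : h0 p (div_class p d m) = k.
  apply: (@exact_order_unique (fun n => h0_ge p (div_class p d m) n)).
  - by move=> a b ab /(h0_geP hp r0) h; apply/(h0_geP hp r0); apply: class_dim_geW h.
  - exact/(h0_geP hp r0).
  - move/(h0_geP hp r0) => h; have : (k.+1 <= k)%N by apply: kmax; apply/asboolP.
    by rewrite ltnn.
split=> [le|h]; first exact: class_dim_geW hk.
by apply: kmax; apply/asboolP.
Qed.

Lemma class_dim_ge1 p d m : class_dim_ge p d m 1 <-> exists2 f, f != 0 & in_class p d m f.
Proof.
split=> [[f [fi fc]]|[f f0 fc]].
  by exists (f ord0) => //; apply: independent_neq0.
exists (fun=> f); split=> // c; rewrite big_ord1 => /eqP.
by rewrite mscalerI (negPf f0) orbF => /eqP c0 i; rewrite ord1.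
Qed.

Lemma class_dim_lt2 p d m f g : ~ class_dim_ge p d m 2 ->
  in_class p d m f -> in_class p d m g -> f != 0 -> exists c, g = c *: f.
Proof.
move=> lt2 fc gc f0; apply: contrapT => /forallNP ng; apply: lt2.
exists (fun i : 'I_2 => if i == ord0 then f else g); split=> [c|i]; last by case: ifP.
rewrite !big_ord_recl big_ord0 addr0 /= => e.
have c1 : c (lift ord0 ord0) = 0.
  apply/eqP; apply: contraT => c1; case: (ng (- (c (lift ord0 ord0))^-1 * c ord0)).
  move/eqP: e; rewrite addrC addr_eq0 => /eqP e.
  by rewrite mulNr scaleNr -scalerA -scalerN -e scalerA mulVf // scale1r.
move: e; rewrite c1 scale0r addr0 => /eqP; rewrite mscalerI (negPf f0) orbF => /eqP c0.
move=> i; case: (unliftP ord0 i) => [j ->|->]; last exact: c0.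
by rewrite ord1 c1.
Qed.

Lemma in_classM p d d' m m' f g : in_class p d m f -> in_class p d' m' g ->
  in_class p (d + d') (fun l => m l + m' l)%N (f * g).
Proof.
by move=> [fh fm] [gh gm]; split=> [|l]; [apply: dhomogM|apply: mult_geM].
Qed.

Lemma in_class1 p : in_class p 0 (fun=> 0%N) 1.
Proof. by split; [apply: dhomog1|]. Qed.

Lemma in_classX p d m f k : in_class p d m f ->
  in_class p (k * d) (fun l => k * m l)%N (f ^+ k).
Proof.
move=> fc; elim: k => [|k IH]; first exact: in_class1.
by rewrite exprS; apply: in_classM.
Qed.

Lemma class_dim_geM p d d' m m' n f : f != 0 -> in_class p d m f ->
  class_dim_ge p d' m' n -> class_dim_ge p (d + d') (fun l => m l + m' l)%N n.
Proof.
move=> f0 fc [g [gi gc]]; exists (fun i => f * g i); split=> [c|i]; last exact: in_classM.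
rewrite (eq_bigr (fun i => f * (c i *: g i))) => [|i _]; last by rewrite scalerAr.
by rewrite -mulr_sumr => /eqP; rewrite mulf_eq0 (negPf f0) => /eqP; apply: gi.
Qed.

Lemma in_class_perm p d m f (s : 'I_r -> 'I_r) (t : 'I_r -> 'I_r) : cancel t s ->
  in_class (fun l => p (s l)) d (fun l => m (s l)) f -> in_class p d m f.
Proof. by move=> ts [fh fm]; split=> // l; have := fm (t l); rewrite /= ts. Qed.

End ClassDimension.

Section ChainRule.
Variables (A : comNzRingType) (D : {additive A -> A}) (sub : {rmorphism A -> {poly A}}).
Hypothesis D_mul : forall f g, D (f * g) = D f * g + f * D g.

(** If [sub f] is f (u + t v) then this is the chain rule in the variable v. *)
Definition chain_rule f := map_poly D (sub f) = 'X * sub (D f).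

Lemma chain_ruleD f g : chain_rule f -> chain_rule g -> chain_rule (f + g).
Proof.
rewrite /chain_rule => hf hg.
have -> : sub (f + g) = sub f + sub g by exact: raddfD.
have -> : D (f + g) = D f + D g by exact: raddfD.
have -> : map_poly D (sub f + sub g) = map_poly D (sub f) + map_poly D (sub g) by exact: raddfD.
have -> : sub (D f + D g) = sub (D f) + sub (D g) by exact: raddfD.
by rewrite hf hg mulrDr.
Qed.

Lemma chain_ruleM f g : chain_rule f -> chain_rule g -> chain_rule (f * g).
Proof.
rewrite /chain_rule => hf hg.
have e1 : sub (D (f * g)) = sub (D f) * sub g + sub f * sub (D g).
  rewrite D_mul (@raddfD _ _ sub); congr (_ + _); exact: (@rmorphM _ _ sub).
have e2 : sub (f * g) = sub f * sub g by exact: (@rmorphM _ _ sub).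
have e3 (F G : {poly A}) : map_poly D (F * G) = map_poly D F * G + F * map_poly D G.
  apply/polyP => k; rewrite coef_map coefD !coefM raddf_sum -big_split.
  by apply: eq_bigr => j _; rewrite D_mul !coef_map.
by rewrite e1 e2 e3 hf hg mulrDr (mulrA 'X) (mulrCA 'X).
Qed.

Lemma chain_rule_coef (F G : {poly A}) k : map_poly D F = 'X * G -> F`_k.+1 = 0 -> G`_k = 0.
Proof.
move=> e e0; have := congr1 (fun H : {poly A} => H`_k.+1) e.
by rewrite coef_map e0 raddf0 coefXM /= => <-.
Qed.

Lemma chain_ruleC c : sub c = c%:P -> D c = 0 -> chain_rule c.
Proof.
move=> e1 e2; rewrite /chain_rule e1 e2 map_polyC /= e2.
by rewrite (raddf0 sub) mulr0.
Qed.

Lemma chain_ruleX x a : sub x = a%:P + x%:P * 'X -> D a = 0 -> sub (D x) = (D x)%:P ->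
  chain_rule x.
Proof.
move=> e1 e2 e3; rewrite /chain_rule e1 e3; apply/polyP => k.
rewrite coef_map coefD coefC coefCM coefX coefXM coefC /=.
by case: k => [|[|k]] /=; rewrite ?mulr0 ?mulr1 ?add0r ?addr0 ?raddf0.
Qed.

End ChainRule.

Section Derivative.
Variable K : numClosedFieldType.
Local Notation P := {mpoly K[3]}.
Implicit Types (u v : 'rV[K]_3) (f g : P).

(** The map [generic_line] as a ring morphism. *)
Let gl u : {rmorphism P -> {poly P}} :=
  mmap (@polyC P \o @mpolyC 3 K) (fun j => (u 0 j)%:MP%:P + ('X_j)%:P * 'X).

Let T i u f := chain_rule (mderiv i : {additive P -> P}) (gl u) f.

Let TM i u f g : T i u f -> T i u g -> T i u (f * g).
Proof. exact: (@chain_ruleM P (mderiv i : {additive P -> P}) (gl u) (@mderivM 3 K i)). Qed.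

Let TD i u f g : T i u f -> T i u g -> T i u (f + g).
Proof. exact: (@chain_ruleD P (mderiv i : {additive P -> P}) (gl u)). Qed.

Let T_all i u f : T i u f.
Proof.
pose D : {additive P -> P} := mderiv i.
have glC (c : K) : gl u c%:MP = c%:MP%:P by rewrite /= mmapC.
have TC (c : K) : T i u c%:MP.
  exact: (@chain_ruleC P D (gl u) _ (glC c) (mderivC i c)).
have TX j : T i u 'X_j.
  have dX : mderiv i ('X_j : P) = ((j == i)%:R)%:MP.
    rewrite mderivX mnm1E; case: eqP => [->|_]; last by rewrite scale0r mpolyC0.
    by rewrite scale1r -{1}[U_(i)%MM]add0m addmK mpolyX0.
  apply: (@chain_ruleX P D (gl u) _ (u 0 j)%:MP _ (mderivC i _)).
    by rewrite /= mmapX mmap1U.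
  by rewrite [D _]dX glC.
have T1 : T i u 1 by rewrite -mpolyC1; apply: TC.
have TXn j e : T i u ('X_j ^+ e).
  elim: e => [|e IH]; first by rewrite expr0.
  by rewrite exprS; apply: (TM (TX j) IH).
have TXm (m : 'X_{1..3}) : T i u 'X_[m].
  rewrite mpolyXE_id; apply: (big_ind (T i u) T1) => [g h|j _]; [exact: TM|exact: TXn].
rewrite (mpolyE f); apply: (big_ind (T i u)) => [|g h|m _]; [|exact: TD|].
  by rewrite -mpolyC0; apply: TC.
by rewrite -mul_mpolyC; apply: (TM (TC _) (TXm m)).
Qed.

(** By the chain rule, the derivative with respect to v of the coefficient of
    t^(k+1) in f (u + t v) is the coefficient of t^k in the derivative of [f]. *)
Lemma mult_ge_deriv i f u n : mult_ge f u n.+1 -> mult_ge (mderiv i f) u n.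
Proof.
move=> /mult_geP h; apply/mult_geP => k kn.
exact: (@chain_rule_coef P (mderiv i) _ _ k (T_all i u f) (h k.+1 kn)).
Qed.

Lemma deriv_homog i f d : f \is d.+1.-homog -> mderiv i f \is d.-homog.
Proof.
move=> fh; apply/dhomogP => m; rewrite mcoeff_msupp mcoeff_mderiv => h /=.
have : f@_(m + U_(i)) != 0 by apply: contraNneq h => ->; rewrite mul0rn.
rewrite -mcoeff_msupp => /(dhomogP _ _ _ fh) /=.
by rewrite mdegD mdeg1 addn1 => -[].
Qed.

(** Differentiate with respect to a variable of the leading monomial. *)
Lemma deriv_neq0 f d : f != 0 -> f \is d.+1.-homog -> exists i, mderiv i f != 0.
Proof.
move=> f0 fh; have mf := mlead_supp f0; set m := mlead f in mf.
have md : mdeg m = d.+1 by have /dhomogP := fh; apply.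
have [i mi] : exists i, m i != 0%N.
  apply: contrapT => /forallNP h.
  have m0 i : m i = 0%N by apply/eqP; apply: contra_notT (h i).
  by move: md; rewrite mdeg3 !m0.
exists i; apply: contraTneq mf => e.
have := mcoeff_mderiv i f (m - U_(i))%MM; rewrite e mcoeff0 submK ?lep1mP //.
by move=> /esym/eqP; rewrite mulrn_eq0 /= -mcoeff_eq0.
Qed.

End Derivative.

(** * Gaussian elimination modulo 13 *)

(** The elements of the field with 13 elements form an enumerated type because the
    elimination is evaluated inside a proof, where a look-up in a table is a single
    step. The matrices of interest have full rank modulo 13. *)
Inductive F13 := c0 | c1 | c2 | c3 | c4 | c5 | c6 | c7 | c8 | c9 | c10 | c11 | c12.

Local Notation table13 x a0 a1 a2 a3 a4 a5 a6 a7 a8 a9 a10 a11 a12 :=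
  (match x with c0 => a0 | c1 => a1 | c2 => a2 | c3 => a3 | c4 => a4 | c5 => a5
      | c6 => a6 | c7 => a7 | c8 => a8 | c9 => a9 | c10 => a10 | c11 => a11
      | c12 => a12 end) (only parsing).

Definition add13 (x y : F13) : F13 :=
  table13 x
    y
    (table13 y c1 c2 c3 c4 c5 c6 c7 c8 c9 c10 c11 c12 c0)
    (table13 y c2 c3 c4 c5 c6 c7 c8 c9 c10 c11 c12 c0 c1)
    (table13 y c3 c4 c5 c6 c7 c8 c9 c10 c11 c12 c0 c1 c2)
    (table13 y c4 c5 c6 c7 c8 c9 c10 c11 c12 c0 c1 c2 c3)
    (table13 y c5 c6 c7 c8 c9 c10 c11 c12 c0 c1 c2 c3 c4)
    (table13 y c6 c7 c8 c9 c10 c11 c12 c0 c1 c2 c3 c4 c5)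
    (table13 y c7 c8 c9 c10 c11 c12 c0 c1 c2 c3 c4 c5 c6)
    (table13 y c8 c9 c10 c11 c12 c0 c1 c2 c3 c4 c5 c6 c7)
    (table13 y c9 c10 c11 c12 c0 c1 c2 c3 c4 c5 c6 c7 c8)
    (table13 y c10 c11 c12 c0 c1 c2 c3 c4 c5 c6 c7 c8 c9)
    (table13 y c11 c12 c0 c1 c2 c3 c4 c5 c6 c7 c8 c9 c10)
    (table13 y c12 c0 c1 c2 c3 c4 c5 c6 c7 c8 c9 c10 c11).

Definition mul13 (x y : F13) : F13 :=
  table13 x
    c0
    y
    (table13 y c0 c2 c4 c6 c8 c10 c12 c1 c3 c5 c7 c9 c11)
    (table13 y c0 c3 c6 c9 c12 c2 c5 c8 c11 c1 c4 c7 c10)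
    (table13 y c0 c4 c8 c12 c3 c7 c11 c2 c6 c10 c1 c5 c9)
    (table13 y c0 c5 c10 c2 c7 c12 c4 c9 c1 c6 c11 c3 c8)
    (table13 y c0 c6 c12 c5 c11 c4 c10 c3 c9 c2 c8 c1 c7)
    (table13 y c0 c7 c1 c8 c2 c9 c3 c10 c4 c11 c5 c12 c6)
    (table13 y c0 c8 c3 c11 c6 c1 c9 c4 c12 c7 c2 c10 c5)
    (table13 y c0 c9 c5 c1 c10 c6 c2 c11 c7 c3 c12 c8 c4)
    (table13 y c0 c10 c7 c4 c1 c11 c8 c5 c2 c12 c9 c6 c3)
    (table13 y c0 c11 c9 c7 c5 c3 c1 c12 c10 c8 c6 c4 c2)
    (table13 y c0 c12 c11 c10 c9 c8 c7 c6 c5 c4 c3 c2 c1).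

Definition opp13 (x : F13) : F13 :=
  table13 x c0 c12 c11 c10 c9 c8 c7 c6 c5 c4 c3 c2 c1.

Definition inv13 (x : F13) : F13 :=
  table13 x c0 c1 c7 c9 c10 c8 c11 c2 c5 c3 c4 c6 c12.

(** The head is evaluated before the list is built, so that under lazy evaluation
    no arithmetic is left pending in the entries of a row. *)
Definition cons13 (x : F13) (s : seq F13) : seq F13 :=
  table13 x (c0 :: s) (c1 :: s) (c2 :: s) (c3 :: s) (c4 :: s) (c5 :: s)
    (c6 :: s) (c7 :: s) (c8 :: s) (c9 :: s) (c10 :: s) (c11 :: s) (c12 :: s).

Definition val13 (x : F13) : 'F_13 :=
  (table13 x 0 1 2 3 4 5 6 7 8 9 10 11 12)%:R.

Definition zero13 (x : F13) : bool := if x is c0 then true else false.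

Lemma val13D x y : val13 (add13 x y) = val13 x + val13 y.
Proof. by case: x; case: y; apply: val_inj. Qed.

Lemma val13M x y : val13 (mul13 x y) = val13 x * val13 y.
Proof. by case: x; case: y; apply: val_inj. Qed.

Lemma val13N x : val13 (opp13 x) = - val13 x.
Proof. by case: x; apply: val_inj. Qed.

Lemma val13V x : val13 (inv13 x) = (val13 x)^-1.
Proof.
by case: x; apply: val_inj.
Qed.

Lemma val13_eq0 x : (val13 x == 0) = zero13 x.
Proof. by case: x. Qed.

Lemma cons13E x s : cons13 x s = x :: s.
Proof. by case: x. Qed.

(** Rows are followed by implicit zeros. *)
Fixpoint axpy13 (t : F13) (r s : seq F13) : seq F13 :=
  match r, s with
  | [::], _ => s
  | y :: r', [::] => cons13 (mul13 t y) (axpy13 t r' [::])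
  | y :: r', x :: s' => cons13 (add13 x (mul13 t y)) (axpy13 t r' s')
  end.

(** Gaussian elimination with the pivot row [r]: the column of the pivot becomes
    zero in [s], and deleting it dispenses with indices. *)
Fixpoint reduce13 (r s : seq F13) : seq F13 :=
  match r, s with
  | y :: r', x :: s' =>
      if zero13 y then cons13 x (reduce13 r' s')
      else if zero13 x then s'
      else axpy13 (opp13 (mul13 x (inv13 y))) r' s'
  | _, _ => [::]
  end.

(** The number [n] bounds the recursion. *)
Fixpoint independent13 (n : nat) (rows : seq (seq F13)) : bool :=
  match n, rows with
  | n'.+1, r :: rows' =>
      if all zero13 r then false else independent13 n' [seq reduce13 r s | s <- rows']
  | _, [::] => true
  | _, _ => false
  end.

Local Notation entry s j := (val13 (nth c0 s j)).

Lemma entry_axpy t r s j : entry (axpy13 t r s) j = entry s j + val13 t * entry r j.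
Proof.
elim: r s j => [|y r IH] [|x s] j; rewrite /= ?nth_nil ?mulr0 ?addr0 //.
  by rewrite cons13E; case: j => [|j] /=; rewrite ?val13M ?IH ?nth_nil add0r.
by rewrite cons13E; case: j => [|j] /=; rewrite ?val13D ?val13M ?IH.
Qed.

Definition pivot13 r := find (fun x => ~~ zero13 x) r.

Lemma pivot_neq0 r : ~~ all zero13 r -> entry r (pivot13 r) != 0.
Proof.
move=> h; rewrite val13_eq0; apply: (nth_find c0 (a := fun x => ~~ zero13 x)).
by rewrite has_predC.
Qed.

Lemma entry_reduce r s j : ~~ all zero13 r ->
  entry (reduce13 r s) j = entry s (bump (pivot13 r) j)
    - entry s (pivot13 r) / entry r (pivot13 r) * entry r (bump (pivot13 r) j).
Proof.
elim: r s j => [|y r IH] [|x s] //= j; rewrite /pivot13 /=.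
  by rewrite !nth_nil !mul0r subr0.
case: (boolP (zero13 y)) => /= y0 h.
  rewrite cons13E; case: j => [|j] /=.
    have -> : val13 y = 0 by apply/eqP; rewrite val13_eq0.
    by rewrite mulr0 subr0.
  by rewrite IH // bumpS.
rewrite /bump /=; case: (boolP (zero13 x)) => x0.
  have -> : val13 x = 0 by apply/eqP; rewrite val13_eq0.
  by rewrite !mul0r subr0.
by rewrite entry_axpy val13N val13M val13V mulNr.
Qed.

(** A relation between the rows restricts to one between the reduced rows, and the
    coefficient of the pivot row is determined by the others. *)
Lemma independent13P n (rows : seq (seq F13)) : independent13 n rows ->
  forall c : nat -> 'F_13,
    (forall j, \sum_(i < size rows) c i * entry (nth [::] rows i) j = 0) ->
    forall i, (i < size rows)%N -> c i = 0.
Proof.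
elim: n rows => [|n IH] [|r rows] //=.
case: (boolP (all zero13 r)) => // r0 ind c hc.
set k := pivot13 r; have rk := pivot_neq0 r0; rewrite -/k in rk.
have c0E : c 0%N = - (\sum_(i < size rows) c i.+1 * entry (nth [::] rows i) k) / entry r k.
  have := hc k; rewrite big_ord_recl /= => /eqP; rewrite addr_eq0 => /eqP e.
  by rewrite -e mulfK.
have rest : forall i, (i < size rows)%N -> c i.+1 = 0.
  move=> i lt; have := IH [seq reduce13 r s | s <- rows] ind (fun i => c i.+1) _ i.
  rewrite size_map; apply=> // j.
  have := hc (bump k j); rewrite big_ord_recl /= c0E => zero; rewrite -[RHS]zero.
  rewrite !mulNr !mulr_suml -sumrN -big_split /=.
  apply: eq_bigr => l _.
  rewrite (nth_map [::]) // entry_reduce // -/k mulrBr addrC; congr (_ + _).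
  by congr (- _); rewrite -!mulrA; congr (_ * (_ * _)); rewrite mulrC.
case=> [|i]; last exact: rest.
by move=> _; rewrite c0E big1 ?oppr0 ?mul0r // => i _; rewrite rest ?mul0r.
Qed.

(** * Taylor conditions at two points *)

Fixpoint pair_sums (s : seq F13) : seq F13 :=
  if s is x :: s' then cons13 (add13 x (head c0 s')) (pair_sums s') else [::].

Definition binomial_row n := iter n (fun s => c1 :: pair_sums s) [:: c1].

Lemma nth_pair_sums s i : nth c0 (pair_sums s) i = add13 (nth c0 s i) (nth c0 s i.+1).
Proof.
elim: s i => [|x s IH] i /=; first by rewrite !nth_nil.
by rewrite cons13E; case: i => [|i] /=; rewrite ?nth0 ?IH.
Qed.

Lemma binomial_rowE n i : val13 (nth c0 (binomial_row n) i) = 'C(n, i)%:R.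
Proof.
elim: n i => [|n IH] [|i].
- by rewrite bin0.
- by rewrite /= nth_nil bin0n.
- by rewrite bin0.
have -> : nth c0 (binomial_row n.+1) i.+1 = nth c0 (pair_sums (binomial_row n)) i by [].
by rewrite nth_pair_sums val13D !IH -natrD binS addnC.
Qed.

(** Without trailing zeros the first rows are short and cheap to subtract. *)
Fixpoint trim13 (s : seq F13) : seq F13 :=
  if s is x :: s' then
    if trim13 s' is y :: t then cons13 x (y :: t) else if zero13 x then [::] else cons13 x [::]
  else [::].

Lemma nth_trim13 s i : nth c0 (trim13 s) i = nth c0 s i.
Proof.
elim: s i => // x s IH i /=; case e : (trim13 s) => [|y t]; rewrite e /= in IH.
  case: i => [|i]; last by rewrite /= -IH !nth_nil; case: ifP; rewrite ?cons13E //= nth_nil.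
  by case: ifP; rewrite ?cons13E //=; case: x.
by rewrite cons13E; case: i => [|i] //=; rewrite -IH.
Qed.

(** With exponents and orders of derivation sorted by their last digit in base 13
    the matrices are nearly triangular modulo 13, by the theorem of Lucas. The
    bound 65 exceeds the degrees that occur. *)
Definition digit_order := [seq (13 * k + c)%N | c <- iota 0 13, k <- iota 0 5].

(** An element (i, j, e) stands for the coefficient of order (i, j) of the Taylor
    expansion at (1, 1), or at (1, 2) if [e]. *)
Definition conditions m : seq (nat * nat * bool) :=
  [seq (s, e) | s <- [seq s <- [seq (i, j) | i <- digit_order, j <- digit_order] | (s.1 + s.2 < m)%N],
     e <- [:: false; true]].

(** A pair (a, b) stands for the monomial X0^(d - a - b) X1^a X2^b. *)
Definition exponents_le d : seq (nat * nat) :=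
  [seq s <- [seq (a, b) | a <- digit_order, b <- digit_order] | (s.1 + s.2 <= d)%N].

(** The weight a + 4 b modulo 5 is that of the monomial under diag(1, z, z^4). *)
Definition exponents d chi (drop : pred (nat * nat)) : seq (nat * nat) :=
  [seq s <- exponents_le d | ((s.1 + 4 * s.2) %% 5 == chi)%N && ~~ drop s].

Lemma exponents_le_uniq d : uniq (exponents_le d).
Proof. by apply: filter_uniq; apply: allpairs_uniq => // -[? ?] [? ?]. Qed.

Lemma mem_exponents_le d s : (d < 65)%N -> (s \in exponents_le d) = (s.1 + s.2 <= d)%N.
Proof.
move=> d65; rewrite mem_filter; case: leqP => [le|_]; last by [].
rewrite andTb; have mem_digit k : (k < 65)%N -> k \in digit_order.
  have /allP h : all (mem digit_order) (iota 0 65) by [].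
  by move=> lt; apply: h; rewrite mem_iota.
apply/allpairsP; exists s; split; [| |by case: s {le}]; apply: mem_digit.
  exact: leq_ltn_trans (leq_trans (leq_addr _ _) le) d65.
exact: leq_ltn_trans (leq_trans (leq_addl _ _) le) d65.
Qed.

Definition condition (s : nat * nat) (c : nat * nat * bool) : nat :=
  ((if c.2 then 2 ^ s.2 else 1) * ('C(s.1, c.1.1) * 'C(s.2, c.1.2)))%N.

Definition condition_row (cs : seq (nat * nat * bool)) (s : nat * nat) : seq F13 :=
  let ra := binomial_row s.1 in
  let rb := binomial_row s.2 in
  let w := iter s.2 (mul13 c2) c1 in
  trim13 [seq mul13 (if c.2 then w else c1) (mul13 (nth c0 ra c.1.1) (nth c0 rb c.1.2)) | c <- cs].

(** For each weight, a form without the monomials in [drop] that satisfies the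
    conditions modulo 13 is zero. *)
Definition certificate d m drop :=
  let C := conditions m in
  all (fun chi => let S := exponents d chi drop in
                  independent13 (size S) [seq condition_row C s | s <- S]) (iota 0 5).

Lemma certificate_19 : certificate 19 6 pred0.
Proof. by vm_cast_no_check (erefl true). Qed.

(** There is a form of degree 57 with the given multiplicities; it is determined
    by its coefficient of X0^57. *)
Lemma certificate_57 : certificate 57 18 (pred1 (0, 0)%N).
Proof. by vm_cast_no_check (erefl true). Qed.

Lemma condition_rowE cs s k : (k < size cs)%N ->
  val13 (nth c0 (condition_row cs s) k) = (condition s (nth (0, 0, false)%N cs k))%:R.
Proof.
move=> lt; rewrite nth_trim13 (nth_map (0, 0, false)%N) //= !val13M !binomial_rowE !natrM.
congr (_ * _); case: (_.2) => //; elim: s.2 => [|n IH] //.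
by rewrite iterS val13M IH expnS natrM.
Qed.

(** A right inverse modulo 13 lifts to an integer matrix B such that the
    determinant of A B is nonzero modulo 13, hence nonzero. *)
Lemma lift_independent (K : numFieldType) N M (A : 'M[int]_(N, M)) :
  (forall c : 'rV['F_13]_N, c *m map_mx intr A = 0 -> c = 0) ->
  forall c : 'rV[K]_N, c *m map_mx intr A = 0 -> c = 0.
Proof.
move=> h c cA; have /row_freeP[B AB] : row_free (map_mx intr A : 'M['F_13]_(N, M)).
  exact: inj_row_free.
pose B' : 'M[int]_(M, N) := \matrix_(i, j) (B i j : nat)%:Z.
have B'E : map_mx intr B' = B.
  by apply/matrixP => i j; rewrite !mxE -[RHS]natr_Zp.
have d0 : \det (A *m B') != 0.
  apply: contraTneq (oner_neq0 'F_13) => e; rewrite negbK; apply/eqP.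
  by rewrite -(det1 _ N) -AB -B'E -map_mxM det_map_mx e.
have u : (map_mx intr (A *m B') : 'M[K]_N) \in unitmx by rewrite unitmxE det_map_mx unitfE intr_eq0.
by rewrite -[c](mulmxK u) map_mxM mulmxA cA !mul0mx.
Qed.

Lemma certificate_independent (K : numFieldType) d m drop chi (c : nat * nat -> K) :
  certificate d m drop -> (chi < 5)%N ->
  (forall t, t \in conditions m ->
     \sum_(s <- exponents d chi drop) c s * (condition s t)%:R = 0) ->
  forall s, s \in exponents d chi drop -> c s = 0.
Proof.
move=> /allP/(_ chi) + lt; rewrite mem_iota => /(_ lt).
set S := exponents _ _ _; set C := conditions m; move=> /independent13P ind cC s sS.
pose A : 'M[int]_(size S, size C) :=
  \matrix_(i, k) (condition (nth (0, 0)%N S i) (nth (0, 0, false)%N C k))%:Z.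
have : \row_(i < size S) c (nth (0, 0)%N S i) = 0.
  apply: (@lift_independent K _ _ A) => [v vA|]; last first.
    apply/rowP => k; rewrite mxE [RHS]mxE -[RHS](cC _ (mem_nth (0, 0, false)%N (ltn_ord k))).
    by rewrite (big_nth (0, 0)%N) big_mkord; apply: eq_bigr => i _; rewrite !mxE.
  apply/rowP => i; rewrite [RHS]mxE.
  pose v' n := if insub n is Some i then v 0 i else 0.
  have v'E (i' : 'I_(size S)) : v' i' = v 0 i' by rewrite /v' valK.
  rewrite -v'E; apply: ind; last by rewrite size_map.
  rewrite size_map => k; have [ltk|gek] := ltnP k (size C); last first.
    apply: big1 => i' _; rewrite (nth_map (0, 0)%N) // nth_trim13 nth_default ?size_map //.
    exact: mulr0.
  have := congr1 (fun w : 'rV_ _ => w 0 (Ordinal ltk)) vA.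
  rewrite mxE [RHS]mxE => zero; rewrite -[RHS]zero; apply: eq_bigr => i' _.
  by rewrite v'E (nth_map (0, 0)%N) // condition_rowE // !mxE.
move/rowP/(_ (Ordinal (etrans (index_mem s S) sS))); rewrite !mxE /=.
by rewrite nth_index.
Qed.

Section Fourier.
Variables (K : idomainType) (n : nat) (z : K).
Hypothesis prim : n.-primitive_root z.

Lemma root_powers_uniq : uniq [seq z ^+ l | l <- iota 0 n].
Proof.
rewrite map_inj_in_uniq ?iota_uniq // => i j; rewrite !mem_iota /= => li lj /eqP.
by rewrite (eq_prim_root_expr prim) !modn_small // => /eqP.
Qed.

(** The polynomial whose coefficients are the sums over the weights has degree less
    than n, and all the powers of z are roots. *)
Lemma isotypic_sum (T : Type) (S : seq T) (w : T -> nat) (c : T -> K) :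
  (forall l, (l < n)%N -> \sum_(s <- S) c s * z ^+ (l * w s) = 0) ->
  forall chi, (chi < n)%N -> \sum_(s <- S | (w s %% n)%N == chi) c s = 0.
Proof.
move=> h chi lt; have n0 := prim_order_gt0 prim.
pose V k := \sum_(s <- S | (w s %% n)%N == k) c s.
suff : \poly_(k < n) V k = 0 by move/(congr1 (fun F : {poly K} => F`_chi)); rewrite coef_poly lt coef0.
apply: (@roots_geq_poly_eq0 _ _ [seq z ^+ l | l <- iota 0 n]).
- apply/allP => _ /mapP[l + ->]; rewrite mem_iota /= => ltl; apply/rootP.
  rewrite horner_poly -[RHS](h l ltl).
  rewrite [RHS](partition_big (fun s => Ordinal (ltn_pmod (w s) n0)) xpredT) //=.
  apply: eq_bigr => k _; rewrite mulr_suml; apply: eq_big => s //= /eqP wk.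
  congr (_ * _); apply/eqP.
  by rewrite -exprM (eq_prim_root_expr prim) -wk modnMmr.
- exact: root_powers_uniq.
- by rewrite size_map size_iota size_poly.
Qed.

End Fourier.

(** * Ten special points *)

Section SpecialPoints.
Variables (K : numClosedFieldType) (z : K).
Hypothesis prim : 5.-primitive_root z.
Local Notation P := {mpoly K[3]}.
Implicit Types (f : P) (u : 'rV[K]_3).

Lemma mult_ge_derivn f u i k n : mult_ge f u (n + k) -> mult_ge (f^`M(i, k)) u n.
Proof.
rewrite mderivn_iter; elim: k n => [|k IH] n /=; first by rewrite addn0.
by rewrite addnS -addSn => /IH; apply: mult_ge_deriv.
Qed.

Lemma mult_ge1 f u : mult_ge f u 1 -> ev u f = 0.
Proof.
move/(_ 0 0%N isT); rewrite -horner_coef0 line_at => e.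
by rewrite -[RHS]e; apply: meval_eq => j; rewrite !mxE mul0r addr0.
Qed.

Definition affine_mon d (s : nat * nat) : 'X_{1..3} := mon3 [:: (d - (s.1 + s.2))%N; s.1; s.2].

Lemma affine_monE d (m : 'X_{1..3}) : mdeg m = d -> m = affine_mon d (m o1, m o2).
Proof.
rewrite mdeg3 => <-; apply/mnmP; apply: ord3P; rewrite mnmE //=.
by rewrite -addnA addnK.
Qed.

Section Exponents.
Variables (d : nat) (E : seq (nat * nat)).
Hypotheses (Euniq : uniq E) (memE : forall s, (s \in E) = (s.1 + s.2 <= d)%N).

Lemma form_sum (V : lmodType K) f (F : 'X_{1..3} -> V) : f \is d.-homog ->
  \sum_(m <- msupp f) f@_m *: F m =
  \sum_(s <- E) f@_(affine_mon d s) *: F (affine_mon d s).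
Proof.
move=> fh; rewrite -(big_map (affine_mon d) xpredT (fun m => f@_m *: F m)).
rewrite [RHS](bigID (fun m => m \in msupp f)) /= [X in _ + X]big1 ?addr0; last first.
  by move=> m; rewrite mcoeff_msupp negbK => /eqP ->; rewrite scale0r.
rewrite -[RHS]big_filter; apply: perm_big; apply: uniq_perm => [||m].
- exact: msupp_uniq.
- apply: filter_uniq; rewrite map_inj_uniq // => -[a b] [a' b'] /mnmP e.
  by have := e o1; have := e o2; rewrite !mnmE /= => -> ->.
rewrite mem_filter; case: (boolP (m \in msupp f)) => //= /(dhomogP _ _ _ fh) /= md.
apply/esym/mapP; exists (m o1, m o2); last exact: affine_monE.
by rewrite memE /= -md mdeg3 -addnA leq_addl.
Qed.

(** Multiplication by the monomial of the derivation restores the degree. *)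
Lemma ev_derivm (m : 'X_{1..3}) u i j :
  (\prod_(k < 3) (m k)^_(mon3 [:: 0; i; j]%N k))%:R * ev u 'X_[m - mon3 [:: 0; i; j]%N]
    * (u 0 o1 ^+ i * u 0 o2 ^+ j) =
  ((m o1)^_i * (m o2)^_j)%:R * ev u 'X_[m].
Proof.
set t := mon3 _; have t0 : t o0 = 0%N by rewrite mnmE.
have t1 : t o1 = i by rewrite mnmE.
have t2 : t o2 = j by rewrite mnmE.
have -> : (\prod_(k < 3) (m k)^_(t k) = (m o1)^_i * (m o2)^_j)%N.
  rewrite big_ord3 /=.
  by rewrite t0 t1 t2 ffactn0 mul1n.
have [im|mi] := leqP i (m o1); last by rewrite ffact_small // mul0n !mul0r.
have [jm|mj] := leqP j (m o2); last by rewrite [X in (_ * X)%N]ffact_small // muln0 !mul0r.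
have tm : (t <= m)%MM by apply/mnm_lepP; apply: ord3P; rewrite ?t0 ?t1 ?t2.
rewrite -mulrA; congr (_ * _); rewrite -{2}(submK tm) mpolyXD mevalM; congr (_ * _).
rewrite mevalX big_ord3 /=.
by rewrite t0 t1 t2 expr0 mul1r.
Qed.

(** Divide the derivative of order (i, j) at u by i! j!. *)
Lemma mult_ge_relation f u m i j : f \is d.-homog -> mult_ge f u m ->
  (i + j < m)%N -> u 0 o0 = 1 ->
  \sum_(s <- E) f@_(affine_mon d s) *
    (('C(s.1, i) * 'C(s.2, j))%:R * (u 0 o1 ^+ s.1 * u 0 o2 ^+ s.2)) = 0.
Proof.
move=> fh fm lt u0.
have e0 : ev u (f^`M[mon3 [:: 0; i; j]%N]) = 0.
  have -> : mon3 [:: 0; i; j]%N = (U_(o1) *+ i + U_(o2) *+ j)%MM.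
    by apply/mnmP; apply: ord3P; rewrite mnmDE !mulmnE !mnmE /= ?mul0n ?mul1n ?addn0.
  rewrite mderivmDm; apply: mult_ge1; do 2 apply: mult_ge_derivn.
  by apply: mult_geW fm; rewrite -addnA add1n [(j + i)%N]addnC.
have fact0 : (i`! * j`!)%:R != 0 :> K by rewrite pnatr_eq0 -lt0n muln_gt0 !fact_gt0.
apply: (mulfI fact0); rewrite mulr0 -[RHS](mul0r (u 0 o1 ^+ i * u 0 o2 ^+ j)) -[X in _ = X * _]e0.
rewrite mderivmE raddf_sum /= mulr_suml mulr_sumr.
pose F (m : 'X_{1..3}) : K^o := ((m o1)^_i * (m o2)^_j)%:R * ev u 'X_[m].
rewrite [RHS](eq_bigr (fun m => f@_m *: F m)) => [|m' _]; last first.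
  by rewrite mevalZ -!mulrA [X in _ * X]mulrA ev_derivm.
rewrite (form_sum F fh); apply: eq_bigr => s _.
rewrite /GRing.scale /= mulrCA; congr (_ * _).
rewrite /F mevalX big_ord3 /=.
rewrite u0 expr1n mul1r !mnmE /= [LHS]mulrA -natrM; congr (_%:R * _).
by rewrite mulnACA [(i`! * _)%N]mulnC [(j`! * _)%N]mulnC !bin_ffact.
Qed.

End Exponents.

(** The orbits of (1 : 1 : 1) and (1 : 1 : 2) under diag(1, z, z^4), for z a
    primitive fifth root of unity. *)
Definition special (l : 'I_10) : 'rV[K]_3 :=
  \row_k nth 0 [:: 1; z ^+ l; (if (l < 5)%N then 1 else 2) * z ^+ (4 * l)] k.

Lemma special_distinct : distinct_points special.
Proof.
have z0 : z != 0 by rewrite (prim_root_eq0 prim).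
split=> [l|l j [c c0 e]].
  by apply/eqP => /rowP/(_ o0)/eqP; rewrite !mxE /= oner_eq0.
have := congr1 (fun v : 'rV[K]_3 => v 0 o0) e; rewrite !mxE /= mulr1 => c1.
rewrite -c1 scale1r in e.
have := congr1 (fun v : 'rV[K]_3 => v 0 o1) e; rewrite !mxE /= => e1.
have := congr1 (fun v : 'rV[K]_3 => v 0 o2) e; rewrite !mxE /= !(mulnC 4) !exprM e1.
have zj : (z ^+ j) ^+ 4 != 0 by rewrite !expf_neq0.
move/(mulIf zj) => e2; apply: val_inj => /=.
have n12 : (1 : K) != 2 by rewrite -subr_eq0 -oppr_eq0 opprB -[2]/(1 + 1) addrK oner_neq0.
move/eqP: e1; rewrite (eq_prim_root_expr prim) => /eqP lj.
have := ltn_ord l; have := ltn_ord j; move: e2 lj.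
case: ifP; case: ifP => h1 h2; do ?[by move=> /eqP; rewrite ?(negPf n12) // eq_sym (negPf n12)].
- by move=> _; rewrite !modn_small.
- move=> _ lj j10 l10; move: h1 h2 lj j10 l10; move: (nat_of_ord l) (nat_of_ord j); clear.
  lia.
Qed.

(** The conditions at the five points of an orbit are those at one point on each
    isotypic part of the form, and they have integer coefficients. *)
Theorem form_eq0 f d m drop : (d < 65)%N -> certificate d m drop ->
  in_class special d (fun=> m) f ->
  (forall s, drop s -> f@_(affine_mon d s) = 0) -> f = 0.
Proof.
move=> d65 cert [fh fm] fdrop.
have := certificate_independent (K := K) (c := fun s => f@_(affine_mon d s)) cert.
have := fun s => mem_exponents_le s d65; have := exponents_le_uniq d; rewrite /exponents.
move: (exponents_le d) => E Euniq memE ind.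
have zero s : s \in E -> f@_(affine_mon d s) = 0.
  move=> sE; case: (boolP (drop s)) => [/fdrop//|ds].
  have lt5 : ((s.1 + 4 * s.2) %% 5 < 5)%N by rewrite ltn_mod.
  apply: (ind _ lt5); last by rewrite mem_filter sE eqxx ds.
  move=> [[i j] e] /allpairsP[[[i' j'] e'] [+ _ [-> -> ->]]].
  rewrite mem_filter => /andP[ij _] {i j e}.
  set chi := (_ %% 5)%N in lt5 *.
  pose c (s : nat * nat) := f@_(affine_mon d s) * (condition s (i', j', e'))%:R.
  have rel l : (l < 5)%N -> \sum_(s <- E) c s * z ^+ (l * (s.1 + 4 * s.2)) = 0.
    move=> ltl; have ltL : (l + (if e' then 5 else 0) < 10)%N by case: (e'); lia.
    have zL : z ^+ (l + (if e' then 5 else 0)) = z ^+ l.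
      by case: (e'); rewrite ?addn0 // exprD (prim_expr_order prim) mulr1.
    pose u := special (Ordinal ltL).
    have u0 : u 0 o0 = 1 by rewrite mxE.
    have u1 : u 0 o1 = z ^+ l by rewrite mxE /= zL.
    have u2 : u 0 o2 = (if e' then 2 else 1)%N%:R * (z ^+ l) ^+ 4.
      rewrite mxE /= mulnC exprM zL; congr (_ * _).
      have -> : (l + (if e' then 5 else 0) < 5)%N = ~~ e' by case: (e'); lia.
      by case: (e').
    rewrite -[RHS](mult_ge_relation Euniq memE fh (fm (Ordinal ltL)) ij u0).
    apply: eq_bigr => t _; rewrite /c -mulrA -/u u1 u2; congr (_ * _).
    rewrite exprM exprD exprM [in RHS]exprMn.
    rewrite -natrX /condition /= natrM.
    have -> : (if e' then 2 ^ t.2 else 1)%N = ((if e' then 2 else 1) ^ t.2)%N.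
      by case: (e'); rewrite ?exp1n.
    by ring.
  have := isotypic_sum prim rel lt5.
  rewrite big_filter => zero; rewrite -[RHS]zero big_mkcond [RHS]big_mkcond.
  apply: eq_bigr => t _; case: eqP => //= _; case: (boolP (drop t)) => //= dt.
  by rewrite /c fdrop // mul0r.
apply/mpolyP => m'; rewrite mcoeff0; have [md|md] := eqVneq (mdeg m') d; last first.
  exact: (dhomog_nemf_coeff fh md).
rewrite (affine_monE md); apply: zero.
by rewrite memE /= -md mdeg3 -addnA leq_addl.
Qed.

End SpecialPoints.

Lemma primitive_root5 (K : numClosedFieldType) : exists z : K, 5.-primitive_root z.
Proof.
have [|z zr] := closed_rootP (\poly_(i < 5) 1 : {poly K}) _.
  by rewrite size_poly_eq // oner_neq0.
exists z; move: zr; rewrite rootE horner_poly !big_ord_recl big_ord0 /= => /eqP zs.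
have z5 : z ^+ 5 = 1.
  apply/eqP; rewrite -subr_eq0; apply/eqP.
  have -> : z ^+ 5 - 1 = (z - 1) * 0 by rewrite -zs; ring.
  exact: mulr0.
have [k kp k5] := prim_order_exists (isT : (0 < 5)%N) z5.
have /primeP[_ /(_ k k5)/orP[/eqP k1|/eqP <- //]] : prime 5 by [].
have z1 : z = 1 by rewrite -[z]expr1 -k1 (prim_expr_order kp).
have : (5%:R : K) == 0 by apply/eqP; rewrite -[RHS]zs z1; ring.
by rewrite pnatr_eq0.
Qed.

Section SpecialDimensions.
Variables (K : numClosedFieldType) (z : K).
Hypothesis prim : 5.-primitive_root z.
Local Notation special := (special z).

Lemma special_19_6 f : in_class special 19 (fun=> 6%N) f -> f = 0.
Proof. by move=> fc; apply: (form_eq0 prim _ certificate_19 fc). Qed.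

(** Two independent forms have a nonzero combination without X0^57. *)
Lemma special_57_18 : ~ class_dim_ge special 57 (fun=> 18%N) 2.
Proof.
move=> [f [fi fc]]; pose a i := (f i)@_(affine_mon 57 (0, 0)%N).
pose i1 : 'I_2 := lift ord0 ord0.
pose c (i : 'I_2) := if i == ord0 then a i1 else - a ord0.
have zero : \sum_(i < 2) c i *: f i = 0.
  apply: (form_eq0 prim _ certificate_57) => //.
    by apply: in_class_lin.
  move=> s /eqP ->; rewrite !big_ord_recl big_ord0 addr0 /c /= mcoeffD !mcoeffZ -/i1.
  by rewrite mulNr [X in _ - X]mulrC subrr.
have a0 : a ord0 = 0 by have := fi c zero i1; rewrite /c /= => /eqP; rewrite oppr_eq0 => /eqP.
have := independent_neq0 ord0 fi; apply/negP; rewrite negbK; apply/eqP.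
apply: (form_eq0 prim _ certificate_57 (fc ord0)) => // s /eqP ->.
exact: a0.
Qed.

End SpecialDimensions.

(** * Classes of plane forms *)

Section DivisorClasses.
Variables (K : numClosedFieldType) (r : nat) (p : 'I_r -> 'rV[K]_3).
Local Notation P := {mpoly K[3]}.
Implicit Types (f g h : P) (d e : nat) (m n : 'I_r -> nat).

(** The strict transform of f has class d H - sum_l m_l E_l. *)
Definition exact_class d m f := [/\ f != 0, f \is d.-homog & forall l, mult_exact f (p l) (m l)].

Lemma exact_in_class d m f : exact_class d m f -> in_class p d m f.
Proof. by move=> [_ fh fm]; split=> // l; case: (fm l). Qed.

Lemma exact_classM d e m n f g : exact_class d m f -> exact_class e n g ->
  exact_class (d + e) (fun l => m l + n l)%N (f * g).
Proof.
move=> [f0 fh fm] [g0 gh gm]; split; [exact: mulf_neq0|exact: dhomogM|move=> l].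
exact: mult_exactM.
Qed.

Lemma exact_class_uniq d e m n f : exact_class d m f -> exact_class e n f ->
  d = e /\ m = n.
Proof.
move=> [f0 fh fm] [_ fh' fm']; split; first exact: (dhomog_uniq f0 fh fh').
by apply: funext => l; apply: mult_exact_uniq (fm l) (fm' l).
Qed.

Lemma exact_class_ex d f : f != 0 -> f \is d.-homog -> exists m, exact_class d m f.
Proof.
move=> f0 fh; have /choice[m hm] := fun l => mult_exact_ex (p l) f0.
by exists m.
Qed.

Lemma exact_class_factor d m f g : exact_class d m (f * g) ->
  exists e n, [/\ exact_class e n f, exact_class (d - e) (fun l => m l - n l)%N g,
    (e <= d)%N & forall l, (n l <= m l)%N].
Proof.
move=> fgc; have [fg0 fgh fgm] := fgc.
have [f0 g0] : f != 0 /\ g != 0 by apply/andP; rewrite -negb_or -mulf_eq0.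
have [e ed [fh gh]] := homog_factor fg0 fgh.
have [n fc] := exact_class_ex f0 fh; have [n' gc] := exact_class_ex g0 gh.
have [_ mE] := exact_class_uniq fgc (exact_classM fc gc).
exists e, n; split=> //; last by move=> l; rewrite mE leq_addr.
by have -> : (fun l => m l - n l)%N = n' by apply: funext => l; rewrite mE addKn.
Qed.

Lemma exact_class0 m f : exact_class 0 m f -> m = fun=> 0%N.
Proof.
move=> [f0 fh fm].
have fu : f \is a GRing.unit by rewrite mpoly_unitP f0.
apply: funext => l; have [g [gf _]] := unitrP fu.
have g0 : g != 0 by apply: contraTneq (oner_neq0 P) => g0; rewrite -gf g0 mul0r eqxx.
have [n gn] := mult_exact_ex (p l) g0.
have := mult_exact_uniq (mult_exactM gn (fm l)); rewrite gf => /(_ _ (mult_exact1 _)).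
by move/eqP; rewrite addn_eq0 => /andP[_ /eqP].
Qed.

(** The multiplicities of [f] and [g] add up to those of [h], hence none of them
    exceeds its lower bound. *)
Lemma in_class_exact d e m n f g h : exact_class (d + e) (fun l => m l + n l)%N h ->
  in_class p d m f -> in_class p e n g -> f * g = h -> exact_class d m f.
Proof.
move=> hc [fh fm] [gh gm] fgh.
have [h0 _ _] := hc; rewrite -fgh in h0 hc.
have [f0 g0] : f != 0 /\ g != 0 by apply/andP; rewrite -negb_or -mulf_eq0.
have [m' fc] := exact_class_ex f0 fh; have [n' gc] := exact_class_ex g0 gh.
have [_ mE] := exact_class_uniq hc (exact_classM fc gc).
have -> // : m = m'; apply: funext => l.
have [_ _ /(_ l) fl] := fc; have [_ _ /(_ l) gl] := gc.
have := mult_exact_leq fl (fm l); have := mult_exact_leq gl (gm l).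
by have := congr1 (fun F : 'I_r -> nat => F l) mE; rewrite /=; lia.
Qed.

Lemma prime_same_class q q' d m n : prime_elt q -> exact_class d m q -> exact_class d n q' ->
  divides q q' -> m = n.
Proof.
move=> qP qc q'c [a q'E]; rewrite q'E mulrC in q'c.
have [e [k [qc' ac _ le]]] := exact_class_factor q'c.
have [ed km] := exact_class_uniq qc qc'.
rewrite -ed subnn in ac; have := exact_class0 ac; rewrite -km => z.
apply: funext => l; have := congr1 (fun F : 'I_r -> nat => F l) z; have := le l.
by rewrite -km /=; lia.
Qed.

End DivisorClasses.

Lemma distinct_primes_divides (R : idomainType) n (A : nat -> R) a : a != 0 ->
  (forall i, (i < n)%N -> prime_elt (A i) /\ divides (A i) a) ->
  (forall i j, (i < n)%N -> (j < n)%N -> divides (A i) (A j) -> i = j) ->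
  divides (\prod_(i < n) A i) a.
Proof.
move=> a0; elim: n => [|n IH] hA inj; first by rewrite big_ord0; apply/divides_unit/unitr1.
have [b aE] : divides (\prod_(i < n) A i) a.
  by apply: IH => [i lt|i j li lj]; [apply: hA|apply: inj]; rewrite ltnW.
have [nP nd] := hA n (ltnSn n); have [_ _ nP'] := nP.
rewrite big_ord_recr /= aE; move: nd; rewrite aE => /nP'[[c bE]|nd].
  by exists c; rewrite bE -mulrA [A n * _]mulrC.
have pick k : (k <= n)%N -> divides (A n) (\prod_(i < k) A i) ->
    exists2 i, (i < n)%N & divides (A n) (A i).
  elim: k => [|k IHk] kn; rewrite ?big_ord0 ?big_ord_recr /=.
    by move/(prime_not_unit nP (unitr1 _)).
  by case/nP' => [/(IHk (ltnW kn))//|h]; exists k.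
have [i lt h] := pick n (leqnn n) nd.
by have e := inj n i (ltnSn n) (ltnW lt) h; rewrite -e ltnn in lt.
Qed.

(** * The unique curve for general points *)

Definition rot (i : nat) (l : 'I_10) : 'I_10 := Ordinal (ltn_pmod (l + i) (isT : 0 < 10)%N).

Lemma rotD i j l : rot i (rot j l) = rot (j + i) l.
Proof. by apply: val_inj; rewrite /= modnDml addnA. Qed.

Lemma rot_mul10 k l : rot (10 * k) l = l.
Proof. by apply: val_inj; rewrite /= addnC mulnC modnMDl modn_small. Qed.

Lemma rotK i : cancel (rot i) (rot (9 * i)).
Proof. by move=> l; rewrite rotD -mulSn rot_mul10. Qed.

Lemma rotKV i : cancel (rot (9 * i)) (rot i).
Proof. by move=> l; rewrite rotD addnC -mulSn rot_mul10. Qed.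

(** The classes for which general points minimize the dimension. *)
Definition admissible d (m : 'I_10 -> nat) : Prop :=
  ((d <= 57)%N /\ forall l, (m l <= 18)%N) \/
  exists j, d = 57%N /\ m = fun l => (18 + (l == j))%N.

(** If 6 e < 19 n, then e is at most (19 n - 1) / 6, and the complement in -3F of
    k times the class e H - n sum_l E_l has at least two independent sections, by
    the count of conditions. *)
Lemma slope_dimension n : (0 < n <= 18)%N ->
  let k := (18 %/ n)%N in let e := ((19 * n).-1 %/ 6)%N in
  (k * e <= 57)%N /\ (2 + 10 * 'C((18 - k * n).+1, 2) <= 'C((57 - k * e).+2, 2))%N.
Proof.
move=> /andP[n0 n18]; apply/andP.
suff /allP h : all (fun n => let k := (18 %/ n)%N in let e := ((19 * n).-1 %/ 6)%N in
    (k * e <= 57)%N && (2 + 10 * 'C((18 - k * n).+1, 2) <= 'C((57 - k * e).+2, 2))%N) (iota 1 18).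
  by apply: h; rewrite mem_iota n0 ltnS.
by vm_compute.
Qed.

Section GenericPoints.
Variables (K : numClosedFieldType) (p : 'I_10 -> 'rV[K]_3).
Hypothesis hp : distinct_points p.
Hypothesis generic : forall (q : 'I_10 -> 'rV[K]_3) d m n, distinct_points q -> admissible d m ->
  class_dim_ge p d m n -> class_dim_ge q d m n.
Hypothesis one_section : ~ class_dim_ge p 57 (fun=> 18%N) 2.
Hypothesis no_section : forall f, in_class p 19 (fun=> 6%N) f -> f = 0.

Local Notation P := {mpoly K[3]}.
Implicit Types (f g h : P) (d e : nat) (m : 'I_10 -> nat).
Local Notation exact := (exact_class p).

(** The permuted points are competitors in the minimality of the dimension. *)
Lemma permute_class d m n (s t : 'I_10 -> 'I_10) : cancel s t -> cancel t s ->
  admissible d m -> class_dim_ge p d m n -> class_dim_ge p d (fun l => m (s l)) n.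
Proof.
move=> st ts adm pd; have hq : distinct_points (fun l => p (t l)).
  by split=> [l|l j /(proj2 hp) e]; [exact: (proj1 hp)|exact: (can_inj ts e)].
have [f [fi fc]] := generic hq adm pd; exists f; split=> // i.
apply: (in_class_perm (s := t) st).
by have -> : (fun l => m (s (t l))) = m by apply: funext => l; rewrite ts.
Qed.

(** Ten points of multiplicity 18 impose 1710 conditions on 1711 coefficients. *)
Lemma section_ex : exists2 h, h != 0 & in_class p 57 (fun=> 18%N) h.
Proof.
apply/class_dim_ge1; apply: expected_dimension => [l|]; first exact: (proj1 hp).
by rewrite sum_nat_const card_ord !bin2.
Qed.

Variable h : P.
Hypotheses (h0 : h != 0) (hc : in_class p 57 (fun=> 18%N) h).

Lemma section_uniq f : in_class p 57 (fun=> 18%N) f -> exists c, f = c *: h.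
Proof. by move=> fc; apply: class_dim_lt2 hc fc h0. Qed.

Lemma section_uniq_neq0 f : in_class p 57 (fun=> 18%N) f -> f != 0 ->
  exists2 c, c != 0 & h = c *: f.
Proof.
move=> /section_uniq[c fE] f0; have c0 : c != 0.
  by apply: contraNneq f0 => c0; rewrite fE c0 scale0r.
by exists c^-1; rewrite ?invr_eq0 // fE scalerA mulVf // scale1r.
Qed.

(** If the curve had a point of multiplicity 19, then by symmetry it would have
    multiplicity 19 at all the points; a partial derivative would be a form of
    degree 56 with multiplicity 18 everywhere, and its products with the three
    coordinates would be independent sections of -3F. *)
Lemma section_exact : exact 57 (fun=> 18%N) h.
Proof.
have [hh hm] := hc; split=> // l; split=> // hl; apply: one_section.
have h19 j : mult_ge h (p j) 19.
  have : class_dim_ge p 57 (fun i => 18 + (tperm l j i == l))%N 1.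
    apply: (permute_class (m := fun i => (18 + (i == l))%N) (tpermK l j) (tpermK l j)).
      by right; exists l.
    apply/class_dim_ge1; exists h => //; split=> // i.
    by case: eqP => [->|_]; [exact: hl|rewrite addn0].
  case/class_dim_ge1 => f f0 [fh fm].
  have [|c c0 ->] := section_uniq_neq0 _ f0.
    by split=> // i; apply: mult_geW (fm i); rewrite leq_addr.
  by apply: mult_geZ; have := fm j; rewrite tpermR eqxx.
have [i di] := deriv_neq0 h0 hh.
apply: (@class_dim_geW _ _ _ _ _ _ 3) => //.
have dc : in_class p 56 (fun=> 18%N) (mderiv i h).
  by split=> [|j]; [apply: deriv_homog|apply: mult_ge_deriv].
have := class_dim_geM di dc (d' := 1) (m' := fun=> 0%N) (n := 3); apply.
apply: expected_dimension => [j|]; first exact: (proj1 hp).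
by rewrite big1.
Qed.

(** The classes of [f] and of its cofactor remain effective when the points are
    permuted, and the product of forms in the permuted classes is again [h], up to a
    scalar. *)
Lemma permute_factor i d m f g : exact d m f -> f * g = h ->
  exists f', exact d (fun l => m (rot i l)) f' /\ divides f' h.
Proof.
move=> fc fgh; have hE := section_exact; rewrite -fgh in hE.
have [e [n [fc' gc ed nm]]] := exact_class_factor hE.
have [de mn] := exact_class_uniq fc fc'; rewrite -{}de -{e n fc'}mn in gc ed nm.
have shift e n k : admissible e n -> exact e n k ->
    exists2 k', k' != 0 & in_class p e (fun l => n (rot i l)) k'.
  move=> adm kc; apply/class_dim_ge1; apply: (permute_class (rotK i) (rotKV i) adm).
  by apply/class_dim_ge1; exists k; [case: kc|apply: exact_in_class].
have [|f' f'0 f'c] := shift _ _ _ _ fc; first by left.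
have [|g' g'0 g'c] := shift _ _ _ _ gc.
  by left; split=> [|l]; apply: leq_subr.
have sE : (fun l => m (rot i l) + (18 - m (rot i l)))%N = fun=> 18%N.
  by apply: funext => l; rewrite subnKC.
have f'g'c : in_class p 57 (fun=> 18%N) (f' * g').
  by have := in_classM f'c g'c; rewrite subnKC // sE.
have [c c0 hE'] := section_uniq_neq0 f'g'c (mulf_neq0 f'0 g'0).
exists f'; split; last by exists (c *: g'); rewrite hE' -scalerAl mulrC.
apply: (in_class_exact (e := (57 - d)%N) (n := fun l => (18 - m (rot i l))%N) (g := c *: g') (h := h)) => //.
- by rewrite subnKC // sE; exact: section_exact.
- by split=> [|l]; [apply: rpredZ; case: g'c|apply: mult_geZ; case: g'c].
- by rewrite hE' scalerAr.
Qed.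

(** A power of [f] times the forms of the complementary class would give two
    independent sections of -3F. *)
Lemma slope_bound e n f : exact e (fun=> n) f -> (n <= 18)%N -> ~ (6 * e < 19 * n)%N.
Proof.
move=> fc n18 lt; have n0 : (0 < n)%N by lia.
have /= := @slope_dimension n; rewrite n0 n18 => /(_ isT).
set k := (18 %/ n)%N; set e' := (_ %/ 6)%N => -[ke dim].
have ee' : (e <= e')%N by rewrite leq_divRL //; lia.
have kn : (k * n <= 18)%N by apply: leq_trunc_div.
have kee' : (k * e <= k * e')%N by rewrite leq_mul2l ee' orbT.
have ke57 : (k * e <= 57)%N by apply: leq_trans kee' ke.
have [f0 _ _] := fc.
apply: one_section.
have -> : (fun=> 18%N) = (fun l : 'I_10 => k * n + (18 - k * n))%N.
  by apply: funext => l; rewrite subnKC.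
rewrite -(subnKC ke57).
apply: (class_dim_geM (expf_neq0 k f0) (in_classX k (exact_in_class fc))).
apply: expected_dimension => [l|]; first exact: (proj1 hp).
rewrite sum_nat_const card_ord; apply: leq_trans dim _; apply: leq_bin2l.
by rewrite !ltnS; apply: leq_sub2l.
Qed.

(** By [slope_bound] for [f] and for its cofactor, 6 e = 19 n; in the cases n = 6
    and n = 12, [f] or its cofactor is a section of -F. *)
Lemma symmetric_factor e n f : exact e (fun=> n) f -> divides f h -> e = 0%N \/ e = 57%N.
Proof.
move=> fc [g hE]; have hc' := section_exact; rewrite hE mulrC in hc'.
have [e' [n' [fc' gc ed nm]]] := exact_class_factor hc'.
have [ee mn] := exact_class_uniq fc fc'; rewrite -{}ee -{e' n' fc'}mn in gc ed nm.
have n18 : (n <= 18)%N := nm ord0.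
have := slope_bound fc n18; have := slope_bound gc (leq_subr _ _) => s1 s2.
have eq6 : (6 * e = 19 * n)%N by lia.
have : (n = 0 \/ n = 6 \/ n = 12 \/ n = 18)%N by lia.
case=> [n0|[n6|[n12|n18']]]; [left; lia|exfalso|exfalso|right; lia].
  have e19 : e = 19%N by lia.
  have [f0 _ _] := fc; move/eqP: f0; apply; apply: no_section.
  by have := exact_in_class fc; rewrite n6 e19.
have e38 : e = 38%N by lia.
have [g0 _ _] := gc; move/eqP: g0; apply; apply: no_section.
by have := exact_in_class gc; rewrite n12 e38.
Qed.

End GenericPoints.

(** * Irreducibility of the unique curve *)

Lemma prime_mul_unit (R : idomainType) (q u : R) : prime_elt q -> u \is a GRing.unit ->
  prime_elt (u * q).
Proof.
move=> [q0 qu qP] uu; split.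
- by rewrite mulf_neq0 //; apply: contraTneq uu => ->; rewrite unitr0.
- by rewrite unitrMr.
have assoc a : divides (u * q) a <-> divides q a.
  split=> [|[b ->]]; first by apply: divides_trans; exists u.
  by exists (b / u); rewrite mulrA divrK.
by move=> a b /assoc/qP[]/assoc; [left|right].
Qed.

Section Irreducible.
Variables (K : numClosedFieldType) (p : 'I_10 -> 'rV[K]_3).
Hypothesis hp : distinct_points p.
Hypothesis generic : forall (q : 'I_10 -> 'rV[K]_3) d m n, distinct_points q ->
  admissible d m -> class_dim_ge p d m n -> class_dim_ge q d m n.
Hypothesis one_section : ~ class_dim_ge p 57 (fun=> 18%N) 2.
Hypothesis no_section : forall f, in_class p 19 (fun=> 6%N) f -> f = 0.
Local Notation P := {mpoly K[3]}.
Variable h : P.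
Hypotheses (h0 : h != 0) (hc : in_class p 57 (fun=> 18%N) h).
Local Notation exact := (exact_class p).

Lemma exact_class_prod n d (m : nat -> 'I_10 -> nat) (A : nat -> P) :
  (forall i, exact d (m i) (A i)) ->
  exact (n * d) (fun l => \sum_(i < n) m i l)%N (\prod_(i < n) A i).
Proof.
move=> hA; elim: n => [|n IH].
  rewrite big_ord0; split=> [||l]; [exact: oner_neq0|exact: dhomog1|].
  by rewrite big_ord0; apply: mult_exact1.
have -> : (fun l => \sum_(i < n.+1) m i l)%N = (fun l => \sum_(i < n) m i l + m n l)%N.
  by apply: funext => l; rewrite big_ord_recr.
by rewrite big_ord_recr /= mulSn addnC; apply: exact_classM.
Qed.

Lemma prime_factor_ex f d : f != 0 -> f \is d.-homog -> (0 < d)%N ->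
  exists q e m, [/\ prime_elt q, exact e m q & divides q f].
Proof.
move=> f0 fh d0; have [u [[|q s] [uu sP fE]]] := homog_factorization f0 fh.
  move: uu; rewrite fE big_nil mulr1 in f0 fh *; rewrite mpoly_unitP => /andP[_ uh].
  by move: d0; rewrite (dhomog_uniq f0 fh uh).
have [qP [e qh]] := sP q (mem_head _ _); have [q0 _ _] := qP.
have [m qc] := exact_class_ex p q0 qh.
exists q, e, m; split=> //; rewrite fE big_cons.
by apply/divides_mull/divides_mulr/divides_refl.
Qed.

(** The cofactor has degree zero. *)
Lemma full_factor d m m' f q : exact d m f -> exact d m' q -> divides q f ->
  exists2 u, u \is a GRing.unit & f = u * q.
Proof.
move=> fc qc [u fE]; exists u => //; rewrite fE mulrC in fc.
have [e [n [qc' uc _ _]]] := exact_class_factor fc.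
have [de mn] := exact_class_uniq qc qc'; rewrite -de subnn in uc.
by case: uc => u0 uh _; rewrite mpoly_unitP u0.
Qed.

(** Rotating the points permutes the components of minimal degree, since a proper
    factor of a rotated one would have smaller degree. The product of the
    rotations of one of them has equal multiplicities, hence it is the whole
    curve, and the number of factors divides 10 and 57. *)
Theorem section_prime : prime_elt h.
Proof.
have hh : h \is 57.-homog by case: hc.
have hE := section_exact hp generic one_section h0 hc.
pose Q d := `[< exists q m, [/\ prime_elt q, exact d m q & divides q h] >].
have exQ : exists d, Q d.
  have [q [e [m qh]]] := prime_factor_ex h0 hh (isT : (0 < 57)%N).
  by exists e; apply/asboolP; exists q, m.
have [d /asboolP[A [m [AP Ac Ah]]] dmin] := ex_minnP exQ.
have d0 : (0 < d)%N by have [_ Ahom _] := Ac; apply: prime_homog_gt0 AP Ahom.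
(* A prime factor of a rotated component has degree at least d, so it is the whole
   of it. *)
have /choice[B hB] i : exists B, [/\ prime_elt B, exact d (fun l => m (rot i l)) B & divides B h].
  have [g hE'] := Ah; rewrite mulrC in hE'.
  have [B [Bc Bh]] := permute_factor hp generic one_section h0 hc i Ac (esym hE').
  exists B; split=> //; have [B0 Bhom _] := Bc.
  have [q [e [n [qP qc qB]]]] := prime_factor_ex B0 Bhom d0.
  have ed : (d <= e)%N.
    by apply: dmin; apply/asboolP; exists q, n; split=> //; apply: divides_trans Bh.
  have [a BE] := qB; have Bc' := Bc; rewrite BE mulrC in Bc'.
  have [e' [n' [qc' _ e'd _]]] := exact_class_factor Bc'.
  have [ee _] := exact_class_uniq qc qc'.
  have de : d = e by apply/eqP; rewrite eqn_leq ed ee.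
  rewrite -de in qc; have [u uu ->] := full_factor Bc qc qB.
  exact: prime_mul_unit.
pose T n := (0 < n)%N && `[< (fun l => m (rot n l)) = m >].
have exT : exists n, T n.
  exists 10%N; rewrite /T /=; apply/asboolP; apply: funext => l.
  by rewrite -[10%N]muln1 rot_mul10.
have [N /andP[N0 /asboolP NE] Nmin] := ex_minnP exT.
have Nper l : m (rot N l) = m l by have := congr1 (fun F : 'I_10 -> nat => F l) NE.
(* Within a period the rotated components have different classes. *)
have inj i j : (i < N)%N -> (j < N)%N -> divides (B i) (B j) -> i = j.
  wlog ij : i j / (i <= j)%N => [wl li lj dij|].
    have [ij|ji] := leqP i j; first exact: wl.
    have [iP _ _] := hB i; have [jP _ _] := hB j.
    by apply/esym/wl => //; [apply: ltnW|apply: prime_divides_sym].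
  move=> li lj dij; have [iP ic _] := hB i; have [_ jc _] := hB j.
  have e := prime_same_class iP ic jc dij; apply/eqP; rewrite eqn_leq ij leqNgt.
  apply/negP => lt; have : (N <= j - i)%N.
    apply: Nmin; rewrite /T subn_gt0 lt; apply/asboolP; apply: funext => l.
    rewrite -{1}[l](rotKV i) rotD subnKC // -[in RHS](rotKV i l).
    by have := congr1 (fun F : 'I_10 -> nat => F (rot (9 * i) l)) e.
  by move: lj; clear; lia.
pose S l := (\sum_(i < N) m (rot i l))%N.
have Pc : exact (N * d) S (\prod_(i < N) B i).
  by apply: (exact_class_prod N (m := fun i l => m (rot i l))) => i; case: (hB i).
have Srot l : S (rot 1 l) = S l.
  case: (N) N0 Nper @S Pc => // k _ per S _; rewrite /S big_ord_recr big_ord_recl /= addnC.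
  congr (_ + _)%N.
    by rewrite rotD per; congr m; apply: val_inj; rewrite /= addn0 modn_small.
  by apply: eq_bigr => i _; rewrite rotD.
have Sconst l : S l = S ord0.
  have -> : l = rot l ord0 by apply: val_inj; rewrite /= add0n modn_small.
  elim: (l : nat) => [|k IH]; first by congr S; apply: val_inj.
  by rewrite -addn1 -rotD Srot.
have Ph : divides (\prod_(i < N) B i) h.
  by apply: distinct_primes_divides => // i _; have [iP _ ih] := hB i.
have := Pc; have -> : S = fun=> S ord0 by apply: funext.
move=> /(symmetric_factor hp generic one_section no_section h0 hc)/(_ Ph)[/eqP|Nd].
  by rewrite muln_eq0 (gtn_eqF N0) (gtn_eqF d0).
have N10 : (N %| 10)%N.
  have per k l : m (rot (N * k) l) = m l.
    elim: k l => [|k IH] l; first by rewrite muln0; congr m; apply: val_inj; rewrite /= addn0 modn_small.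
    by rewrite mulnS -rotD IH Nper.
  apply: contraT; rewrite /dvdn -lt0n => r0.
  have : (N <= 10 %% N)%N.
    apply: Nmin; rewrite /T r0; apply/asboolP; apply: funext => l.
    rewrite -(per (10 %/ N)%N) rotD addnC [(N * _)%N]mulnC -divn_eq.
    by rewrite -[10%N]muln1 rot_mul10.
  by rewrite leqNgt ltn_mod N0.
have N57 : (N %| 57)%N by rewrite -Nd dvdn_mulr.
have N1 : N = 1%N.
  by apply/eqP; rewrite -dvdn1 -[1%N]/(gcdn 10 57) dvdn_gcd N10.
rewrite N1 mul1n in Nd; rewrite Nd in Ac.
have [u uu ->] := full_factor hE Ac Ah.
exact: prime_mul_unit.
Qed.

End Irreducible.

(** * The linear system of the unique curve *)

Section UniqueCurve.
Variables (K : numClosedFieldType) (r : nat) (p : 'I_r -> 'rV[K]_3).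
Hypotheses (hp : distinct_points p) (r0 : (0 < r)%N).
Local Notation P := {mpoly K[3]}.
Local Notation X0 := ('X_ord0 : P).
Variables (d : nat) (m : 'I_r -> nat) (h : P).
Hypotheses (hc : exact_class p d m h) (h1 : ~ class_dim_ge p d m 2).

(** The divisor of [h] as a section of the line bundle of d H - sum_l m_l E_l. *)
Definition section_div : set 'M[K]_(r.+1, 3) -> int :=
  div_pullback p h - div_pullback p (X0 ^+ d) + div_class p d m.

Lemma section_div_ge0 G : 0 <= section_div G.
Proof. by have [h0 _ _] := hc; apply: form_section => //; apply: exact_in_class. Qed.

(** A member of the linear system is the divisor of a form of the class, which is
    a multiple of [h]. *)
Lemma section_linear_system : is_divisor p section_div ->
  complete_linear_system p (div_class p d m) = [set section_div].
Proof.
have [h0 hh _] := hc; have hin := exact_in_class hc.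
move=> hdiv; apply/seteqP; split=> C /=; last first.
  move->; split; first by split=> // G; apply: section_div_ge0.
  exists d, h, (X0 ^+ d); split; rewrite ?X0n_neq0 ?X0n_homog //.
  exact: addrK.
move=> [[_ C0] [k [f [g [f0 g0 fh gh CE]]]]].
have CE' : C = div_pullback p f - div_pullback p g + div_class p d m by rewrite -CE subrK.
have pos G : 0 <= (div_pullback p f - div_pullback p g + div_class p d m) G by rewrite -CE'.
have [h' h'c fE] := section_form hp r0 f0 g0 fh gh pos.
have [c h'E] := class_dim_lt2 h1 hin h'c h0.
have h'0 : h' != 0.
  by apply: contraNneq (mulf_neq0 f0 (X0n_neq0 K d)) => h'0; rewrite fE h'0 mul0r.
have c0 : c != 0 by apply: contraNneq h'0 => c0; rewrite h'E c0 scale0r.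
have dh' : div_pullback p h' = div_pullback p h.
  have cC : c%:MP != 0 :> P by rewrite mpolyC_eq0.
  have cH : (c%:MP : P) \is 0.-homog by rewrite -[c%:MP]mulr1 mul_mpolyC; apply/rpredZ/dhomog1.
  by rewrite h'E -mul_mpolyC (div_mul hp r0 cC h0 cH hh) (div_unit hp r0 cC cH) add0r.
have := congr1 (div_pullback p) fE.
rewrite (div_mul hp r0 f0 (X0n_neq0 K d) fh (X0n_homog K d)).
rewrite (div_mul hp r0 h'0 g0 (proj1 h'c) gh) dh' => e.
rewrite CE' /section_div; congr (_ + _).
by apply/eqP; rewrite subr_eq addrAC eq_sym subr_eq; apply/eqP.
Qed.

Hypothesis hP : prime_elt h.

Lemma section_divE G : section_div G = (`[< G = curve p h >] : nat)%:Z.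
Proof.
have [h0 hh hm] := hc.
rewrite /section_div !addrfctE opprfctE.
elim/(prime_divisor_ind hp r0): G => [q k qP qh|l|G nG].
- rewrite class_curve // subrK; case: asboolP => [->|ne].
    apply: (div_curve hp r0 hP hh hh); first by rewrite expr1; apply: divides_refl.
    move=> [a]; rewrite expr2 mulrA -{1}[h]mul1r => /(mulIf h0) e.
    by apply: (prime_not_unit hP (unitr1 _)); exists a.
  apply: (div_curve hp r0 qP qh hh); first by rewrite expr0; apply/divides_unit/unitr1.
  by rewrite expr1 => /(curve_assoc p qP hP).
- rewrite class_exc // addrA subrK (div_exceptional hp r0 hh (hm l)) subrr asboolF //.
  by move/esym; apply: curve_neq_exc.
- rewrite class_not_prime // !div_not_prime // asboolF // => e; apply: nG; rewrite e.
  exact: curve_prime_divisor hh.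
Qed.

Lemma section_div_is_divisor : is_divisor p section_div.
Proof.
have [h0 hh hm] := hc; split=> [|G].
  apply: (@sub_finite_set _ _ [set curve p h]); last exact: finite_set1.
  by move=> G /=; rewrite section_divE; case: asboolP.
rewrite section_divE; case: asboolP => // -> _.
exact: curve_prime_divisor hh.
Qed.

Lemma section_support : Defs.support section_div = curve p h.
Proof.
apply/seteqP; split=> M /=; rewrite /Defs.support /=.
  by move=> [G]; rewrite section_divE; case: asboolP => // ->.
by move=> hM; exists (curve p h) => //; rewrite section_divE asboolT.
Qed.

End UniqueCurve.

Theorem lemma5p7 (R : realType) (L : seq (nat * {ffun 'I_10 -> nat}))
    (hL : forall c, required_class c -> c \in L)
    (p : 'I_10 -> 'rV[R[i]]_3) (hp : general_points L p) :
  exists C : set 'M[R[i]]_(11, 3) -> int,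
    [/\ complete_linear_system p (- (divF p *+ 3)) = [set C],
        reduced_divisor C & irreducible_divisor p C].
Proof.
have [hpd hdim] := hp; have ten : (0 < 10)%N by [].
have generic (q : 'I_10 -> 'rV[R[i]]_3) d m n : distinct_points q -> admissible d m ->
    class_dim_ge p d m n -> class_dim_ge q d m n.
  move=> hq adm /(h0P d m n hpd ten) le; apply/(h0P d m n hq ten); apply: leq_trans le _.
  pose c : nat * {ffun 'I_10 -> nat} := (d, [ffun l => m l]).
  have mE : (c.2 : 'I_10 -> nat) = m by apply: funext => l; rewrite ffunE.
  have /hL cL : required_class c.
    case: adm => [[d57 m18]|[j [d57 mj]]]; [left|right].
      by split=> // l; rewrite mE.
    by exists j; rewrite /c d57; congr (_, _); apply/ffunP => l; rewrite !ffunE mj.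
  have := hdim c cL q hq; rewrite mE /dim_linear_system.
  by rewrite lerD2r lez_nat.
have [z prim] := primitive_root5 R[i].
have hs := special_distinct prim.
have one : ~ class_dim_ge p 57 (fun=> 18%N) 2.
  have adm : admissible 57 (fun=> 18%N) by left.
  by move/(generic _ _ _ _ hs adm)/(special_57_18 prim).
have none f : in_class p 19 (fun=> 6%N) f -> f = 0.
  move=> fc; apply: contrapT => /eqP f0.
  have adm : admissible 19 (fun=> 6%N) by left.
  have : class_dim_ge p 19 (fun=> 6%N) 1 by apply/class_dim_ge1; exists f.
  move/(generic _ _ _ _ hs adm)/class_dim_ge1 => -[g g0 /(special_19_6 prim) g0'].
  by move: g0; rewrite g0' eqxx.
have [h h0 hc] := section_ex hpd.
have hE := section_exact hpd generic one h0 hc.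
have hP := section_prime hpd generic one none h0 hc.
exists (section_div p 57 (fun=> 18%N) h); split.
- rewrite -(section_linear_system hpd ten hE one); last exact: section_div_is_divisor.
  congr complete_linear_system; rewrite /divF /div_class sumrMnl.
  by rewrite mulrnDl mulNrn -!mulrnA opprD opprK.
- by move=> G; rewrite (section_divE hpd ten hE hP); case: asboolP.
- rewrite /irreducible_divisor (section_support hpd ten hE hP).
  exact: curve_irreducible.
Qed.
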